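(* Let $\mathbb{K}$ be $\mathbb{R}$ or $\mathbb{C}$, let $S\subset\mathbb{K}^n$ be a set consisting of $r$ distinct points, and let $f:(\mathbb{K}^n,S)\rightarrow(\mathbb{K}^p,0)$ be a finitely $\mathcal{L}$-determined multigerm. Then the set $\mathrm{Lower}(f)$ of lowerable vector fields for $f$ is finitely generated as a $C_{p,0}$-module via $f$.
   Context: All mappings are smooth, meaning of class $C^\infty$ if $\mathbb{K}=\mathbb{R}$ and holomorphic if $\mathbb{K}=\mathbb{C}$. A multigerm is a map-germ $f:(\mathbb{K}^n,S)\rightarrow(\mathbb{K}^p,0)$ where $S$ is a set of $r$ distinct points of $\mathbb{K}^n$ (so every point of $S$ is sent to $0$); it can be identified with the collection of its branches $\{f_k:(\mathbb{K}^n,0)\rightarrow(\mathbb{K}^p,0)\mid 1\le k\le r\}$. $C_{n,S}$ (resp. $C_{p,0}$) is the $\mathbb{K}$-algebra of function-germs $(\mathbb{K}^n,S)\rightarrow\mathbb{K}$ (resp. $(\mathbb{K}^p,0)\rightarrow\mathbb{K}$). For a non-negative integer $i$, $m_{n,S}^i\subset C_{n,S}$ is the set of function-germs $(\mathbb{K}^n,S)\rightarrow\mathbb{K}$ whose Taylor series (at each point of $S$) has zero terms up to degree $i-1$. $\theta_{n,S}(f)$ is the $C_{n,S}$-module of germs (at $S$) of vector fields along $f$, identified with the direct sum of $p$ copies of $C_{n,S}$. $\theta_S(n)=\theta_{n,S}(\mathrm{id}_{(\mathbb{K}^n,S)})$ and $\theta_0(p)=\theta_{p,\{0\}}(\mathrm{id}_{(\mathbb{K}^p,0)})$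 are the modules of germs of vector fields on $(\mathbb{K}^n,S)$ and $(\mathbb{K}^p,0)$. Define $tf:\theta_S(n)\rightarrow\theta_{n,S}(f)$ by $tf(\xi)=df\circ\xi$, where $df$ is the differential of $f$, and $\omega f:\theta_0(p)\rightarrow\theta_{n,S}(f)$ by $\omega f(\eta)=\eta\circ f$. Set $T\mathcal{R}_e(f)=tf(\theta_S(n))$ and $T\mathcal{L}_e(f)=\omega f(\theta_0(p))$. A vector field $\xi\in\theta_S(n)$ is said to be lowerable (for $f$) if $df\circ\xi\in T\mathcal{R}_e(f)\cap T\mathcal{L}_e(f)$; the set of lowerable vector fields is denoted $\mathrm{Lower}(f)$. It has a $C_{p,0}$-module structure via $f$, namely $\psi\cdot\xi=(\psi\circ f)\,\xi$ for $\psi\in C_{p,0}$. The multigerm $f$ is said to be finitely $\mathcal{L}$-determined if there exists a positive integer $\ell$ such that $m_{n,S}^\ell\theta_{n,S}(f)\subset T\mathcal{L}_e(f)$. *)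

(* Defs.v *)
From HB Require Import structures.
From mathcomp Require Import all_boot all_order all_algebra complex.
From mathcomp Require Import all_classical all_reals all_analysis.

Set Implicit Arguments.
Unset Strict Implicit.
Unset Printing Implicit Defensive.

Import Order.TTheory GRing.Theory Num.Theory.
Import numFieldNormedType.Exports.

Local Open Scope classical_set_scope.
Local Open Scope ring_scope.

Variant base_field := RealField | ComplexField.

(* K = R or K = C = R[i]; the topology and the norm of K and of 'rV[K]_n, and
   hence limits and differentials, are those induced by the absolute value. *)
Definition scalars (R : realType) (b : base_field) : numFieldType :=
  match b with
  | RealField => R
  | ComplexField => R[i]%C
  end.

Section Smoothness.
Context {K : numFieldType} {n : nat}.
Implicit Types (U : set 'rV[K]_n) (g : 'rV[K]_n -> K).

Definition basis_vec (i : 'I_n) : 'rV[K]_n := delta_mx 0 i.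

(* iter_partial [:: i1; ...; ik] g is d/dx_i1 (... (d/dx_ik g)); derivatives
   which do not exist take an unspecified value. *)
Definition iter_partial (s : seq 'I_n) g : 'rV[K]_n -> K :=
  foldr (fun i h => 'D_(basis_vec i) h) g s.

(* On an open set U: all partial derivatives of all orders exist and are
   continuous. *)
Definition C_infty_on U g : Prop :=
  forall (s : seq 'I_n) (x : 'rV[K]_n), U x ->
    {for x, continuous (iter_partial s g)} /\
    (forall i, derivable (iter_partial s g) x (basis_vec i)).

(* [differentiable] asks for a K-linear differential, so that for K = C this is
   complex differentiability at every point of U. *)
Definition holomorphic_on U g : Prop :=
  forall x, U x -> differentiable g x.

End Smoothness.

Definition smooth_on (R : realType) (b : base_field) :
    forall n : nat, set 'rV[scalars R b]_n ->
      ('rV[scalars R b]_n -> scalars R b) -> Prop :=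
  match b with
  | RealField => fun n => @C_infty_on R n
  | ComplexField => fun n => @holomorphic_on R[i]%C n
  end.

(* Germs at S are handled through representatives, i.e. total functions that
   are only meaningful near S; two representatives define the same germ when
   they satisfy [germ_eq S]. *)
Section Germs.
Context {R : realType} {b : base_field}.
Local Notation K := (scalars R b).

Definition germ_eq {n : nat} {T : Type} (S : set 'rV[K]_n)
    (g h : 'rV[K]_n -> T) : Prop :=
  forall y, S y -> \forall x \near y, g x = h x.

(* C_{n,S} *)
Definition function_germ {n : nat} (S : set 'rV[K]_n) :
    set ('rV[K]_n -> K) :=
  [set g | exists U, [/\ open U, S `<=` U & smooth_on U g]].

Definition smooth_map_germ {n p : nat} (S : set 'rV[K]_n)
    (f : 'rV[K]_n -> 'rV[K]_p) : Prop :=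
  forall j : 'I_p, function_germ S (fun x => f x 0 j).

Definition multigerm {n p : nat} (S : set 'rV[K]_n)
    (f : 'rV[K]_n -> 'rV[K]_p) : Prop :=
  smooth_map_germ S f /\ (forall x, S x -> f x = 0).

(* m_{n,S}^i: up to the nonzero factors alpha!, the Taylor coefficients of
   degree < i are the partial derivatives of order < i. *)
Definition m_pow {n : nat} (S : set 'rV[K]_n) (i : nat) :
    set ('rV[K]_n -> K) :=
  [set g | function_germ S g /\
     forall s : seq 'I_n, (size s < i)%N ->
       forall x, S x -> iter_partial s g x = 0].

(* theta_{n,S}(f): under the identification with the direct sum of p copies of
   C_{n,S}, it depends on f only through n and p. *)
Definition theta {n p : nat} (S : set 'rV[K]_n)
    (f : 'rV[K]_n -> 'rV[K]_p) : set ('rV[K]_n -> 'rV[K]_p) :=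
  [set zeta | smooth_map_germ S zeta].

(* m_{n,S}^i theta_{n,S}(f): finite sums of products *)
Definition m_pow_theta {n p : nat} (S : set 'rV[K]_n)
    (f : 'rV[K]_n -> 'rV[K]_p) (i : nat) : set ('rV[K]_n -> 'rV[K]_p) :=
  [set zeta | exists (N : nat) (a : 'I_N -> 'rV[K]_n -> K)
                     (eta : 'I_N -> 'rV[K]_n -> 'rV[K]_p),
     [/\ forall k, m_pow S i (a k),
         forall k, theta S f (eta k) &
         germ_eq S zeta (fun x => \sum_(k < N) a k x *: eta k x)]].

Definition tf {n p : nat} (f : 'rV[K]_n -> 'rV[K]_p)
    (xi : 'rV[K]_n -> 'rV[K]_n) : 'rV[K]_n -> 'rV[K]_p :=
  fun x => 'd f x (xi x).

Definition omegaf {n p : nat} (f : 'rV[K]_n -> 'rV[K]_p)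
    (eta : 'rV[K]_p -> 'rV[K]_p) : 'rV[K]_n -> 'rV[K]_p :=
  eta \o f.

Definition TRe {n p : nat} (S : set 'rV[K]_n) (f : 'rV[K]_n -> 'rV[K]_p) :
    set ('rV[K]_n -> 'rV[K]_p) :=
  [set zeta | exists2 xi, theta S id xi & germ_eq S zeta (tf f xi)].

Definition TLe {n p : nat} (S : set 'rV[K]_n) (f : 'rV[K]_n -> 'rV[K]_p) :
    set ('rV[K]_n -> 'rV[K]_p) :=
  [set zeta | exists2 eta, theta [set 0] id eta & germ_eq S zeta (omegaf f eta)].

Definition Lower {n p : nat} (S : set 'rV[K]_n) (f : 'rV[K]_n -> 'rV[K]_p) :
    set ('rV[K]_n -> 'rV[K]_n) :=
  [set xi | theta S id xi /\ (TRe S f `&` TLe S f) (tf f xi)].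

Definition finitely_L_determined {n p : nat} (S : set 'rV[K]_n)
    (f : 'rV[K]_n -> 'rV[K]_p) : Prop :=
  exists2 l : nat, (0 < l)%N & m_pow_theta S f l `<=` TLe S f.

(* The C_{p,0}-module structure via f *)
Definition act_via {n p : nat} (f : 'rV[K]_n -> 'rV[K]_p)
    (psi : 'rV[K]_p -> K) (xi : 'rV[K]_n -> 'rV[K]_n) :
    'rV[K]_n -> 'rV[K]_n :=
  fun x => psi (f x) *: xi x.

(* M is the C_{p,0}-submodule, for the structure via f, generated by finitely
   many of its elements. *)
Definition finitely_generated_via {n p : nat} (S : set 'rV[K]_n)
    (f : 'rV[K]_n -> 'rV[K]_p) (M : set ('rV[K]_n -> 'rV[K]_n)) : Prop :=
  exists (N : nat) (e : 'I_N -> 'rV[K]_n -> 'rV[K]_n),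
    (forall k, M (e k)) /\
    (forall xi, M xi <->
       exists2 psi : 'I_N -> 'rV[K]_p -> K,
         forall k, function_germ [set 0] (psi k) &
         germ_eq S xi (fun x => \sum_(k < N) act_via f (psi k) (e k) x)).

End Germs.

(* Main.v *)
(* Since p > 0, finite L-determinacy says that every function germ h in
   m_{n,S}^l is a pullback psi \o f (look at one component of h e_j).  As
   C_{n,S}/m_{n,S}^l is finite dimensional, C_{n,S} is then generated over
   C_{p,0} by finitely many germs u_k, 1 among them.  By Hadamard's lemma
   m_{n,S}^l is generated as an ideal by finitely many monomials mu_w, hence as a
   C_{p,0}-module by the products mu_w u_k.  Finally Lower(f) contains
   m_{n,S}^l theta_S(n), with a quotient of finite dimension, so no preparation
   theorem is needed.

   Hadamard's lemma is proved at once over R and C for functions all of whose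
   iterated partial derivatives exist and are continuous; over C these are the
   holomorphic functions, by Goursat's theorem and Cauchy's estimate. *)
Require Import Defs.
From HB Require Import structures.
From mathcomp Require Import all_boot all_order all_algebra complex.
From mathcomp Require Import all_classical all_reals all_analysis.
From mathcomp Require Import ring lra.

Set Implicit Arguments.
Unset Strict Implicit.
Unset Printing Implicit Defensive.

Import Order.TTheory GRing.Theory Num.Theory.
Import numFieldNormedType.Exports.

Local Open Scope classical_set_scope.
Local Open Scope ring_scope.

(** Hadamard's lemma is usually proved by integrating partial derivatives along a segment, and its
    quotients are shown smooth by differentiating under the integral sign. Here the quotients by
    powers of a coordinate are studied directly through Taylor estimates, whose only analytic input
    is [mean_value_inequality], valid over both fields. Over C the gap is that holomorphy means
    complex differentiability at each point, so iterated derivatives have to be produced. Cauchy's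
    inequality for a first derivative suffices: applied to increments, it gives Lipschitz bounds for
    the partial derivatives and a Cauchy criterion for their difference quotients.

    Finite-dimensional quotients are harmless because constants are germs at the target. The
    condition [0 < p] is essential: for [p = 0] determinacy holds trivially, the germs at the target
    are the constants, and every germ of vector field is lowerable, an infinite-dimensional space as
    soon as [n > 0] and [S] is nonempty. *)

(** * Directional derivatives and the mean value inequality *)

(* The factor 2 allows for K = C, where real and imaginary parts are estimated
   separately; 0 <= t <= 1 then forces t to be real. *)
Definition mean_value_inequality (K : numFieldType) : Prop :=
  forall (phi dphi : K -> K) (M : K),
    (forall t : K, 0 <= t <= 1 -> is_derive t 1 phi (dphi t)) ->
    (forall t : K, 0 <= t <= 1 -> `|dphi t| <= M) ->
    `|phi 1 - phi 0| <= 2 * M.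

Section Directional.
Context {K : numFieldType} {V : normedModType K}.
Implicit Types (g : V -> K) (x v : V).

Lemma nearPadd x (P : V -> Prop) :
  (\forall y \near x, P y) <->
  exists2 r : K, 0 < r & forall h, `|h| < r -> P (x + h).
Proof.
split=> [/nbhs_ballP [r /= r0 rP]|[r r0 rP]].
  exists r => // h hr; apply: rP.
  by rewrite -ball_normE /= opprD addNKr normrN.
apply/nbhs_ballP; exists r => //= y; rewrite -ball_normE /= distrC => yr.
by rewrite -[y](subrK x) addrC; exact: rP.
Qed.

(** Multiplying the difference quotient by [h] removes the division and the punctured neighbourhood:
    at [h = 0] both sides of the inequality are 0. *)
Lemma is_deriveP g x v (d : K) :
  is_derive x v g d <->
  forall e, 0 < e -> \forall h \near (0 : K),
    `|g (x + h *: v) - g x - h * d| <= e * `|h|.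
Proof.
have cvgE : is_derive x v g d <->
    (h^-1 *: ((g \o shift x) (h *: v) - g x)) @[h --> 0^'] --> d.
  split=> [[dg <-]//|cg]; split; first by apply/cvg_ex; exists d.
  exact: cvg_lim cg.
apply: iff_trans cvgE _; rewrite cvgrPdist_le; split=> cg e e0.
- have := cg _ e0; rewrite near_withinE; apply: filterS => h.
  have [->|h0 /(_ isT)] := eqVneq h 0.
    by move=> _; rewrite scale0r addr0 mul0r !subrr normr0 mulr0.
  rewrite /= [x + _]addrC => H.
  have -> : g (h *: v + x) - g x - h * d =
      - (h * (d - h^-1 *: (g (h *: v + x) - g x))).
    by rewrite /GRing.scale /= mulrBr mulVKf // opprB.
  by rewrite normrN normrM mulrC ler_wpM2r.
- rewrite near_withinE; have := cg _ e0; apply: filterS => h H h0 /=.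
  rewrite -(ler_pM2r (_ : 0 < `|h|)) ?normr_gt0 //.
  apply: le_trans H; rewrite -normrM -normrN [h *: v + x]addrC.
  rewrite /GRing.scale /= mulrBl mulrAC mulVf // mul1r opprB.
  by rewrite [d * h]mulrC.
Qed.

End Directional.

Section MeanValue.
Context {K : numFieldType} {V : normedModType K}.
Implicit Types (g : V -> K) (x v : V).

Lemma is_derive_line g x v (t d : K) :
  is_derive (x + t *: v) v g d ->
  is_derive t 1 (fun s : K => g (x + s *: v)) d.
Proof.
move=> [dg <-].
have E : (fun h : K => h^-1 *: (g (x + (h *: 1 + t) *: v) - g (x + t *: v)))
  = (fun h : K => h^-1 *: (g (h *: v + (x + t *: v)) - g (x + t *: v))).
  apply/funext => h; congr (_ *: (g _ - _)).
  by rewrite scalerDl /GRing.scale /= mulr1 addrCA.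
by split; rewrite /derivable /derive /= E.
Qed.

Lemma is_derive_scale_dir g x v (c d : K) :
  is_derive x v g d -> is_derive x (c *: v) g (c * d).
Proof.
have [->|c0] := eqVneq c 0.
  by rewrite scale0r mul0r => _; exact: is_derive0.
move=> /is_deriveP dg; apply/is_deriveP => e e0.
have /dg/nbhs_ballP [r /= r0 rP] : 0 < e / `|c| by rewrite divr_gt0 ?normr_gt0.
apply/nbhs_ballP; exists (r / `|c|); first by rewrite /= divr_gt0 ?normr_gt0.
move=> h /=; rewrite -ball_normE /= sub0r normrN => hr.
have : ball 0 r (h * c).
  by rewrite -ball_normE /= sub0r normrN normrM -ltr_pdivlMr ?normr_gt0.
move=> /rP /=; rewrite scalerA mulrA => H; apply: le_trans H _.
by rewrite normrM [`|h| * _]mulrC mulrA divfK // normr_eq0.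
Qed.

(** The mean value inequality is applied to the restriction of [g] to the segment minus [t * l], so
    that the oscillation of the derivative about [l] controls a first order remainder. *)
Lemma mean_value_line (Kmvi : mean_value_inequality K) g x v (l M : K) :
  (forall t : K, 0 <= t <= 1 -> derivable g (x + t *: v) v /\
     `|'D_v g (x + t *: v) - l| <= M) ->
  `|g (x + v) - g x - l| <= 2 * M.
Proof.
move=> H.
have := Kmvi (fun t => g (x + t *: v) - t * l)
  (fun t => 'D_v g (x + t *: v) - l) M.
rewrite scale1r mul1r scale0r addr0 mul0r subr0.
have -> : g (x + v) - l - g x = g (x + v) - g x - l by rewrite addrAC.
apply=> t /H [] // dg _.
have d1 := is_derive_line (derivableP dg).
have d2 : is_derive t 1 (fun s : K => s * l) l.
  apply/is_deriveP => e e0; near=> h.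
  rewrite /GRing.scale /= mulr1 mulrDl [t * l + _]addrC addrK subrr normr0.
  by rewrite mulr_ge0 // ltW.
by have := is_deriveB d1 d2.
Unshelve. all: by end_near. Qed.

Lemma mean_value_dir (Kmvi : mean_value_inequality K) g x v (c l M : K) :
  (forall t : K, 0 <= t <= 1 -> derivable g (x + (t * c) *: v) v /\
     `|'D_v g (x + (t * c) *: v) - l| <= M) ->
  `|g (x + c *: v) - g x - c * l| <= 2 * M * `|c|.
Proof.
move=> H; rewrite -mulrA; apply: mean_value_line => // t /H [dg le].
have [d1 d2] := is_derive_scale_dir c (derivableP dg).
rewrite scalerA; split => //.
by rewrite d2 -mulrBr normrM mulrC ler_wpM2r.
Qed.

Lemma differentiable_remainder (W : normedModType K) (f : V -> W) x
    (L : {linear V -> W}) :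
  continuous L ->
  (forall e : K, 0 < e -> \forall h \near (0 : V),
     `|f (h + x) - f x - L h| <= e * `|h|) ->
  differentiable f x /\ 'd f x = L :> (V -> W).
Proof.
move=> Lc fL.
have E : f \o shift x = cst (f x) + L +o_ (0:V) id.
  apply/eqaddoP => e e0; have := fL _ e0; apply: filterS => h.
  by rewrite -addrA -opprD.
have dE := diff_unique Lc E.
by split => //; apply/diff_locallyP; rewrite dE.
Qed.

End MeanValue.

Lemma near_forall_ord (T : Type) (F : set_system T) (n : nat)
    (P : 'I_n -> T -> Prop) : Filter F ->
  (forall i, \forall x \near F, P i x) -> \forall x \near F, forall i, P i x.
Proof. by move=> FF H; exact: (@filter_forall _ 'I_n P F FF H). Qed.

(** * Coordinates, the sup norm and coordinate paths *)

Section Coordinates.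
Context {K : numFieldType} {n : nat}.
Implicit Types (h x : 'rV[K]_n).

Lemma norm_coord_le h i : `|h 0 i| <= `|h|.
Proof.
have -> : `|h| = mx_norm h by []; rewrite mx_normE.
have : (`|h 0 i|%:nng <= \big[Order.max/0%:nng]_(j : 'I_1 * 'I_n) `|h j.1 j.2|%:nng)%O.
  exact: (le_bigmax _ (fun j : 'I_1 * 'I_n => `|h j.1 j.2|%:nng) (0, i)).
by [].
Qed.

Lemma norm_le_coord h (r : K) : 0 <= r -> (forall i, `|h 0 i| <= r) -> `|h| <= r.
Proof.
move=> r0 H; have -> : `|h| = mx_norm h by [].
by have [->//|/mx_norm_neq0 [[i j] /= ->]] := eqVneq (mx_norm h) 0; rewrite ord1.
Qed.

Lemma norm_basis_vec (c : K) (i : 'I_n) : `|c *: basis_vec i| = `|c| :> K.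
Proof.
apply/eqP; rewrite eq_le; apply/andP; split.
  apply: norm_le_coord => // j; rewrite !mxE eqxx /=.
  by case: eqP => _; rewrite ?mulr1 // mulr0 normr0.
have := norm_coord_le (c *: basis_vec i) i.
by rewrite !mxE !eqxx mulr1.
Qed.

(** Corner number [k] of the path from 0 to [h] that moves one coordinate at a time, so that partial
    derivatives control the whole increment. *)
Definition truncate_vec h (k : nat) : 'rV[K]_n :=
  \row_j (if (j < k)%N then h 0 j else 0).

Lemma truncate_vec0 h : truncate_vec h 0 = 0.
Proof. by apply/rowP => j; rewrite !mxE. Qed.

Lemma truncate_vecn h : truncate_vec h n = h.
Proof. by apply/rowP => j; rewrite !mxE ltn_ord. Qed.

Lemma truncate_vecS h (i : 'I_n) :
  truncate_vec h i.+1 = truncate_vec h i + h 0 i *: basis_vec i.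
Proof.
apply/rowP => j; rewrite !mxE eqxx /= ltnS leq_eqVlt.
have [/val_inj->|] /= := eqVneq (j : nat) i.
  by rewrite ltnn eqxx mulr1 add0r.
rewrite -val_eqE => /negPf ->; by rewrite mulr0 addr0.
Qed.

(** For the sup norm the coordinate path never leaves the closed ball of radius [|h|], so estimates
    valid near [x] hold all along it. *)
Lemma truncate_vec_step_norm h (i : 'I_n) (t : K) : 0 <= t <= 1 ->
  `|truncate_vec h i + (t * h 0 i) *: basis_vec i| <= `|h|.
Proof.
move=> /andP [t0 t1]; apply: norm_le_coord => // j.
rewrite !mxE eqxx /=; have [->|ij] := eqVneq j i.
  rewrite ltnn add0r mulr1 normrM ger0_norm //.
  by apply: le_trans (norm_coord_le h i); rewrite ler_piMl.
rewrite mulr0 addr0; case: ifP => _; first exact: norm_coord_le.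
by rewrite normr0.
Qed.

Lemma telescope_truncate (W : zmodType) (g : 'rV[K]_n -> W) x h :
  g (x + h) - g x =
  \sum_(i < n) (g (x + truncate_vec h i.+1) - g (x + truncate_vec h i)).
Proof.
have := telescope_sumr (fun k => g (x + truncate_vec h k)) (leq0n n).
by rewrite big_mkord truncate_vecn truncate_vec0 addr0 => <-.
Qed.

Definition linear_form (c : 'I_n -> K) (h : 'rV[K]_n) : K := \sum_i h 0 i * c i.

Lemma linear_form_is_linear c : linear (linear_form c).
Proof.
move=> a u v; rewrite /linear_form scaler_sumr -big_split /=.
by apply: eq_bigr => i _; rewrite !mxE mulrDl -mulrA.
Qed.
HB.instance Definition _ c :=
  GRing.isLinear.Build K 'rV[K]_n K *:%R (linear_form c) (linear_form_is_linear c).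

Lemma linear_form_continuous c : continuous (linear_form c : _ -> K).
Proof.
apply: (@continuous_big _ _ +%R 0) => [|i _ x]; first exact: add_continuous.
have cx := @coord_continuous K 1 n 0 i x.
exact: (cvgMr_tmp cx).
Qed.

End Coordinates.

Section Partials.
Context {K : numFieldType} (Kmvi : mean_value_inequality K) {n : nat}.
Implicit Types (g : 'rV[K]_n -> K) (x : 'rV[K]_n).
Local Notation ee := basis_vec.

(** The increment is telescoped along the coordinate path; on each leg the mean value inequality
    compares it with the partial derivative at [x], and continuity of that derivative bounds the
    error. *)
Lemma partials_differentiable g x :
  (forall i : 'I_n, \forall y \near x, derivable g y (ee i)) ->
  (forall i, {for x, continuous ('D_(ee i) g)}) ->
  differentiable g x /\
  'd g x = linear_form (fun i => 'D_(ee i) g x) :> ('rV[K]_n -> K).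
Proof.
move=> dg cg; apply: differentiable_remainder; first exact: linear_form_continuous.
move=> e e0.
(* Each of the [n] legs contributes at most [2 * d * |h|]; [n.+1] keeps the denominator nonzero when
   [n = 0]. *)
pose d := e / (2 * n.+1%:R).
have d0 : 0 < d by rewrite divr_gt0 // mulr_gt0.
have H (i : 'I_n) : \forall y \near x,
    derivable g y (ee i) /\ `|'D_(ee i) g y - 'D_(ee i) g x| <= d.
  near=> y; split; first by near: y; exact: dg.
  rewrite distrC; near: y; have /cvgrPdist_le := cg i; exact.
have /nearPadd [r r0 rP] : \forall y \near x, forall i : 'I_n,
    derivable g y (ee i) /\ `|'D_(ee i) g y - 'D_(ee i) g x| <= d.
  exact: near_forall_ord H.
apply/nearPadd; exists r => // h hr; rewrite add0r [h + x]addrC.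
rewrite telescope_truncate /linear_form -sumrB.
apply: le_trans (ler_norm_sum _ _ _) _.
apply: (@le_trans _ _ (\sum_(i < n) (2 * d * `|h|))).
  apply: ler_sum => i _; rewrite truncate_vecS addrA.
  apply: le_trans (mean_value_dir (M := d) Kmvi _) _ => [t t01|]; last first.
    by apply: ler_wpM2l; rewrite ?norm_coord_le // mulr_ge0 // ltW.
  by rewrite -addrA; apply: rP; apply: le_lt_trans hr; exact: truncate_vec_step_norm.
rewrite sumr_const card_ord -[leLHS]mulr_natr mulrAC; apply: ler_wpM2r => //.
have -> : 2 * d * n%:R = e * (n%:R / n.+1%:R).
  by rewrite /d; field; rewrite ?natr1 ?nat1r ?[1 + _]addrC ?natr1 pnatr_eq0.
by rewrite ler_piMr ?ltW // ltr_pdivrMr // mul1r ltr_nat.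
Unshelve. all: by end_near. Qed.

End Partials.

Lemma is_derive_translate (K : numFieldType) (V : normedModType K) (g : V -> K)
    (x v w : V) (d : K) :
  is_derive (x + w) v g d -> is_derive x v (fun y => g (y + w)) d.
Proof.
move=> /is_deriveP H; apply/is_deriveP => e /H; apply: filterS => h.
by rewrite [x + _ + w]addrAC.
Qed.

(** * Symmetry of second partial derivatives *)

Section Schwarz.
Context {K : numFieldType} (Kmvi : mean_value_inequality K) {n : nat}.
Implicit Types (g : 'rV[K]_n -> K) (x : 'rV[K]_n).
Local Notation ee := basis_vec.

Let second_difference g x i j (s t : K) :=
  g (x + s *: (ee i) + t *: (ee j)) - g (x + s *: (ee i)) - (g (x + t *: (ee j)) - g x).

(** Two nested mean value inequalities, each with its factor 2: first in direction [i] for the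
    increment of [g] along [t *: ee j], whose derivative is an increment of ['D_(ee i) g]; then in
    direction [j] for that increment. *)
Let second_difference_mvi g x i j (r e : K) :
  (forall h, `|h| < r ->
    [/\ derivable g (x + h) (ee i), derivable ('D_(ee i) g) (x + h) (ee j) &
        `|'D_(ee j) ('D_(ee i) g) (x + h) - 'D_(ee j) ('D_(ee i) g) x| <= e]) ->
  forall s t : K, `|s| + `|t| < r ->
  `|second_difference g x i j s t - s * (t * 'D_(ee j) ('D_(ee i) g) x)|
    <= 4 * e * `|s| * `|t|.
Proof.
move=> H s t st.
pose G y := g (y + t *: (ee j)) - g y.
have := @mean_value_dir K _ Kmvi G x (ee i) s (t * 'D_(ee j) ('D_(ee i) g) x)
  (2 * e * `|t|).
have -> : 4 * e * `|s| * `|t| = 2 * (2 * e * `|t|) * `|s| by ring.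
apply=> c /andP [c0 c1].
have cs : `|(c * s) *: (ee i)| <= `|s|.
  by rewrite norm_basis_vec normrM ger0_norm // ler_piMl.
have [|d1 _ _] := H ((c * s) *: (ee i)).
  by apply: le_lt_trans cs _; apply: le_lt_trans st; rewrite lerDl.
have [|d2 _ _] := H ((c * s) *: (ee i) + t *: (ee j)).
  apply: le_lt_trans st; apply: le_trans (ler_normD _ _) _.
  by rewrite lerD // norm_basis_vec.
rewrite addrA in d2.
have dG := is_deriveB (is_derive_translate (derivableP d2)) (derivableP d1).
have [dG1 ->] : is_derive (x + (c * s) *: (ee i)) (ee i) G
  ('D_(ee i) g (x + (c * s) *: (ee i) + t *: (ee j)) - 'D_(ee i) g (x + (c * s) *: (ee i)))
  by exact: dG.
split; first exact: dG1.
apply: (@mean_value_dir K _ Kmvi ('D_(ee i) g)) => c' /andP [c'0 c'1].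
rewrite -addrA; have [|_ d3 d4] := H ((c * s) *: (ee i) + (c' * t) *: (ee j)); last by split.
apply: le_lt_trans st; apply: le_trans (ler_normD _ _) _.
by rewrite lerD // norm_basis_vec normrM ger0_norm // ler_piMl.
Qed.

(** The second difference is symmetric in the two directions, and after division by [s * s] it is
    close to either mixed derivative. *)
Lemma partials_commute g x i j :
  (forall k l : 'I_n, {for x, continuous ('D_(ee l) ('D_(ee k) g))} /\
    \forall y \near x, derivable g y (ee k) /\ derivable ('D_(ee k) g) y (ee l)) ->
  'D_(ee j) ('D_(ee i) g) x = 'D_(ee i) ('D_(ee j) g) x.
Proof.
move=> H; apply/eqP; rewrite -subr_eq0 -normr_le0; apply/ler_addgt0Pr => e e0.
rewrite add0r.
(* Comparing either mixed derivative with the second difference costs [4 * (e / 8)] times [s * s];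
   the two costs add up to [e * s * s]. *)
have e8 : 0 < e / 8 by rewrite divr_gt0.
have Hk k l : \forall y \near x, [/\ derivable g y (ee k),
    derivable ('D_(ee k) g) y (ee l) &
    `|'D_(ee l) ('D_(ee k) g) y - 'D_(ee l) ('D_(ee k) g) x| <= e / 8].
  have [/cvgrPdist_le/(_ _ e8) c1 c2] := H k l.
  apply: filterS2 c1 c2 => y H1 [H2 H3].
  by rewrite distrC in H1; split; [exact: H2|exact: H3|exact: H1].
have /nearPadd [r r0 rP] : \forall y \near x,
    [/\ derivable g y (ee i), derivable ('D_(ee i) g) y (ee j) &
        `|'D_(ee j) ('D_(ee i) g) y - 'D_(ee j) ('D_(ee i) g) x| <= e / 8] /\
    [/\ derivable g y (ee j), derivable ('D_(ee j) g) y (ee i) &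
        `|'D_(ee i) ('D_(ee j) g) y - 'D_(ee i) ('D_(ee j) g) x| <= e / 8].
  by apply: filterI; exact: Hk.
pose s := r / 4.
have s0 : 0 < s by rewrite divr_gt0.
have ss : `|s| + `|s| < r.
  rewrite gtr0_norm // /s (_ : r / 4 + r / 4 = r / 2); last by field.
  by rewrite ltr_pdivrMr // ltr_pMr // ltr1n.
have A := second_difference_mvi (fun h hr => (rP h hr).1) ss.
have B := second_difference_mvi (fun h hr => (rP h hr).2) ss.
have E : second_difference g x j i s s = second_difference g x i j s s.
  rewrite /second_difference [x + _ + _]addrAC.
  by rewrite opprB opprB addrACA [RHS]addrACA [- _ - _]addrC.
rewrite E in B; clear E Hk H rP; move: A B.
move: (second_difference g x i j s s) => d.
move: ('D_(ee j) ('D_(ee i) g) x) ('D_(ee i) ('D_(ee j) g) x) => a b A B.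
rewrite -(@ler_pM2l _ (s * s)) ?mulr_gt0 //.
have -> : s * s * e = 4 * (e / 8) * `|s| * `|s| + 4 * (e / 8) * `|s| * `|s|.
  by rewrite gtr0_norm //; field.
rewrite -{1}[s * s]gtr0_norm ?mulr_gt0 // -normrM.
apply: le_trans (lerD B A); rewrite [X in _ <= X + _]distrC.
apply: le_trans _ (ler_normD _ _); rewrite addrA subrK [leRHS]distrC.
by rewrite mulrBr !mulrA.
Qed.

End Schwarz.

(** * Smooth functions *)

Section SmoothFunctions.
Context {K : numFieldType} {n : nat}.
Implicit Types (U : set 'rV[K]_n) (g h : 'rV[K]_n -> K) (x : 'rV[K]_n).
Local Notation ee := basis_vec.

Lemma iter_partial_rcons s (i : 'I_n) g :
  iter_partial (rcons s i) g = iter_partial s ('D_(ee i) g).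
Proof. by rewrite /iter_partial foldr_rcons. Qed.

Lemma iter_partial_near s g h x : (\forall y \near x, g y = h y) ->
  \forall y \near x, iter_partial s g y = iter_partial s h y.
Proof.
move=> gh; elim: s => [//|i s IH] /=.
have := nbhs_interior IH; apply: filterS => y H.
exact: (near_eq_derive (basis_vec i) H).
Qed.

Lemma near_continuous g h x : (\forall y \near x, g y = h y) ->
  {for x, continuous g} -> {for x, continuous h}.
Proof.
move=> gh; rewrite /prop_for /continuous_at -(nbhs_singleton gh).
exact: cvg_trans (near_eq_cvg gh).
Qed.

Lemma C_infty_on_eq U g h : open U -> (forall x, U x -> g x = h x) ->
  C_infty_on U g -> C_infty_on U h.
Proof.
move=> oU gh Cg s x Ux.
have nE : \forall y \near x, iter_partial s g y = iter_partial s h y.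
  apply: iter_partial_near; have : nbhs x U by exact: open_nbhs_nbhs.
  by apply: filterS => y /gh.
have [cg dg] := Cg s x Ux; split; first exact: near_continuous nE cg.
by move=> i; exact: near_eq_derivable nE (dg i).
Qed.

Lemma C_infty_on_sub U U' g : U' `<=` U -> C_infty_on U g -> C_infty_on U' g.
Proof. by move=> UU Cg s x /UU; exact: Cg. Qed.

Lemma C_infty_on_partial U g (i : 'I_n) :
  C_infty_on U g -> C_infty_on U ('D_(ee i) g).
Proof. by move=> Cg s x /(Cg (rcons s i)); rewrite iter_partial_rcons. Qed.

Lemma C_infty_on_iter_partial U g s :
  C_infty_on U g -> C_infty_on U (iter_partial s g).
Proof. by move=> Cg; elim: s => [|i s IH]; [exact: Cg|exact: C_infty_on_partial]. Qed.

Lemma C_infty_on_continuous U g x :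
  C_infty_on U g -> U x -> {for x, continuous g}.
Proof. by move=> Cg /(Cg [::]) []. Qed.

Lemma C_infty_on_derivable U g (i : 'I_n) x :
  C_infty_on U g -> U x -> derivable g x (ee i).
Proof. by move=> Cg /(Cg [::]) [_]; exact. Qed.

(* Smoothness is coinductive: it is enough to find a class of functions closed,
   on U, under partial derivatives. *)
Lemma C_infty_on_coind U (P : set ('rV[K]_n -> K)) : open U ->
  (forall g, P g -> forall x, U x ->
     {for x, continuous g} /\ forall i : 'I_n, derivable g x (ee i)) ->
  (forall g (i : 'I_n), P g ->
     exists2 h, P h & forall x, U x -> 'D_(ee i) g x = h x) ->
  P `<=` C_infty_on U.
Proof.
move=> oU P1 P2 g Pg s; elim/last_ind: s g Pg => [|s i IH] g Pg x Ux.
  exact: P1.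
have [h Ph gh] := P2 g i Pg; rewrite iter_partial_rcons.
have nE : \forall y \near x, iter_partial s h y = iter_partial s ('D_(ee i) g) y.
  apply: iter_partial_near; have : nbhs x U by exact: open_nbhs_nbhs.
  by apply: filterS => y /gh ->.
have [ch dh] := IH h Ph x Ux; split; first exact: near_continuous nE ch.
by move=> j; exact: near_eq_derivable nE (dh j).
Qed.

Inductive finite_sum_of (B : set ('rV[K]_n -> K)) : set ('rV[K]_n -> K) :=
| finite_sum_of0 : finite_sum_of B (fun=> 0)
| finite_sum_of_add b g : B b -> finite_sum_of B g ->
    finite_sum_of B (fun x => b x + g x).

Lemma finite_sum_of1 B b : B b -> finite_sum_of B b.
Proof.
move=> Bb; have := finite_sum_of_add Bb (finite_sum_of0 B).
by congr finite_sum_of; apply/funext => x; rewrite addr0.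
Qed.

Lemma finite_sum_ofD B g h : finite_sum_of B g -> finite_sum_of B h ->
  finite_sum_of B (fun x => g x + h x).
Proof.
move=> Bg Bh; elim: Bg => [|b g' Bb _ IH].
  by have : finite_sum_of B (fun x => 0 + h x) by under eq_fun do rewrite add0r.
under eq_fun do rewrite -addrA; exact: finite_sum_of_add.
Qed.

Lemma finite_sum_of_sum B m (F : 'I_m -> 'rV[K]_n -> K) :
  (forall i, B (F i)) -> finite_sum_of B (fun x => \sum_i F i x).
Proof.
elim: m F => [|m IH] F BF.
  under eq_fun do rewrite big_ord0; exact: finite_sum_of0.
under eq_fun do rewrite big_ord_recl; apply: finite_sum_of_add => //.
exact: IH.
Qed.

(** The derivative of a product or of a composite is a sum of terms of the same shape. The terms
    alone are therefore not stable under derivatives, but their finite sums are, and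
    [C_infty_on_coind] applies to these. *)
Lemma C_infty_on_sum_coind U (B : set ('rV[K]_n -> K)) : open U ->
  (forall b, B b -> forall x, U x ->
     {for x, continuous b} /\ forall i : 'I_n, derivable b x (ee i)) ->
  (forall b (i : 'I_n), B b ->
     exists2 h, finite_sum_of B h & forall x, U x -> 'D_(ee i) b x = h x) ->
  B `<=` C_infty_on U.
Proof.
move=> oU B1 B2 b Bb; apply: (C_infty_on_coind (P := finite_sum_of B)) => //.
- move=> g Bg x Ux; elim: Bg => [|b' g' /B1 /(_ x Ux) [cb db] _ [cg dg]].
    split=> [|i]; first exact: cst_continuous.
    exact: derivable_cst.
  split; first exact: (cvgD cb cg).
  by move=> i; exact: (derivableD (db i) (dg i)).
- move=> g i Bg.
  (* Derivability of the partial sums is proved simultaneously, because the sum rule for the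
     derivative requires it. *)
  have [] : (exists2 h, finite_sum_of B h & forall x, U x -> 'D_(ee i) g x = h x) /\
      forall x, U x -> derivable g x (ee i); last by [].
  elim: Bg => [|b' g' Bb' _ [[h Bh gh] dg]].
    split=> [|x _]; last exact: derivable_cst.
    by exists (fun=> 0) => [|x _]; [exact: finite_sum_of0|exact: derive_cst].
  have db x : U x -> derivable b' x (ee i) by move=> Ux; exact: (B1 _ Bb' x Ux).2.
  split=> [|x Ux]; last exact: (derivableD (db x Ux) (dg x Ux)).
  have [h' Bh' bh'] := B2 b' i Bb'.
  exists (fun x => h' x + h x); first exact: finite_sum_ofD.
  by move=> x Ux; rewrite (deriveD (db x Ux) (dg x Ux)) gh // bh'.
- exact: finite_sum_of1.
Qed.

Lemma C_infty_on_cst U (c : K) : open U -> C_infty_on U (fun=> c).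
Proof.
move=> oU.
apply: (C_infty_on_coind (P := [set g | exists c, g = fun=> c])) => //.
- move=> g [d ->] x Ux; split; first exact: cst_continuous.
  by move=> i; exact: derivable_cst.
- move=> g i [d ->]; exists (fun=> 0); first by exists 0.
  by move=> x _; exact: derive_cst.
- by exists c.
Qed.

Lemma C_infty_onD U g h : open U -> C_infty_on U g -> C_infty_on U h ->
  C_infty_on U (fun x => g x + h x).
Proof.
move=> oU Cg Ch.
apply: (C_infty_on_coind (P := [set k | exists g h,
  [/\ C_infty_on U g, C_infty_on U h & k = fun x => g x + h x]])) => //.
- move=> _ [g' [h' [Cg' Ch' ->]]] x Ux; split.
    exact: (cvgD (C_infty_on_continuous Cg' Ux) (C_infty_on_continuous Ch' Ux)).
  move=> i; apply: derivableD; [exact: C_infty_on_derivable Cg' Ux|].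
  exact: C_infty_on_derivable Ch' Ux.
- move=> _ i [g' [h' [Cg' Ch' ->]]].
  exists (fun x => 'D_(ee i) g' x + 'D_(ee i) h' x).
    exists ('D_(ee i) g'), ('D_(ee i) h').
    by split; [exact: C_infty_on_partial|exact: C_infty_on_partial|].
  move=> x Ux; apply: deriveD; [exact: C_infty_on_derivable Cg' Ux|].
  exact: C_infty_on_derivable Ch' Ux.
- by exists g, h.
Qed.

Lemma C_infty_onM U g h : open U -> C_infty_on U g -> C_infty_on U h ->
  C_infty_on U (fun x => g x * h x).
Proof.
move=> oU Cg Ch.
apply: (C_infty_on_sum_coind (B := [set k | exists g h,
  [/\ C_infty_on U g, C_infty_on U h & k = fun x => g x * h x]])) => //.
- move=> _ [g' [h' [Cg' Ch' ->]]] x Ux; split.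
    exact: (cvgM (C_infty_on_continuous Cg' Ux) (C_infty_on_continuous Ch' Ux)).
  move=> i; apply: derivableM; [exact: C_infty_on_derivable Cg' Ux|].
  exact: C_infty_on_derivable Ch' Ux.
- move=> _ i [g' [h' [Cg' Ch' ->]]].
  exists (fun x => g' x * 'D_(ee i) h' x + h' x * 'D_(ee i) g' x).
    apply: finite_sum_ofD; apply: finite_sum_of1.
      by exists g', ('D_(ee i) h'); split; [exact: Cg'|exact: C_infty_on_partial|].
    by exists h', ('D_(ee i) g'); split; [exact: Ch'|exact: C_infty_on_partial|].
  move=> x Ux; apply: deriveM; [exact: C_infty_on_derivable Cg' Ux|].
  exact: C_infty_on_derivable Ch' Ux.
- by exists g, h.
Qed.

Lemma is_derive_coord (i j : 'I_n) x :
  is_derive x (ee i) (fun y : 'rV[K]_n => y 0 j) (i == j)%:R.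
Proof.
apply/is_deriveP => e e0; near=> h.
rewrite !mxE eqxx /= eq_sym [x 0 j + _]addrC addrK subrr normr0.
by rewrite mulr_ge0 // ltW.
Unshelve. all: by end_near. Qed.

Lemma C_infty_on_coord U (j : 'I_n) : open U ->
  C_infty_on U (fun x : 'rV[K]_n => x 0 j).
Proof.
move=> oU.
apply: (C_infty_on_coind (P := [set g | g = (fun x : 'rV[K]_n => x 0 j) \/
  C_infty_on U g])) => //.
- move=> g [->|Cg] x Ux.
    split; first exact: (@coord_continuous K 1 n 0 j x).
    by move=> i; have [] := is_derive_coord i j x.
  split; first exact: C_infty_on_continuous Ux.
  by move=> i; exact: C_infty_on_derivable Ux.
- move=> g i [->|Cg].
    exists (fun=> (i == j)%:R); first by right; exact: C_infty_on_cst.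
    by move=> x _; have [] := is_derive_coord i j x.
  by exists ('D_(ee i) g) => //; right; exact: C_infty_on_partial.
- by left.
Qed.

End SmoothFunctions.

(** * Differentials of smooth maps and composition *)

Section Differential.
Context {K : numFieldType} (Kmvi : mean_value_inequality K).
Local Notation ee := basis_vec.

Lemma differentiable_rV (V : normedModType K) p (f : V -> 'rV[K]_p) x :
  (forall j, differentiable (fun y => f y 0 j : K) x) -> differentiable f x.
Proof.
move=> df; have -> : f = \sum_(j < p) (fun y => f y 0 j *: ee j).
  apply/funext => y; rewrite fct_sumE [LHS]row_sum_delta.
  by apply: eq_bigr.
by apply: differentiable_sum => j; exact: differentiableZl.
Qed.

Lemma diff_coordE (V : normedModType K) p (f : V -> 'rV[K]_p) x v j :
  differentiable f x ->
  'd f x v 0 j = 'd (fun y => f y 0 j : K) x v.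
Proof.
move=> df.
pose c (y : 'rV[K]_p) : K := y 0 j.
have lc : linear c by move=> a u w; rewrite /c !mxE.
pose cM := GRing.isLinear.Build _ _ _ _ _ lc.
pose cL : {linear 'rV[K]_p -> K} := HB.pack c cM.
have cc : continuous cL by move=> y; exact: (@coord_continuous K 1 p 0 j y).
have -> : (fun y => f y 0 j : K) = cL \o f by [].
have dc : differentiable cL (f x) by exact: linear_differentiable.
rewrite (diff_comp df dc).
by have /(congr1 (fun h => h ('d f x v))) := diff_lin (f x) cc.
Qed.

Lemma C_infty_on_differentiable n (U : set 'rV[K]_n) (g : 'rV[K]_n -> K) x :
  open U -> C_infty_on U g -> U x ->
  differentiable g x /\
  forall v, 'd g x v = \sum_i v 0 i * 'D_(ee i) g x.
Proof.
move=> oU Cg Ux; have [||dg dE] := @partials_differentiable K Kmvi n g x.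
- move=> i; have : nbhs x U by exact: open_nbhs_nbhs.
  by apply: filterS => y; exact: C_infty_on_derivable.
- by move=> i; apply: C_infty_on_continuous Ux; exact: C_infty_on_partial.
by split=> // v; rewrite dE.
Qed.

Lemma C_infty_on_partials_commute n (U : set 'rV[K]_n) (g : 'rV[K]_n -> K) i j x :
  open U -> C_infty_on U g -> U x ->
  'D_(ee j) ('D_(ee i) g) x = 'D_(ee i) ('D_(ee j) g) x.
Proof.
move=> oU Cg Ux; apply: (partials_commute Kmvi) => k l; split.
  by apply: C_infty_on_continuous Ux; do 2 apply: C_infty_on_partial.
have : nbhs x U by exact: open_nbhs_nbhs.
apply: filterS => y Uy; split; first exact: C_infty_on_derivable Cg Uy.
by apply: C_infty_on_derivable Uy; apply: C_infty_on_partial.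
Qed.

Section Composition.
Context {n p : nat} (U : set 'rV[K]_n) (V : set 'rV[K]_p).
Hypotheses (oU : open U) (oV : open V).
Variable f : 'rV[K]_n -> 'rV[K]_p.
Hypothesis Cf : forall j, C_infty_on U (fun x => f x 0 j).
Hypothesis fUV : forall x, U x -> V (f x).

Lemma C_infty_on_differentiable_rV x : U x -> differentiable f x.
Proof.
move=> Ux; apply: differentiable_rV => j.
by have [] := C_infty_on_differentiable oU (Cf j) Ux.
Qed.

Lemma derive_comp_rV psi (i : 'I_n) x : C_infty_on V psi -> U x ->
  derivable (psi \o f) x (ee i) /\
  'D_(ee i) (psi \o f) x =
    \sum_j 'D_(ee j) psi (f x) * 'D_(ee i) (fun y => f y 0 j) x.
Proof.
move=> Cpsi Ux; have df := C_infty_on_differentiable_rV Ux.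
have [dpsi dE] := C_infty_on_differentiable oV Cpsi (fUV Ux).
have dc := differentiable_comp df dpsi.
split; first exact: diff_derivable.
rewrite (deriveE _ dc) diff_comp //= dE; apply: eq_bigr => j _.
rewrite mulrC diff_coordE // -deriveE //.
by have [] := C_infty_on_differentiable oU (Cf j) Ux.
Qed.

Lemma C_infty_on_comp psi : C_infty_on V psi -> C_infty_on U (psi \o f).
Proof.
(* The factor 1 places [psi \o f] in the class of products of a pullback and a smooth function,
   which the chain and product rules keep stable up to finite sums. *)
move=> Cpsi; apply: (C_infty_on_eq (g := fun x => psi (f x) * 1)) => //.
  by move=> x _; rewrite mulr1.
have cf psi' x : C_infty_on V psi' -> U x -> {for x, continuous (psi' \o f)}.
  move=> Cpsi' Ux; apply: continuous_comp.
    exact: differentiable_continuous (C_infty_on_differentiable_rV Ux).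
  exact: C_infty_on_continuous Cpsi' (fUV Ux).
apply: (C_infty_on_sum_coind (B := [set k | exists psi h,
  [/\ C_infty_on V psi, C_infty_on U h & k = fun x => psi (f x) * h x]])) => //.
- move=> _ [psi' [h [Cpsi' Ch ->]]] x Ux; split.
    exact: (cvgM (cf _ _ Cpsi' Ux) (C_infty_on_continuous Ch Ux)).
  move=> i; apply: (derivableM (f := psi' \o f)); last exact: C_infty_on_derivable Ch Ux.
  by have [] := derive_comp_rV i Cpsi' Ux.
- move=> _ i [psi' [h [Cpsi' Ch ->]]].
  exists (fun x => psi' (f x) * 'D_(ee i) h x +
    \sum_j 'D_(ee j) psi' (f x) * ('D_(ee i) (fun y => f y 0 j) x * h x)).
    apply: finite_sum_ofD.
      apply: finite_sum_of1; exists psi', ('D_(ee i) h).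
      by split; [exact: Cpsi'|exact: C_infty_on_partial|].
    apply: finite_sum_of_sum => j.
    exists ('D_(ee j) psi'), (fun x => 'D_(ee i) (fun y => f y 0 j) x * h x).
    split; [exact: C_infty_on_partial| |by []].
    by apply: (C_infty_onM oU); [exact: C_infty_on_partial|exact: Ch].
  move=> x Ux; have [dc dcE] := derive_comp_rV i Cpsi' Ux.
  rewrite (deriveM (f := psi' \o f) dc (C_infty_on_derivable Ch Ux)) dcE.
  congr (_ + _); rewrite scaler_sumr; apply: eq_bigr => j _.
  by rewrite /GRing.scale /= mulrC mulrA.
- by exists psi, (fun=> 1); split => //; exact: C_infty_on_cst.
Qed.

End Composition.
End Differential.

(** * Order of vanishing at a point *)

Section VanishingOrder.
Context {K : numFieldType} {n : nat}.
Implicit Types (U : set 'rV[K]_n) (g h : 'rV[K]_n -> K) (x : 'rV[K]_n).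
Local Notation ee := basis_vec.

Lemma iter_partial_linear U s (c : K) g h x : open U -> C_infty_on U g ->
  C_infty_on U h -> U x ->
  iter_partial s (fun y => c * g y + h y) x =
    c * iter_partial s g x + iter_partial s h x.
Proof.
move=> oU Cg Ch; elim: s x => [//|i s IH] x Ux /=.
have nE : \forall y \near x, iter_partial s (fun y => c * g y + h y) y =
    (c \*: iter_partial s g + iter_partial s h) y.
  have : nbhs x U by exact: open_nbhs_nbhs.
  by apply: filterS => y /IH.
rewrite (near_eq_derive (ee i) nE).
have dg : derivable (iter_partial s g) x (ee i) by exact: (Cg s x Ux).2.
have dh : derivable (iter_partial s h) x (ee i) by exact: (Ch s x Ux).2.
have dcg : derivable (c \*: iter_partial s g) x (ee i) by exact: derivableZ.
rewrite (deriveD dcg dh); congr (_ + _); exact: deriveZ.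
Qed.

Definition vanishes_to (k : nat) g x : Prop :=
  forall s : seq 'I_n, (size s < k)%N -> iter_partial s g x = 0.

Lemma vanishes_to_near k g h x : (\forall y \near x, g y = h y) ->
  vanishes_to k g x -> vanishes_to k h x.
Proof.
move=> gh vg s /vg <-; exact/esym/(nbhs_singleton (iter_partial_near s gh)).
Qed.

Lemma vanishes_to_eq U k g h x : open U -> U x -> (forall y, U y -> g y = h y) ->
  vanishes_to k g x -> vanishes_to k h x.
Proof.
move=> oU Ux gh; apply: vanishes_to_near.
have : nbhs x U by exact: open_nbhs_nbhs.
by apply: filterS => y /gh.
Qed.

Lemma vanishes_toW k l g x : (k <= l)%N -> vanishes_to l g x -> vanishes_to k g x.
Proof. by move=> kl vg s sk; apply: vg; exact: leq_trans kl. Qed.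

(** The derivative split off is the innermost one, at the end of the word. This makes the order of
    vanishing recursive in the function itself, the form used by the inductions below. *)
Lemma vanishes_toS k g x : vanishes_to k.+1 g x <->
  g x = 0 /\ forall i : 'I_n, vanishes_to k ('D_(ee i) g) x.
Proof.
split=> [vg|[g0 vg] s].
  split; first exact: (vg [::]).
  by move=> i s sk; rewrite -iter_partial_rcons; apply: vg; rewrite size_rcons.
case/lastP: s => [//|s i]; rewrite size_rcons ltnS iter_partial_rcons.
exact: vg.
Qed.

Lemma vanishes_to_linear U k (c : K) g h x : open U -> U x ->
  C_infty_on U g -> C_infty_on U h -> vanishes_to k g x -> vanishes_to k h x ->
  vanishes_to k (fun y => c * g y + h y) x.
Proof.
move=> oU Ux Cg Ch vg vh s sk.
by rewrite (iter_partial_linear _ _ oU Cg Ch Ux) vg // vh // mulr0 addr0.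
Qed.

Lemma vanishes_toD U k g h x : open U -> U x ->
  C_infty_on U g -> C_infty_on U h -> vanishes_to k g x -> vanishes_to k h x ->
  vanishes_to k (fun y => g y + h y) x.
Proof.
move=> oU Ux Cg Ch vg vh; have := vanishes_to_linear 1 oU Ux Cg Ch vg vh.
by congr vanishes_to; apply/funext => y; rewrite mul1r.
Qed.

Lemma C_infty_on_deriveM U g h (i : 'I_n) x : C_infty_on U g -> C_infty_on U h ->
  U x -> 'D_(ee i) (fun y => g y * h y) x =
    g x * 'D_(ee i) h x + h x * 'D_(ee i) g x.
Proof.
move=> Cg Ch Ux; apply: deriveM; first exact: C_infty_on_derivable Cg Ux.
exact: C_infty_on_derivable Ch Ux.
Qed.

Lemma vanishes_toM U k g h x : open U -> U x ->
  C_infty_on U g -> C_infty_on U h -> vanishes_to k g x ->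
  vanishes_to k (fun y => g y * h y) x.
Proof.
move=> oU Ux; elim: k g h => [//|k IH] g h Cg Ch vg.
have [g0 dg] := (vanishes_toS k g x).1 vg.
apply/vanishes_toS; rewrite g0 mul0r; split => // i.
apply: (vanishes_to_eq oU Ux (g := fun y => g y * 'D_(ee i) h y + 'D_(ee i) g y * h y)).
  by move=> y Uy; rewrite (C_infty_on_deriveM i Cg Ch Uy) [h y * _]mulrC.
have Cdg := C_infty_on_partial i Cg.
have Cdh := C_infty_on_partial i Ch.
apply: (vanishes_toD oU Ux); try exact: C_infty_onM.
  by apply: IH => //; exact: vanishes_toW vg.
exact: IH.
Qed.

Lemma vanishes_toM1 U k c g x : open U -> U x ->
  C_infty_on U c -> C_infty_on U g -> c x = 0 -> vanishes_to k g x ->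
  vanishes_to k.+1 (fun y => c y * g y) x.
Proof.
move=> oU Ux Cc Cg c0; elim: k g Cg => [|k IH] g Cg vg.
  by apply/vanishes_toS; rewrite c0 mul0r.
apply/vanishes_toS; rewrite c0 mul0r; split => // i.
apply: (vanishes_to_eq oU Ux (g := fun y => c y * 'D_(ee i) g y + g y * 'D_(ee i) c y)).
  by move=> y Uy; rewrite (C_infty_on_deriveM i Cc Cg Uy).
have Cdg := C_infty_on_partial i Cg.
have Cdc := C_infty_on_partial i Cc.
apply: (vanishes_toD oU Ux); try exact: C_infty_onM.
  by apply: IH => //; exact: ((vanishes_toS k g x).1 vg).2.
exact: (vanishes_toM oU Ux).
Qed.

End VanishingOrder.

(** * Rules for directional derivatives *)

Section DerivativeRules.
Context {K : numFieldType} {V : normedModType K}.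
Implicit Types (f g : V -> K) (x v : V).

(** A directional derivative sees only one line. In a direction tangent to a hyperplane, a function
    defined by cases can thus be replaced by its branch on the hyperplane. *)
Lemma is_derive_eq_line f g x v (d : K) :
  (\forall h \near (0 : K), f (x + h *: v) = g (x + h *: v)) ->
  is_derive x v g d -> is_derive x v f d.
Proof.
move=> fg /is_deriveP dg; apply/is_deriveP => e /dg H.
have fg0 : f x = g x by have := nbhs_singleton fg; rewrite scale0r addr0.
by apply: filterS2 H fg => h; rewrite fg0 => H ->.
Qed.

Lemma is_derive_near f g x v (d : K) : (\forall y \near x, f y = g y) ->
  is_derive x v g d -> is_derive x v f d.
Proof.
by move=> fg; apply: near_eq_is_derive; apply: filterS fg => y ->.
Qed.

Lemma is_derive_exp f x v (df : K) (k : nat) : is_derive x v f df ->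
  is_derive x v (fun y => f y ^+ k) (k%:R * f x ^+ k.-1 * df).
Proof.
move=> dfx; elim: k => [|k IH].
  rewrite !mul0r; exact: is_derive_cst.
have -> : (fun y => f y ^+ k.+1) = (f * (fun y => f y ^+ k) : V -> K).
  by apply/funext => y; rewrite exprS.
apply: is_derive_eq (is_deriveM dfx IH) _.
rewrite /GRing.scale /=; case: k {IH} => [|k] /=.
  by rewrite !expr0; ring.
by rewrite -[k.+2%:R]natr1 !exprS; ring.
Qed.

Lemma is_derive_mulr f x v (df c : K) :
  is_derive x v f df -> is_derive x v (fun y => f y * c) (df * c).
Proof.
move=> /is_deriveP H; apply/is_deriveP => e e0.
have [->|c0] := eqVneq c 0.
  near=> h; rewrite !mulr0 !subr0 normr0 mulr_ge0 // ltW //.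
have : 0 < e / `|c| by rewrite divr_gt0 ?normr_gt0.
move=> /H; apply: filterS => h; rewrite mulrAC ler_pdivlMr ?normr_gt0 //.
by rewrite -normrM !mulrBl mulrA.
Unshelve. all: by end_near. Qed.

Lemma is_derive_quotient f g x v (df dg : K) : g x != 0 ->
  is_derive x v f df -> is_derive x v g dg ->
  is_derive x v (fun y => f y / g y) (df / g x - f x * dg / g x ^+ 2).
Proof.
move=> g0 dfx [dg1 dg2].
have dV : is_derive x v (fun y => (g y)^-1) (- (g x) ^- 2 *: dg).
  by split; [exact: derivableV|rewrite deriveV // dg2].
apply: is_derive_eq (is_deriveM dfx dV) _.
by rewrite /GRing.scale /= mulNr mulrN addrC [_^-1 * df]mulrC mulrA mulrAC.
Qed.

End DerivativeRules.

(** * Division by a coordinate and Hadamard's lemma *)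

Section Taylor.
Context {K : numFieldType} (Kmvi : mean_value_inequality K) {n : nat}.
Variables (U : set 'rV[K]_n) (i : 'I_n).
Local Notation ee := basis_vec.
Implicit Types (R : 'rV[K]_n -> K).
Local Notation Dk k R := (iter_partial (nseq k i) R).

Lemma iter_partial_nseqS k R : Dk k.+1 R = Dk k ('D_(ee i) R).
Proof. by elim: k => [//|k IH]; rewrite /= -IH. Qed.

(** Induction on [m]: the derivative of the remainder along the segment is [h] times the remainder
    of ['D_(ee i) R] one order lower, and each mean value inequality costs a factor 2. The top
    coefficient is an arbitrary [c] rather than the derivative at [x], so that it can be taken at
    another base point. *)
Lemma taylor m R x (h c e : K) :
  (forall t : K, 0 <= t <= 1 -> U (x + (t * h) *: ee i)) -> C_infty_on U R ->
  (forall t : K, 0 <= t <= 1 -> `|Dk m R (x + (t * h) *: ee i) - c| <= e) ->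
  `|R (x + h *: ee i) - \sum_(j < m) h ^+ j / j`!%:R * Dk j R x
    - h ^+ m / m`!%:R * c| <= 2 ^+ m * e * `|h| ^+ m.
Proof.
elim: m R h => [|m IH] R h Uh CR H.
  have := H 1; rewrite mul1r big_ord0 subr0 fact0 divr1 !expr0 !mul1r mulr1.
  by apply; rewrite ler01 lexx.
(* [p] is the Taylor polynomial of [R] along the line without its constant term, and [q] that of
   ['D_(ee i) R], so that [q] is the derivative of [p]. *)
pose p (s : K) := \sum_(j < m) s ^+ j.+1 / (j.+1)`!%:R * Dk j ('D_(ee i) R) x.
pose q (s : K) := \sum_(j < m) s ^+ j / j`!%:R * Dk j ('D_(ee i) R) x.
pose phi (t : K) := R (x + t *: (h *: ee i)) - p (t * h) - (t * h) ^+ m.+1 / (m.+1)`!%:R * c.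
pose dphi (t : K) := h * 'D_(ee i) R (x + t *: (h *: ee i)) - h * q (t * h)
  - h * ((t * h) ^+ m / m`!%:R * c).
have := Kmvi (phi := phi) (dphi := dphi) (M := 2 ^+ m * e * `|h| ^+ m.+1).
have -> : phi 1 - phi 0 = R (x + h *: ee i) - \sum_(j < m.+1) h ^+ j / j`!%:R * Dk j R x
    - h ^+ m.+1 / (m.+1)`!%:R * c.
  rewrite /phi /p !mul1r scale1r scale0r addr0 mul0r expr0n mul0r mul0r subr0.
  rewrite [in X in _ - (_ - X)]big1 => [|j _]; last by rewrite expr0n !mul0r.
  rewrite big_ord_recl expr0 fact0 divr1 mul1r subr0.
  under [in RHS]eq_bigr => j _ do rewrite lift0 iter_partial_nseqS.
  by move: (\sum_(_ < _) _) => s; rewrite opprD [in RHS]addrA [LHS]addrAC; congr (_ - _); rewrite addrAC.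
have -> : 2 ^+ m.+1 * e * `|h| ^+ m.+1 = 2 * (2 ^+ m * e * `|h| ^+ m.+1).
  by rewrite exprS !mulrA.
have dmon (t : K) j : is_derive t 1 (fun t : K => (t * h) ^+ j.+1 / (j.+1)`!%:R)
    (h * ((t * h) ^+ j / j`!%:R)).
  have d1 : is_derive t 1 (fun t : K => t * h) h.
    apply/is_deriveP => e' e'0; near=> s.
    rewrite /GRing.scale /= mulr1 mulrDl [t * h + _]addrC addrK subrr normr0.
    by rewrite mulr_ge0 // ltW.
  have d2 := is_derive_exp j.+1 d1.
  apply: is_derive_eq (is_derive_mulr (j.+1)`!%:R^-1 d2) _.
  rewrite /= factS natrM.
  have j0 : j.+1%:R != 0 :> K by rewrite pnatr_eq0.
  have f0 : j`!%:R != 0 :> K by rewrite pnatr_eq0 -lt0n fact_gt0.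
  move: (j.+1%:R) (j`!%:R) ((t * h) ^+ j) j0 f0 => u v w u0 v0.
  by field; rewrite v0 u0.
apply=> t t01.
  have d1 : is_derive t 1 (fun t : K => R (x + t *: (h *: ee i)))
      (h * 'D_(ee i) R (x + t *: (h *: ee i))).
    apply: is_derive_line; apply: is_derive_scale_dir; apply: derivableP.
    by apply: C_infty_on_derivable CR _; rewrite scalerA; exact: Uh.
  have d2 : is_derive t 1 (fun t : K => p (t * h)) (h * q (t * h)).
    rewrite /p /q mulr_sumr.
    have -> : (fun t : K => \sum_(j < m) (t * h) ^+ j.+1 / (j.+1)`!%:R * Dk j ('D_(ee i) R) x)
      = \sum_(j < m) (fun t : K => (t * h) ^+ j.+1 / (j.+1)`!%:R * Dk j ('D_(ee i) R) x).
      by apply/funext => s; rewrite fct_sumE.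
    apply: is_derive_sum => j.
    by rewrite mulrA; apply: is_derive_mulr; exact: dmon.
  have d3 : is_derive t 1 (fun t : K => (t * h) ^+ m.+1 / (m.+1)`!%:R * c)
      (h * ((t * h) ^+ m / m`!%:R * c)).
    by rewrite mulrA; apply: is_derive_mulr; exact: dmon.
  exact: (is_deriveB (is_deriveB d1 d2) d3).
rewrite /dphi -!mulrBr normrM exprS mulrCA; apply: ler_wpM2l => //.
have /andP [t0 t1] := t01.
have CdR := C_infty_on_partial i CR.
have th : `|t * h| <= `|h| by rewrite normrM ger0_norm // ler_piMl.
have e0 : 0 <= e by apply: le_trans (H _ t01).
rewrite scalerA; apply: le_trans (IH _ (t * h) _ CdR _) _.
- move=> s /andP [s0 s1]; rewrite mulrA; apply: Uh.
  by rewrite mulr_ge0 //= mulr_ile1.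
- move=> s /andP [s0 s1]; rewrite mulrA -iter_partial_nseqS; apply: H.
  by rewrite mulr_ge0 //= mulr_ile1.
apply: ler_wpM2l; first by rewrite mulr_ge0 // exprn_ge0.
by rewrite lerXn2r // ?nnegrE.
Unshelve. all: by end_near. Qed.

End Taylor.

(** * Dividing a flat function by a power of a coordinate *)

Section Division.
Context {K : numFieldType} (Kmvi : mean_value_inequality K) {n : nat}.
Variables (a : 'rV[K]_n) (r : K) (r0 : 0 < r) (i : 'I_n).
Local Notation ee := basis_vec.
Local Notation B := (ball a r).
Implicit Types (R g : 'rV[K]_n -> K) (x : 'rV[K]_n).
Local Notation Dk k R := (iter_partial (nseq k i) R).

Let openB : open (B : set 'rV[K]_n).
Proof. exact: ball_open. Qed.

Definition flat_on_hyperplane (k : nat) R : Prop :=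
  C_infty_on B R /\
  forall j, (j < k)%N -> forall x, B x -> x 0 i = a 0 i -> Dk j R x = 0.

(* The quotient of R by the k-th power of the i-th coordinate, extended by its
   limit to the hyperplane x_i = a_i.  Together these quotients are closed under
   partial derivatives, see [is_derive_divided]; this replaces the usual
   differentiation under the integral sign. *)
Definition divided (k : nat) R x : K :=
  if x 0 i == a 0 i then Dk k R x / k`!%:R else R x / (x 0 i - a 0 i) ^+ k.

Lemma partial_nseq_commute j k R x : C_infty_on B R -> B x ->
  'D_(ee j) (Dk k R) x = Dk k ('D_(ee j) R) x.
Proof.
move=> CR; elim: k x => [//|k IH] x Bx /=.
have CD := C_infty_on_iter_partial (nseq k i) CR.
rewrite (C_infty_on_partials_commute Kmvi i j openB CD Bx).
apply: near_eq_derive; have : nbhs x B by exact: open_nbhs_nbhs.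
by apply: filterS => y /IH.
Qed.

Lemma near_line x v (P : set 'rV[K]_n) : (\forall y \near x, P y) ->
  \forall h \near (0 : K), P (x + h *: v).
Proof.
move=> /nearPadd [d d0 dP].
have [->|v0] := eqVneq v 0.
  near=> h; rewrite scaler0; apply: dP; by rewrite normr0.
apply/nearPadd; exists (d / `|v|); first by rewrite divr_gt0 ?normr_gt0.
move=> h hd; apply: dP; rewrite add0r normrZ.
by rewrite -ltr_pdivlMr ?normr_gt0.
Unshelve. all: by end_near. Qed.

Lemma nbhsB x : B x -> \forall y \near x, B y.
Proof. by move=> Bx; exact: open_nbhs_nbhs. Qed.

Lemma coord_line x (j : 'I_n) (h : K) : j != i -> (x + h *: ee j) 0 i = x 0 i.
Proof.
by move=> ji; rewrite !mxE eqxx /= eq_sym (negPf ji) mulr0 addr0.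
Qed.

Lemma flat_partial j k R : j != i ->
  flat_on_hyperplane k R -> flat_on_hyperplane k ('D_(ee j) R).
Proof.
move=> ji [CR FR]; split=> [|l lk x Bx xa]; first exact: C_infty_on_partial.
rewrite -partial_nseq_commute //.
have [] // : is_derive x (ee j) (Dk l R) 0.
apply: is_derive_eq_line (is_derive_cst (0 : K) x (ee j)).
have := near_line (ee j) (nbhsB Bx); apply: filterS => h Bh.
by rewrite FR // coord_line.
Qed.

(** With [c = x_i - a_i], the quotient rule gives [(c * 'D_(ee i) R - k * R) / c ^ (k + 1)] as the
    [i]-th derivative of [R / c ^ k]; this is its numerator. *)
Definition dividend (k : nat) R x : K :=
  (x 0 i - a 0 i) * 'D_(ee i) R x + (- k%:R) * R x.

Lemma C_infty_on_shift_coord : C_infty_on B (fun x : 'rV[K]_n => x 0 i - a 0 i).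
Proof.
apply: C_infty_onD => //; first exact: C_infty_on_coord.
exact: C_infty_on_cst.
Qed.

Lemma C_infty_on_dividend k R : C_infty_on B R -> C_infty_on B (dividend k R).
Proof.
move=> CR; apply: (C_infty_onD openB); apply: (C_infty_onM openB).
- exact: C_infty_on_shift_coord.
- exact: C_infty_on_partial.
- exact: C_infty_on_cst.
- exact: CR.
Qed.

Lemma is_derive_shift_coord x (j : 'I_n) :
  is_derive x (ee j) (fun x : 'rV[K]_n => x 0 i - a 0 i) (j == i)%:R.
Proof.
apply: is_derive_eq (is_deriveB (is_derive_coord j i x)
  (is_derive_cst (a 0 i : K) x (ee j))) _.
by rewrite subr0.
Qed.

Lemma is_derive_C_infty R (j : 'I_n) x : C_infty_on B R -> B x ->
  is_derive x (ee j) R ('D_(ee j) R x).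
Proof. by move=> CR Bx; apply: derivableP; exact: C_infty_on_derivable CR Bx. Qed.

Lemma iter_partial_dividend l k R x : C_infty_on B R -> B x ->
  Dk l (dividend k R) x =
    (x 0 i - a 0 i) * Dk l.+1 R x + (l%:R - k%:R) * Dk l R x.
Proof.
move=> CR; elim: l x => [|l IH] x Bx; first by rewrite sub0r.
pose F (y : 'rV[K]_n) : K := (y 0 i - a 0 i) * Dk l.+1 R y + Dk l R y * (l%:R - k%:R).
have FE : \forall y \near x, Dk l (dividend k R) y = F y.
  by apply: filterS (nbhsB Bx) => y /IH ->; rewrite /F [Dk l R y * _]mulrC.
rewrite [LHS](near_eq_derive (ee i) FE).
have dR m : is_derive x (ee i) (Dk m R) (Dk m.+1 R x).
  by apply: is_derive_C_infty Bx; exact: C_infty_on_iter_partial.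
have d1 := is_deriveM (is_derive_shift_coord x i) (dR l.+1).
have [_ ->] := is_deriveD d1 (is_derive_mulr (l%:R - k%:R) (dR l)).
rewrite eqxx -natr1 /GRing.scale /= mulr1.
move: (derive _ x _) (derive _ x _) => u v; ring.
Qed.

(** On the hyperplane [iter_partial_dividend] leaves only [(l - k) * Dk l R]. Flatness of [R] kills
    it for [l < k], and for [l = k] the coefficient does, which gains the extra order. *)
Lemma flat_dividend k R :
  flat_on_hyperplane k R -> flat_on_hyperplane k.+1 (dividend k R).
Proof.
move=> [CR FR]; split=> [|l lk x Bx xa]; first exact: C_infty_on_dividend.
rewrite iter_partial_dividend // xa subrr mul0r add0r.
move: lk; rewrite ltnS leq_eqVlt => /orP [/eqP ->|lk]; first by rewrite subrr mul0r.
by rewrite FR // mulr0.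
Qed.

Lemma fact_neq0 k : k`!%:R != 0 :> K.
Proof. by rewrite pnatr_eq0 -lt0n fact_gt0. Qed.

Lemma near_divided k R x : x 0 i != a 0 i ->
  \forall y \near x, divided k R y = R y / (y 0 i - a 0 i) ^+ k.
Proof.
move=> xa.
have : \forall y \near x, (y : 'rV[K]_n) 0 i != a 0 i.
  apply/nearPadd; exists `|x 0 i - a 0 i|; first by rewrite normr_gt0 subr_eq0.
  move=> h /(le_lt_trans (norm_coord_le h i)); apply: contraTneq.
  by rewrite mxE => <-; rewrite opprD addNKr normrN ltxx.
by apply: filterS => y; rewrite /divided => /negPf ->.
Qed.

Lemma is_derive_divided_off k R x j : C_infty_on B R -> B x -> x 0 i != a 0 i ->
  is_derive x (ee j) (divided k R)
    (if j == i then divided k.+1 (dividend k R) x else divided k ('D_(ee j) R) x).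
Proof.
move=> CR Bx xa.
have c0 : x 0 i - a 0 i != 0 by rewrite subr_eq0.
apply: is_derive_near (near_divided k R xa) _.
have d := @is_derive_quotient _ _ R (fun y => (y 0 i - a 0 i) ^+ k) x _ _ _
  (expf_neq0 k c0) (is_derive_C_infty j CR Bx)
  (is_derive_exp k (is_derive_shift_coord x j)).
apply: is_derive_eq d _.
rewrite /divided (negPf xa) /dividend; case: eqVneq => [->|_]; last first.
  by rewrite !mulr0 mul0r subr0.
move: (derive _ _ _) (R x) (x 0 i - a 0 i) c0 => u v c c0; rewrite mulr1.
case: k => [|k] /=; first by rewrite !expr0 expr1; field.
rewrite !exprS; move: (c ^+ k) (expf_neq0 k c0) => w w0.
by field; rewrite w0 c0.
Qed.

Lemma is_derive_divided_tangent k R x j : C_infty_on B R -> B x ->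
  x 0 i = a 0 i -> j != i ->
  is_derive x (ee j) (divided k R) (divided k ('D_(ee j) R) x).
Proof.
move=> CR Bx xa ji.
apply: (is_derive_eq_line (g := fun y => Dk k R y / k`!%:R)).
  by near=> h; rewrite /divided coord_line // xa eqxx.
rewrite /divided xa eqxx -partial_nseq_commute //; apply: is_derive_mulr.
by apply: is_derive_C_infty Bx; exact: C_infty_on_iter_partial.
Unshelve. all: by end_near. Qed.

Lemma near_segment x (P : set 'rV[K]_n) : (\forall y \near x, P y) ->
  \forall h \near (0 : K), forall t : K, 0 <= t <= 1 -> P (x + (t * h) *: ee i).
Proof.
move=> /nearPadd [d d0 dP]; apply/nearPadd; exists d => // h hd t /andP [t0 t1].
apply: dP; rewrite norm_basis_vec normrM ger0_norm // add0r.
by apply: le_lt_trans hd; rewrite ler_piMl.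
Qed.

(** Flatness removes the Taylor terms of [R] below order [k]; dividing the others by [h ^+ k] shows
    that the derivative is [Dk k.+1 R x / (k.+1)!]. This is the stated value, since the coefficient
    in [iter_partial_dividend] at [l = k.+1] is 1. *)
Lemma is_derive_divided_normal k R x : flat_on_hyperplane k R -> B x ->
  x 0 i = a 0 i ->
  is_derive x (ee i) (divided k R) (divided k.+1 (dividend k R) x).
Proof.
move=> [CR FR] Bx xa; apply/is_deriveP => e e0.
(* The power of 2 cancels the constant of [taylor] at order [k.+1]. *)
pose c := Dk k.+1 R x; pose d := e / 2 ^+ k.+1.
have d0 : 0 < d by rewrite divr_gt0 // exprn_gt0.
have cD : {for x, continuous (Dk k.+1 R)}.
  by apply: C_infty_on_continuous Bx; exact: C_infty_on_iter_partial.
have near1 : \forall y \near x, B y /\ `|Dk k.+1 R y - c| <= d.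
  apply: filterI; first exact: nbhsB.
  by move/cvgrPdist_le : cD => /(_ _ d0); apply: filterS => y; rewrite distrC.
have := near_segment near1; apply: filterS => h H.
have HB t : 0 <= t <= 1 -> B (x + (t * h) *: ee i) by move=> /H [].
have HD (t : K) : 0 <= t <= 1 -> `|Dk k.+1 R (x + (t * h) *: ee i) - c| <= d.
  by move=> /H [].
have [->|h0] := eqVneq h 0.
  by rewrite scale0r addr0 mul0r !subrr normr0 mulr0.
have := taylor Kmvi HB CR HD.
rewrite big_ord_recr /= big1 ?add0r => [|j _]; last by rewrite FR ?mulr0.
have xh : (x + h *: ee i) 0 i = a 0 i + h by rewrite !mxE !eqxx /= mulr1 xa.
rewrite /divided xa eqxx xh -subr_eq0 [a 0 i + h]addrC addrK (negPf h0).
rewrite [Dk k.+1 _ x]iter_partial_dividend // xa subrr mul0r add0r -/c.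
clear near1 H HD; clearbody c; move: (Dk k R x) (R _) => u v H2.
have -> : v / h ^+ k - u / k`!%:R - h * ((k.+1%:R - k%:R) * c / k.+1`!%:R) =
    (v - h ^+ k / k`!%:R * u - h ^+ k.+1 / k.+1`!%:R * c) / h ^+ k.
  rewrite -natr1 [k%:R + 1]addrC addrK mul1r exprS.
  move: (h ^+ k) (expf_neq0 k h0) (k`!%:R) (fact_neq0 k) (k.+1`!%:R) (fact_neq0 k.+1).
  by move=> w w0 p p0 q q0; field; rewrite w0 p0 q0.
rewrite normrM normfV ler_pdivrMr ?normr_gt0 ?expf_neq0 //.
apply: le_trans H2 _; rewrite normrX /d [`|h| ^+ k.+1]exprS.
move: (`|h| ^+ k) `|h| => p q.
rewrite [2 ^+ _ * _]mulrC divfK ?mulrA //.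
Qed.

Lemma is_derive_divided j k R x : flat_on_hyperplane k R -> B x ->
  is_derive x (ee j) (divided k R)
    (if j == i then divided k.+1 (dividend k R) x else divided k ('D_(ee j) R) x).
Proof.
move=> FR Bx; have [xa|xa] := eqVneq (x 0 i) (a 0 i); last first.
  by apply: is_derive_divided_off => //; exact: FR.1.
have [->|ji] := eqVneq j i; first exact: is_derive_divided_normal.
by apply: is_derive_divided_tangent => //; exact: FR.1.
Qed.

(** The delicate case is a point of the hyperplane approached from outside: the nearby point is
    expanded by [taylor] from its own projection, while the constant [c] is taken at [x]. *)
Lemma divided_continuous k R x : flat_on_hyperplane k R -> B x ->
  {for x, continuous (divided k R)}.
Proof.
move=> [CR FR] Bx; have [xa|xa] := eqVneq (x 0 i) (a 0 i); last first.
  have nE : \forall y \near x, R y / (y 0 i - a 0 i) ^+ k = divided k R y.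
    by apply: filterS (near_divided k R xa) => y ->.
  apply: near_continuous nE _; apply: (cvgM (C_infty_on_continuous CR Bx)).
  apply: cvgV; first by rewrite expf_neq0 // subr_eq0.
  have cc : {for x, continuous (fun y : 'rV[K]_n => y 0 i - a 0 i)}.
    exact: (C_infty_on_continuous C_infty_on_shift_coord Bx).
  elim: (k) => [|m IH]; first by under eq_fun do rewrite expr0; exact: cst_continuous.
  by rewrite exprS; under eq_fun do rewrite exprS; exact: (cvgM cc IH).
suff : divided k R y @[y --> x] --> divided k R x by [].
apply/(@cvgrPdist_le _ _ _ (nbhs x) (nbhs_filter x)) => e e0.
pose c := Dk k R x; pose d := e / 2 ^+ k.
have d0 : 0 < d by rewrite divr_gt0 // exprn_gt0.
have cD : {for x, continuous (Dk k R)}.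
  by apply: C_infty_on_continuous Bx; exact: C_infty_on_iter_partial.
have : \forall y \near x, B y /\ `|Dk k R y - c| <= d.
  apply: filterI; first exact: nbhsB.
  by move/cvgrPdist_le : cD => /(_ _ d0); apply: filterS => y; rewrite distrC.
move=> /nearPadd [s s0 sP]; apply: (@nearPadd K 'rV[K]_n x _).2; exists s => // v vs.
rewrite /divided xa eqxx -/c; have [ya|ya] := eqVneq.
  have [_ H] := sP _ vs.
  rewrite -mulrBl normrM distrC normfV [`|k`!%:R|]ger0_norm //.
  apply: le_trans (_ : d <= _).
    apply: le_trans H; rewrite ler_piMr // invf_le1 ?ltr0n ?fact_gt0 //.
    by rewrite ler1n fact_gt0.
  by rewrite /d ler_pdivrMr ?exprn_gt0 // ler_peMr ?exprn_ege1 ?ler1n // ltW.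
(* [x'] is the projection of [x + v] onto the hyperplane, and [h] the coordinate separating the two;
   the segment joining them stays within [|v|] of [x]. *)
pose h := v 0 i; pose x' := x + v - h *: ee i.
have h0 : h != 0 by apply: contraNneq ya => h0; rewrite mxE -/h h0 addr0 xa.
have H t : 0 <= t <= 1 -> B (x' + (t * h) *: ee i) /\
    `|Dk k R (x' + (t * h) *: ee i) - c| <= d.
  move=> /andP [t0 t1].
  have -> : x' + (t * h) *: ee i = x + (v + ((t - 1) * h) *: ee i).
    by rewrite /x' mulrBl mul1r scalerBl -!addrA; congr (_ + (_ + _)); rewrite addrC.
  apply: sP; apply: le_lt_trans vs; apply: norm_le_coord => // j.
  rewrite !mxE eqxx /=; have [->|ji] := eqVneq j i.
    rewrite mulr1 mulrBl mul1r addrCA subrr addr0 normrM ger0_norm //.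
    by apply: le_trans (norm_coord_le v i); rewrite ler_piMl.
  by rewrite mulr0 addr0 norm_coord_le.
have HB t : 0 <= t <= 1 -> B (x' + (t * h) *: ee i) by move=> /H [].
have HD (t : K) : 0 <= t <= 1 -> `|Dk k R (x' + (t * h) *: ee i) - c| <= d.
  by move=> /H [].
have Bx' : B x' by have := HB 0; rewrite mul0r scale0r addr0; apply; rewrite lexx ler01.
have x'a : x' 0 i = a 0 i by rewrite !mxE !eqxx /= mulr1 -/h addrK xa.
have := taylor Kmvi HB CR HD.
rewrite big1 => [|j _]; last by rewrite FR ?mulr0.
rewrite /x' subrK subr0 -/x' => T.
have -> : (x + v) 0 i - a 0 i = h by rewrite mxE xa addrC addKr.
clear H HD; clearbody c; move: (R _) T => u T.
have -> : c / k`!%:R - u / h ^+ k = - ((u - h ^+ k / k`!%:R * c) / h ^+ k).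
  move: (h ^+ k) (expf_neq0 k h0) (k`!%:R) (fact_neq0 k) => w w0 p p0.
  by field; rewrite w0 p0.
rewrite normrN normrM normfV ler_pdivrMr ?normr_gt0 ?expf_neq0 //.
apply: le_trans T _; rewrite normrX /d [2 ^+ _ * _]mulrC divfK //.
Qed.

Lemma C_infty_on_divided k R : flat_on_hyperplane k R -> C_infty_on B (divided k R).
Proof.
move=> FR; apply: (C_infty_on_coind
  (P := [set g | exists k R, flat_on_hyperplane k R /\ g = divided k R])) => //.
- move=> _ [k' [R' [FR' ->]]] x Bx; split; first exact: divided_continuous.
  by move=> j; have [] := is_derive_divided j FR' Bx.
- move=> _ j [k' [R' [FR' ->]]].
  exists (if j == i then divided k'.+1 (dividend k' R') else divided k' ('D_(ee j) R')).
    case: eqVneq => [_|ji].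
      by exists k'.+1, (dividend k' R'); split => //; exact: flat_dividend.
    by exists k', ('D_(ee j) R'); split => //; exact: flat_partial.
  by move=> x Bx; have [_ ->] := is_derive_divided j FR' Bx; case: eqP.
- by exists k, R.
Qed.

(** Induction on [d] over all [k] and [R]. A tangent derivative lowers the order of [R] by one, as
    allowed. The normal one passes to [k.+1] and [dividend k R], which keeps the order of [R]: its
    factor [x_i - a_i] restores what the derivative of [R] loses. *)
Lemma vanishes_to_divided d k R : flat_on_hyperplane k R ->
  vanishes_to (d + k) R a -> vanishes_to d (divided k R) a.
Proof.
have Ba : B a by exact: ballxx.
elim: d k R => [//|d IH] k R FR vR; apply/vanishes_toS; split.
  by rewrite /divided eqxx vR ?mul0r // size_nseq addSn ltnS leq_addl.
move=> j; have CR := FR.1.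
apply: (vanishes_to_eq openB Ba (g := if j == i then divided k.+1 (dividend k R)
    else divided k ('D_(ee j) R))).
  by move=> y By; have [_ ->] := is_derive_divided j FR By; case: eqP.
have vDR j' : vanishes_to (d + k) ('D_(ee j') R) a.
  exact: ((vanishes_toS _ _ _).1 vR).2.
case: eqVneq => [_|ji]; last by apply: IH; [exact: flat_partial|exact: vDR].
apply: IH; first exact: flat_dividend.
rewrite addnS; apply: (vanishes_toD openB Ba).
- by apply: (C_infty_onM openB); [exact: C_infty_on_shift_coord|exact: C_infty_on_partial].
- by apply: (C_infty_onM openB); [exact: C_infty_on_cst|exact: CR].
- apply: (vanishes_toM1 openB Ba); last exact: vDR.
  + exact: C_infty_on_shift_coord.
  + exact: C_infty_on_partial.
  + exact: subrr.
- have -> : (fun y => - k%:R * R y) = (fun y => R y * - k%:R).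
    by apply/funext => y; rewrite mulrC.
  by apply: (vanishes_toM openB Ba); [exact: CR|exact: C_infty_on_cst|exact: vR].
Qed.

End Division.

(* Words index monomials with repetitions, x_1 x_2 and x_2 x_1 being different
   words, as Hadamard's lemma is iterated one coordinate at a time. *)
Fixpoint word (n l : nat) : finType :=
  if l is l'.+1 then ('I_n * word n l')%type else unit.

Lemma vanishes_to0 (K : numFieldType) (n d : nat) (x : 'rV[K]_n) :
  vanishes_to d (fun=> 0 : K) x.
Proof.
move=> t _; have -> : iter_partial t (fun=> 0 : K) = (fun=> 0) :> ('rV[K]_n -> K).
  by elim: t => [//|l' t /= ->]; apply/funext => y; exact: derive_cst.
by [].
Qed.

(** * Hadamard's lemma on a ball *)

Section Hadamard.
Context {K : numFieldType} (Kmvi : mean_value_inequality K) {n : nat}.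
Variables (a : 'rV[K]_n) (r : K) (r0 : 0 < r).
Local Notation ee := basis_vec.
Local Notation B := (ball a r).
Implicit Types (g : 'rV[K]_n -> K) (x : 'rV[K]_n).

Let openB : open (B : set 'rV[K]_n).
Proof. exact: ball_open. Qed.

Let Ba : B a.
Proof. exact: ballxx. Qed.

(** Projection onto the hyperplane [x_i = a_i]. It maps a ball of the sup norm centred at [a] into
    itself, so the domain never has to shrink. *)
Definition reset (i : 'I_n) x : 'rV[K]_n :=
  \row_j (if j == i then a 0 j else x 0 j).

Lemma reset_ball i x : B x -> B (reset i x).
Proof.
rewrite -ball_normE /= => H; apply: le_lt_trans H; apply: norm_le_coord => // j.
rewrite !mxE; case: eqP => _; first by rewrite subrr normr0.
by have := norm_coord_le (a - x) j; rewrite !mxE.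
Qed.

Lemma reset_id i x : x 0 i = a 0 i -> reset i x = x.
Proof. by move=> xa; apply/rowP => j; rewrite !mxE; case: eqP => // ->. Qed.

Lemma C_infty_on_reset_coord i k : C_infty_on B (fun x => reset i x 0 k).
Proof.
have [->|ki] := eqVneq k i.
  under eq_fun do rewrite mxE eqxx; exact: C_infty_on_cst.
under eq_fun do rewrite mxE (negPf ki); exact: C_infty_on_coord.
Qed.

Lemma C_infty_on_reset g i : C_infty_on B g -> C_infty_on B (g \o reset i).
Proof.
apply: (C_infty_on_comp Kmvi openB openB); first exact: C_infty_on_reset_coord.
exact: reset_ball.
Qed.

Lemma derive_reset g i j x : C_infty_on B g -> B x ->
  'D_(ee j) (g \o reset i) x = if j == i then 0 else 'D_(ee j) g (reset i x).
Proof.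
move=> Cg Bx.
have [_ ->] := derive_comp_rV Kmvi openB openB (C_infty_on_reset_coord i)
  (@reset_ball i) j Cg Bx.
have E k : 'D_(ee j) (fun y => reset i y 0 k) x = ((k != i) && (k == j))%:R.
  have [->|ki] /= := eqVneq k i.
    under eq_fun do rewrite mxE eqxx; exact: derive_cst.
  under eq_fun do rewrite mxE (negPf ki).
  by have [_ ->] := is_derive_coord j k x; rewrite eq_sym.
under eq_bigr => k _ do rewrite E.
have [->|ji] := eqVneq j i.
  by rewrite big1 // => k _; case: eqP => //=; rewrite mulr0.
rewrite (bigD1 j) //= ji eqxx mulr1 big1 ?addr0 // => k /negPf ->.
by rewrite andbF mulr0.
Qed.

Lemma vanishes_to_reset m g i : C_infty_on B g ->
  vanishes_to m g a -> vanishes_to m (g \o reset i) a.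
Proof.
elim: m g => [//|m IH] g Cg /vanishes_toS [g0 vg]; apply/vanishes_toS.
split=> [|j]; first by rewrite /= reset_id.
have CD := C_infty_on_partial j Cg.
have [ji|ji] := eqVneq j i.
  apply: (vanishes_to_eq openB Ba (g := fun=> 0)); last exact: vanishes_to0.
  by move=> y By; rewrite (derive_reset i j Cg By) ji eqxx.
apply: (vanishes_to_eq openB Ba (g := 'D_(ee j) g \o reset i)) => [y By|].
  by rewrite (derive_reset i j Cg By) (negPf ji).
exact: IH.
Qed.

(** The difference of [g] and [g \o reset i] vanishes on the hyperplane, so it can be divided once
    by the coordinate. Since [reset i] preserves the order of vanishing at [a], the division loses
    exactly one order. *)
Lemma hadamard_coord d g i : C_infty_on B g -> vanishes_to d.+1 g a ->
  exists q, [/\ C_infty_on B q, vanishes_to d q a &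
    forall x, B x -> g x = g (reset i x) + (x 0 i - a 0 i) * q x].
Proof.
move=> Cg vg; pose R y := -1 * (g \o reset i) y + g y.
have CR : C_infty_on B R.
  apply: (C_infty_onD openB); last exact: Cg.
  by apply: (C_infty_onM openB); [exact: C_infty_on_cst|exact: C_infty_on_reset].
have FR : flat_on_hyperplane a r i 1 R.
  split=> // -[|//] _ x Bx xa /=.
  by rewrite /R /= reset_id // mulN1r addNr.
exists (divided a i 1 R); split; first exact: C_infty_on_divided.
  apply: (vanishes_to_divided Kmvi r0) => //; rewrite addn1.
  apply: (vanishes_to_linear _ openB Ba); last exact: vg.
  - exact: C_infty_on_reset.
  - exact: Cg.
  - exact: vanishes_to_reset.
move=> x Bx; rewrite /divided; have [xa|xa] := eqVneq.
  by rewrite reset_id // xa subrr mul0r addr0.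
by rewrite expr1 mulrC divfK ?subr_eq0 // /R /= mulN1r addNKr.
Qed.

Lemma hadamard_seq d (s : seq 'I_n) g : C_infty_on B g -> vanishes_to d.+1 g a ->
  exists q : 'I_n -> 'rV[K]_n -> K,
    [/\ forall i, C_infty_on B (q i), forall i, vanishes_to d (q i) a &
    forall x, B x ->
      g x = g (foldr reset x s) + \sum_i (x 0 i - a 0 i) * q i x].
Proof.
elim: s g => [|i s IH] g Cg vg.
  exists (fun _ _ => 0); split => [_|_|x Bx]; [exact: C_infty_on_cst|exact: vanishes_to0|].
  by rewrite /= big1 ?addr0 // => i _; rewrite mulr0.
have [q [Cq vq gE]] := hadamard_coord i Cg vg.
have [q' [Cq' vq' gE']] := IH _ (C_infty_on_reset i Cg) (vanishes_to_reset i Cg vg).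
(* The induction hypothesis supplies a quotient for every coordinate, [i] included, hence the sum of
   [q] and [q' i]. *)
exists (fun j => if j == i then (fun x => q x + q' i x) else q' j); split.
- by move=> j; case: eqP => _; [apply: C_infty_onD|exact: Cq'].
- by move=> j; case: eqP => _; [exact: (vanishes_toD openB Ba)|exact: vq'].
move=> x Bx; rewrite (gE x Bx) -[g (reset i x)]/((g \o reset i) x) (gE' x Bx) /= -addrA.
congr (_ + _); rewrite (bigD1 i) //= [in RHS](bigD1 i) //= eqxx mulrDr.
rewrite addrC -addrA; congr (_ + _); congr (_ + _).
by apply: eq_bigr => j /negPf ->.
Qed.

Lemma hadamard d g : C_infty_on B g -> vanishes_to d.+1 g a ->
  exists q : 'I_n -> 'rV[K]_n -> K,
    [/\ forall i, C_infty_on B (q i), forall i, vanishes_to d (q i) a &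
    forall x, B x -> g x = \sum_i (x 0 i - a 0 i) * q i x].
Proof.
move=> Cg vg; have [q [Cq vq gE]] := hadamard_seq (enum 'I_n) Cg vg.
exists q; split => // x Bx; rewrite gE //.
suff -> : foldr reset x (enum 'I_n) = a by rewrite [g a](vg [::]) ?add0r.
have H (s : seq 'I_n) j : j \in s -> foldr reset x s 0 j = a 0 j.
  elim: s => [//|i s IH]; rewrite inE /= mxE; case: eqP => //= _; exact: IH.
by apply/rowP => j; rewrite H ?mem_enum.
Qed.

Fixpoint monomial (l : nat) : word n l -> 'rV[K]_n -> K :=
  match l with
  | 0 => fun _ _ => 1
  | l'.+1 => fun w x => (x 0 w.1 - a 0 w.1) * monomial w.2 x
  end.

Lemma C_infty_on_monomial l (w : word n l) : C_infty_on B (monomial w).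
Proof.
elim: l w => [|l IH] w /=; first exact: C_infty_on_cst.
by apply: C_infty_onM => //; exact: C_infty_on_shift_coord.
Qed.

Lemma vanishes_to_monomial l (w : word n l) : vanishes_to l (monomial w) a.
Proof.
elim: l w => [//|l IH] w /=; apply: (vanishes_toM1 openB Ba) => //.
- exact: C_infty_on_shift_coord.
- exact: C_infty_on_monomial.
- by rewrite subrr.
Qed.

Lemma hadamard_monomial l g : C_infty_on B g -> vanishes_to l g a ->
  exists2 q : word n l -> 'rV[K]_n -> K, forall w, C_infty_on B (q w) &
    forall x, B x -> g x = \sum_w monomial w x * q w x.
Proof.
elim: l g => [|l IH] g Cg vg.
  exists (fun _ => g) => // x Bx /=.
  by rewrite (big_pred1 tt) /= ?mul1r // => -[].
have [q [Cq vq gE]] := hadamard Cg vg.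
have /choice [Q QP] : forall i, exists Q : word n l -> 'rV[K]_n -> K,
    (forall w, C_infty_on B (Q w)) /\
    forall x, B x -> q i x = \sum_w monomial w x * Q w x.
  by move=> i; have [Q] := IH _ (Cq i) (vq i); exists Q.
exists (fun w => Q w.1 w.2) => [w|x Bx]; first exact: (QP w.1).1.
rewrite gE //; under eq_bigr => i _ do rewrite (QP i).2 // mulr_sumr.
by rewrite pair_bigA /=; apply: eq_bigr => w _; rewrite mulrA.
Qed.

End Hadamard.

(** * Goursat's theorem and Cauchy's estimate *)

Import ComplexField.Normc.

Section ComplexBasics.
Context {R : realType}.
Local Notation C := (R[i]%C).
Local Notation K := (R[i]%C : numFieldType).
Local Notation Re := (@complex.Re R).
Local Notation Im := (@complex.Im R).
Local Notation nrm := (@normc R).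
Implicit Types (z w : C) (x y t : R).

Lemma normE z : `|z| = (nrm z)%:C%C.
Proof. by []. Qed.

Lemma nrm_ge0 z : 0 <= nrm z.
Proof. by case: z => a b; exact: sqrtr_ge0. Qed.

Lemma le_normE z x : (`|z| <= x%:C%C) = (nrm z <= x).
Proof. by rewrite normE lecR. Qed.

Lemma Re_le_nrm z : `|Re z| <= nrm z.
Proof. by rewrite -lecR -normE; exact: normc_ge_Re. Qed.

Lemma Im_le_nrm z : `|Im z| <= nrm z.
Proof.
case: z => a b /=; rewrite -sqrtr_sqr ler_wsqrtr // lerDr; exact: sqr_ge0.
Qed.

Lemma nrm_real x : nrm x%:C%C = `|x|.
Proof. by rewrite /= expr0n /= addr0 sqrtr_sqr. Qed.

Lemma nrm_le_ReIm z : nrm z <= `|Re z| + `|Im z|.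
Proof.
have {1}-> : z = (Re z)%:C%C + 'i%C * (Im z)%:C%C by rewrite -complexE.
apply: le_trans (le_normcD _ _) _; rewrite normcM !nrm_real.
suff -> : nrm 'i%C = 1 by rewrite mul1r.
by rewrite /= expr0n expr1n add0r sqrtr1.
Qed.

Lemma nrm_eq0 z : (nrm z == 0) = (z == 0).
Proof. by apply/eqP/eqP => [/eq0_normc|->]; rewrite ?normc0. Qed.

Lemma nrmX z n : nrm (z ^+ n) = nrm z ^+ n.
Proof. by elim: n => [|n IH]; rewrite ?expr0 ?normc1 // !exprS normcM IH. Qed.

Lemma realC_pos (e : C) : 0 < e -> e = (Re e)%:C%C /\ 0 < Re e.
Proof.
by case: e => a b; rewrite ltcE /= => /andP [/eqP -> a0].
Qed.

Lemma realC_nneg (e : C) : 0 <= e -> e = (Re e)%:C%C /\ 0 <= Re e.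
Proof.
by case: e => a b; rewrite lecE /= => /andP [/eqP -> a0].
Qed.

Lemma near_realC (P : K -> Prop) t : (\forall z \near (t%:C%C : K), P z) ->
  \forall s \near t, P s%:C%C.
Proof.
move=> /nearPadd [r /realC_pos [-> r0] rP]; apply: (@nearPadd R R t _).2.
exists (Re r) => // h hr; rewrite rmorphD; apply: rP.
by rewrite normE ltcR nrm_real.
Qed.

Lemma is_derive_Re_Im (phi : K -> K) t (d : K) :
  is_derive (t%:C%C : K) (1 : K) phi d ->
  is_derive t (1 : R) (fun s : R => Re (phi s%:C%C)) (Re d) /\
  is_derive t (1 : R) (fun s : R => Im (phi s%:C%C)) (Im d).
Proof.
move=> /is_deriveP H.
have H' e : 0 < e -> \forall h \near (0 : R),
    nrm (phi (t + h)%:C%C - phi t%:C%C - h%:C%C * d) <= e * `|h|.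
  move=> e0; have := H e%:C%C; rewrite ltcR => /(_ e0) /near_realC.
  apply: filterS => h; rewrite normE [`|h%:C%C|]normE nrm_real -rmorphM lecR.
  by rewrite /GRing.scale /= mulr1 rmorphD.
have ReE u v w (h : R) : Re (u - v - h%:C%C * w) = Re u - Re v - h * Re w.
  by case: u v w => [? ?] [? ?] [? ?] /=; rewrite mul0r subr0.
have ImE u v w (h : R) : Im (u - v - h%:C%C * w) = Im u - Im v - h * Im w.
  by case: u v w => [? ?] [? ?] [? ?] /=; rewrite mul0r addr0.
split; apply/is_deriveP => e /H'; apply: filterS => h H1;
  apply: le_trans H1; rewrite /GRing.scale /= mulr1.
  by rewrite -ReE; exact: Re_le_nrm.
by rewrite -ImE; exact: Im_le_nrm.
Qed.

Lemma real_mean_value (f df : R -> R) :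
  (forall t : R, 0 <= t <= 1 -> is_derive t (1 : R) f (df t)) ->
  exists2 t : R, 0 <= t <= 1 & f 1 - f 0 = df t.
Proof.
move=> H; have [||c] := @MVT_segment R f df 0 1 ler01.
- by move=> x; rewrite in_itv /= => /andP [x0 x1]; apply: H; rewrite !ltW.
- apply: derivable_within_continuous => x; rewrite in_itv /= => x01.
  by have [] := H x x01.
- by rewrite in_itv /= subr0 mulr1 => c01 ->; exists c.
Qed.

Lemma real_mean_value_inequality : mean_value_inequality R.
Proof.
move=> f df M H b; have [t t01 ->] := real_mean_value H.
have := b t t01; have := normr_ge0 (df t); lra.
Qed.

Lemma complex_mean_value_inequality : mean_value_inequality K.
Proof.
move=> f df M H b.
have M0 : 0 <= M by apply: le_trans (b 0 _); rewrite ?lexx ?ler01.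
have [m ME] : exists m : R, M = m%:C%C by exists (Re M); have [] := realC_nneg M0.
rewrite {}ME {M} in b M0 *.
have H' (t : R) : 0 <= t <= 1 -> 0 <= (t%:C%C : C) <= 1 by rewrite !lecR.
have b' (t : R) : 0 <= t <= 1 -> nrm (df t%:C%C) <= m.
  by move=> /H' /b; rewrite le_normE.
have [t t01 tE] : exists2 t : R, 0 <= t <= 1 & Re (f 1 - f 0) = Re (df t%:C%C).
  have [|t t01 tE] := real_mean_value (f := fun s => Re (f s%:C%C))
    (df := fun s => Re (df s%:C%C)).
    by move=> t /H' /H /is_derive_Re_Im [].
  by exists t => //; rewrite -tE; move: (f _) (f _) => [? ?] [? ?].
have [s s01 sE] : exists2 t : R, 0 <= t <= 1 & Im (f 1 - f 0) = Im (df t%:C%C).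
  have [|s s01 sE] := real_mean_value (f := fun s => Im (f s%:C%C))
    (df := fun s => Im (df s%:C%C)).
    by move=> t' /H' /H /is_derive_Re_Im [].
  by exists s => //; rewrite -sE; move: (f _) (f _) => [? ?] [? ?].
have -> : 2 * m%:C%C = (2 * m)%:C%C :> C by rewrite rmorphM rmorph_nat.
rewrite le_normE; apply: le_trans (nrm_le_ReIm _) _; rewrite tE sE.
have := Re_le_nrm (df t%:C%C); have := Im_le_nrm (df s%:C%C).
have := b' _ t01; have := b' _ s01; lra.
Qed.

End ComplexBasics.

(** * Integrals over the unit interval *)

Section RealIntegral.
Context {R : realType}.
Implicit Types (f g : R -> R) (t v : R).

(* Integrals are differences of primitives; the Lebesgue integral is used only to
   find a primitive of a continuous function. *)
Definition is_integral f v := exists G : R -> R,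
  (forall t, 0 <= t <= 1 -> is_derive t (1 : R) G (f t)) /\ v = G 1 - G 0.

Lemma is_integral_ext f g v : (forall t, 0 <= t <= 1 -> f t = g t) ->
  is_integral f v -> is_integral g v.
Proof.
by move=> fg [G [dG ->]]; exists G; split => // t t01; rewrite -fg //; exact: dG.
Qed.

Lemma is_integral_continuous f : continuous f -> exists v, is_integral f v.
Proof.
(* The integration starts at -1 and integrability is used up to 2, so that the primitive has a
   two-sided derivative even at 0 and 1. *)
move=> cf; pose G x : R := (\int[lebesgue_measure]_(t in `[-1, x]) f t)%R.
exists (G 1 - G 0), G; split => // t /andP [t0 t1].
have cI : lebesgue_measure.-integrable `[-1, 2] (EFin \o f).
  apply: continuous_compact_integrable; first exact: segment_compact.
  by apply: continuous_subspaceT; exact: cf.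
have t2 : t < 2 by apply: le_lt_trans t1 _; rewrite ltr1n.
have t_1 : -1 < t by apply: lt_le_trans t0; rewrite ltrN10.
have [d1 d2] := continuous_FTC1_closed t2 cI t_1 (cf t).
by split; [exact: d1|rewrite -derive1E].
Qed.

Lemma is_integral_linear (c : R) f g v w : is_integral f v -> is_integral g w ->
  is_integral (fun t => c * f t + g t) (c * v + w).
Proof.
move=> [F [dF ->]] [G [dG ->]]; exists (fun t => c * F t + G t); split; last by ring.
move=> t t01; have dFt := dF t t01; have dGt := dG t t01.
exact: (is_deriveD (is_deriveZ c dFt) dGt).
Qed.

Lemma is_derive_affine f (t d c c0 : R) :
  is_derive (c * t + c0) (1 : R) f d ->
  is_derive t (1 : R) (fun s => f (c * s + c0)) (c * d).
Proof.
move=> H.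
have H' : is_derive (c0 + t *: c : R) (1 : R) f d.
  by rewrite /GRing.scale /= addrC mulrC.
have H2 : is_derive (c0 + t *: c : R) (c : R) f (c * d).
  by have := is_derive_scale_dir c H'; rewrite [c *: 1]mulr1.
have := is_derive_line H2.
by congr is_derive; apply/funext => s; rewrite /GRing.scale /= addrC mulrC.
Qed.

Lemma is_integral_mvi f v (M : R) : is_integral f v ->
  (forall t, 0 <= t <= 1 -> `|f t| <= M) -> `|v| <= M.
Proof.
by move=> [G [dG ->]] fM; have [t t01 ->] := real_mean_value dG; exact: fM.
Qed.

Lemma is_integral_lower f v (m : R) : is_integral f v ->
  (forall t, 0 <= t <= 1 -> m <= f t) -> m <= v.
Proof.
by move=> [G [dG ->]] fM; have [t t01 ->] := real_mean_value dG; exact: fM.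
Qed.

(** The difference is an integral of zero, hence zero by the mean value theorem. This justifies
    treating integrals as a relation. *)
Lemma is_integral_unique f v w : is_integral f v -> is_integral f w -> v = w.
Proof.
move=> fv fw; have := is_integral_linear (-1) fv fw.
move=> /(@is_integral_mvi _ _ 0) H; apply/eqP; rewrite -subr_eq0 -normr_le0.
rewrite -normrN opprB -mulN1r addrC; apply: H => t _.
by rewrite mulN1r addNr normr0.
Qed.

Lemma is_integral_halves f v : is_integral f v -> exists v1 v2,
  [/\ is_integral (fun t => 2^-1 * f (2^-1 * t + 0)) v1,
      is_integral (fun t => 2^-1 * f (2^-1 * t + 2^-1)) v2 & v = v1 + v2].
Proof.
move=> [G [dG ->]]; exists (G 2^-1 - G 0), (G 1 - G 2^-1); split; last by ring.
  exists (fun t => G (2^-1 * t + 0)); rewrite mulr1 mulr0 !addr0; split => // t t01.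
  by apply: is_derive_affine; apply: dG; lra.
exists (fun t => G (2^-1 * t + 2^-1)); rewrite mulr1 mulr0 !add0r; split => [t t01|].
  by apply: is_derive_affine; apply: dG; lra.
by congr (G _ - _); field.
Qed.

Lemma is_integral_rev f v : is_integral f v ->
  is_integral (fun t => -1 * f (-1 * t + 1)) (- v).
Proof.
move=> [G [dG ->]]; exists (fun t => G (-1 * t + 1)); split => [t t01|].
  by apply: is_derive_affine; apply: dG; lra.
by rewrite mulr1 mulr0 add0r addNr opprB.
Qed.

Lemma is_integral_affine (c0 c1 : R) :
  is_integral (fun t => c0 + t * c1) (c0 + c1 / 2).
Proof.
exists (fun t => t * c0 + (t * t) * (c1 / 2)); split; last by field.
move=> t t01.
apply/is_deriveP => e e0; apply/nearPadd.
have [c10|c10] := eqVneq c1 0.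
  exists 1 => // h _; rewrite add0r /GRing.scale /= c10.
  by apply: le_trans (_ : 0 <= _); [rewrite normr_le0; apply/eqP; ring|rewrite mulr_ge0 // ltW].
exists (e / `|c1|) => [|h]; first by rewrite divr_gt0 ?normr_gt0.
rewrite add0r /GRing.scale /= ltr_pdivlMr ?normr_gt0 // => he.
have -> : (t + h * 1) * c0 + (t + h * 1) * (t + h * 1) * (c1 / 2) -
    (t * c0 + t * t * (c1 / 2)) - h * (c0 + t * c1) = (h * c1 / 2) * h by field.
rewrite normrM ler_wpM2r //; apply: le_trans (ltW he).
by rewrite -normrM [leLHS]normrM ler_piMr // ger0_norm // invf_le1 // ler1n.
Qed.

End RealIntegral.

(** * Integrals along segments of the complex plane *)

Section SegmentIntegral.
Context {R : realType}.
Local Notation C := (R[i]%C).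
Local Notation K := (R[i]%C : numFieldType).
Local Notation Re := (@complex.Re R).
Local Notation Im := (@complex.Im R).
Local Notation nrm := (@normc R).
Local Open Scope complex_scope.
Implicit Types (z w v a b c : C) (x y t : R) (psi : C -> C) (g : R -> C).

Lemma reD z w : Re (z + w) = Re z + Re w. Proof. by case: z w => ? ? [? ?]. Qed.
Lemma imD z w : Im (z + w) = Im z + Im w. Proof. by case: z w => ? ? [? ?]. Qed.
Lemma reM z w : Re (z * w) = Re z * Re w + - Im z * Im w.
Proof. by case: z w => ? ? [? ?] /=; rewrite mulNr. Qed.
Lemma imM z w : Im (z * w) = Re z * Im w + Im z * Re w.
Proof. by case: z w => ? ? [? ?]. Qed.
Lemma reN z : Re (- z) = - Re z. Proof. by case: z. Qed.
Lemma imN z : Im (- z) = - Im z. Proof. by case: z. Qed.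

Lemma realCM x y : (x * y)%:C = x%:C * y%:C. Proof. exact: rmorphM. Qed.
Lemma realCD x y : (x + y)%:C = x%:C + y%:C. Proof. exact: rmorphD. Qed.
Lemma realCB x y : (x - y)%:C = x%:C - y%:C. Proof. exact: rmorphB. Qed.

Definition is_cintegral g v :=
  is_integral (fun t => Re (g t)) (Re v) /\ is_integral (fun t => Im (g t)) (Im v).

Lemma is_cintegral_ext g g' v : (forall t, 0 <= t <= 1 -> g t = g' t) ->
  is_cintegral g v -> is_cintegral g' v.
Proof.
move=> gg [H1 H2]; split.
  by apply: is_integral_ext H1 => t /gg ->.
by apply: is_integral_ext H2 => t /gg ->.
Qed.

Lemma is_cintegral_linear c g g' v v' : is_cintegral g v -> is_cintegral g' v' ->
  is_cintegral (fun t => c * g t + g' t) (c * v + v').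
Proof.
move=> [H1 H2] [H1' H2']; split.
  have := is_integral_linear (Re c) H1 (is_integral_linear (- Im c) H2 H1').
  rewrite addrA reD reM; apply: is_integral_ext => t _.
  by rewrite reD reM addrA.
have := is_integral_linear (Re c) H2 (is_integral_linear (Im c) H1 H2').
rewrite addrA imD imM; apply: is_integral_ext => t _.
by rewrite imD imM addrA.
Qed.

Lemma eq_ReIm z w : Re z = Re w -> Im z = Im w -> z = w.
Proof. by case: z w => ? ? [? ?] /= -> ->. Qed.

Lemma is_cintegral_unique g v w : is_cintegral g v -> is_cintegral g w -> v = w.
Proof.
move=> [H1 H2] [H1' H2']; apply: eq_ReIm.
  exact: is_integral_unique H1 H1'.
exact: is_integral_unique H2 H2'.
Qed.

Lemma is_cintegral_bound g v (M : R) : is_cintegral g v ->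
  (forall t, 0 <= t <= 1 -> nrm (g t) <= M) -> nrm v <= 2 * M.
Proof.
move=> [H1 H2] gM; apply: le_trans (nrm_le_ReIm v) _.
have := is_integral_mvi H1 (M := M) => H1'.
have := is_integral_mvi H2 (M := M) => H2'.
rewrite mulr_natl mulr2n lerD //.
  by apply: H1' => t /gM; apply: le_trans; exact: Re_le_nrm.
by apply: H2' => t /gM; apply: le_trans; exact: Im_le_nrm.
Qed.

Lemma Re_realM x z : Re (x%:C * z) = x * Re z.
Proof. by rewrite reM /= oppr0 mul0r addr0. Qed.
Lemma Im_realM x z : Im (x%:C * z) = x * Im z.
Proof. by rewrite imM /= mul0r addr0. Qed.

Lemma is_cintegral_halves g v : is_cintegral g v -> exists v1 v2,
  [/\ is_cintegral (fun t => (2^-1 : R)%:C * g (2^-1 * t + 0)) v1,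
      is_cintegral (fun t => (2^-1 : R)%:C * g (2^-1 * t + 2^-1)) v2 & v = v1 + v2].
Proof.
move=> [/is_integral_halves [x1 [x2 [X1 X2 E]]] /is_integral_halves [y1 [y2 [Y1 Y2 F]]]].
exists (Complex x1 y1), (Complex x2 y2); split; last exact: eq_ReIm.
  by split; [apply: is_integral_ext X1|apply: is_integral_ext Y1] => t _;
    rewrite ?Re_realM ?Im_realM.
by split; [apply: is_integral_ext X2|apply: is_integral_ext Y2] => t _;
  rewrite ?Re_realM ?Im_realM.
Qed.

Lemma is_cintegral_rev g v : is_cintegral g v ->
  is_cintegral (fun t => - g (-1 * t + 1)) (- v).
Proof.
move=> [H1 H2]; split; rewrite ?reN ?imN.
  by apply: is_integral_ext (is_integral_rev H1) => t _; rewrite mulN1r reN.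
by apply: is_integral_ext (is_integral_rev H2) => t _; rewrite mulN1r imN.
Qed.

Lemma is_cintegral_affine c0 c1 :
  is_cintegral (fun t => c0 + t%:C * c1) (c0 + (2^-1 : R)%:C * c1).
Proof.
split; rewrite ?reD ?imD ?Re_realM ?Im_realM [_^-1 * _]mulrC.
  by apply: is_integral_ext (is_integral_affine _ _) => t _; rewrite reD Re_realM.
by apply: is_integral_ext (is_integral_affine _ _) => t _; rewrite imD Im_realM.
Qed.

Definition segment a b t : C := a + t%:C * (b - a).

Definition is_segment_integral psi a b v :=
  is_cintegral (fun t => (b - a) * psi (segment a b t)) v.

Lemma is_segment_integral_rev psi a b v :
  is_segment_integral psi a b v -> is_segment_integral psi b a (- v).
Proof.
move=> /is_cintegral_rev; apply: is_cintegral_ext => t _.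
rewrite -mulNr opprB; congr (_ * psi _).
by rewrite /segment realCD realCM rmorphN1; ring.
Qed.

Lemma half2 : (2^-1 : R)%:C = 2^-1.
Proof. by rewrite fmorphV rmorph_nat. Qed.

Lemma is_segment_integral_halves psi a b v :
  is_segment_integral psi a b v -> exists v1 v2,
  [/\ is_segment_integral psi a ((a + b) / 2) v1,
      is_segment_integral psi ((a + b) / 2) b v2 & v = v1 + v2].
Proof.
move=> /is_cintegral_halves [v1 [v2 [H1 H2 ->]]]; exists v1, v2; split => //.
  apply: is_cintegral_ext H1 => t _; rewrite mulrA half2; congr (_ * psi _).
    by field.
  by rewrite /segment addr0 realCM half2; field.
apply: is_cintegral_ext H2 => t _; rewrite mulrA half2; congr (_ * psi _).
  by field.
by rewrite /segment realCD realCM half2; field.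
Qed.

(** The value is an increment of the primitive [c0 * z + c1 / 2 * z ^+ 2], so the contributions
    cancel around a triangle. *)
Lemma is_segment_integral_affine (c0 c1 : C) a b :
  is_segment_integral (fun z => c0 + c1 * z) a b
    (c0 * (b - a) + c1 / 2 * (b ^+ 2 - a ^+ 2)).
Proof.
have := is_cintegral_affine ((b - a) * (c0 + c1 * a)) (c1 * (b - a) ^+ 2).
have -> : (b - a) * (c0 + c1 * a) + (2^-1 : R)%:C * (c1 * (b - a) ^+ 2) =
   c0 * (b - a) + c1 / 2 * (b ^+ 2 - a ^+ 2) by rewrite half2; field.
by apply: is_cintegral_ext => t _; rewrite /segment; ring.
Qed.

Lemma is_segment_integral_bound psi a b v (M : R) :
  is_segment_integral psi a b v ->
  (forall t, 0 <= t <= 1 -> nrm (psi (segment a b t)) <= M) ->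
  nrm v <= 2 * (nrm (b - a) * M).
Proof.
move=> H HM; apply: is_cintegral_bound H _ => t /HM H.
by rewrite normcM ler_wpM2l // nrm_ge0.
Qed.

(* Extends an integrand from [0, 1] to a continuous function on R. *)
Definition clamp t : R := if t < 0 then 0 else if 1 < t then 1 else t.

Lemma clamp01 t : 0 <= clamp t <= 1.
Proof. by rewrite /clamp; do 2 case: ltP => ?; lra. Qed.

Lemma clamp_id t : 0 <= t <= 1 -> clamp t = t.
Proof. by rewrite /clamp; do 2 case: ltP => ?; lra. Qed.

Lemma clamp_lipschitz t h : `|clamp (t + h) - clamp t| <= `|h|.
Proof.
rewrite /clamp; have := ler_norm h; have := ler_norm (- h); rewrite normrN.
move=> ? ?; rewrite ler_norml; do 4 case: ltP => ?; lra.
Qed.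

Lemma continuous_ReIm (g : R -> C) :
  (forall t (e : R), 0 < e -> \forall h \near (0 : R), nrm (g (t + h) - g t) <= e) ->
  continuous (fun t => Re (g t)) /\ continuous (fun t => Im (g t)).
Proof.
move=> H.
have N t e : 0 < e -> \forall s \near t, nrm (g s - g t) <= e.
  move=> /(H t) /nearPadd [r r0 rP]; apply/nearPadd; exists r => // h hr.
  by have := rP h hr; rewrite add0r.
split=> t; apply/cvgrPdist_le => e e0; apply: filterS (N t e e0) => s H1;
  apply: le_trans H1; rewrite distrC.
  by rewrite -reN -reD; exact: Re_le_nrm.
by rewrite -imN -imD; exact: Im_le_nrm.
Qed.

Lemma derivable_nrm_continuous (psi : K -> K) (p : K) (e : R) :
  derivable psi p (1 : K) -> 0 < e ->
  exists2 d : R, 0 < d & forall h : C, nrm h < d -> nrm (psi (p + h) - psi p) <= e.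
Proof.
move=> /derivable1_diffP /differentiable_continuous cp e0.
have : \forall q \near (p : K), `|psi q - psi p| <= e%:C.
  by move/cvgrPdist_le : cp => /(_ e%:C); rewrite ltcR => /(_ e0);
    apply: filterS => q; rewrite distrC.
move=> /nearPadd [r /realC_pos [-> r0] rP]; exists (Re r) => // h hr.
by rewrite -le_normE; apply: rP; rewrite normE ltcR.
Qed.

Lemma is_segment_integral_exists (psi : K -> K) a b :
  (forall t, 0 <= t <= 1 -> derivable psi (segment a b t : K) (1 : K)) ->
  exists v, is_segment_integral psi a b v.
Proof.
move=> dpsi; pose g t := (b - a) * psi (segment a b (clamp t)).
have [|c1 c2] := @continuous_ReIm g.
  move=> t e e0.
  have [ab|ab] := eqVneq (b - a) 0.
    by near=> h; rewrite /g ab !mul0r subrr normc0 ltW.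
  have N0 : 0 < nrm (b - a) by rewrite lt_def nrm_eq0 ab nrm_ge0.
  have [d d0 dP] := derivable_nrm_continuous (dpsi _ (clamp01 t)) (divr_gt0 e0 N0).
  apply/nearPadd; exists (d / nrm (b - a)); first by rewrite divr_gt0.
  move=> h; rewrite add0r ltr_pdivlMr // => hd.
  rewrite /g -mulrBr normcM mulrC -ler_pdivlMr //.
  have -> : segment a b (clamp (t + h)) =
      segment a b (clamp t) + (clamp (t + h) - clamp t)%:C * (b - a).
    by rewrite /segment realCB; ring.
  apply: dP; rewrite normcM nrm_real; apply: le_lt_trans hd.
  by rewrite ler_wpM2r ?nrm_ge0 // clamp_lipschitz.
have [x X] := is_integral_continuous c1; have [y Y] := is_integral_continuous c2.
exists (Complex x y); split.
  by apply: is_integral_ext X => t t01; rewrite /g clamp_id.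
by apply: is_integral_ext Y => t t01; rewrite /g clamp_id.
Unshelve. all: by end_near. Qed.

End SegmentIntegral.

(** * Limits of sequences with dyadic increments *)

Section DyadicLimit.
Context {R : realType}.

(** The intervals of radius [P / 2 ^+ n] about [u n] are nested, because the next radius is half the
    previous one; the supremum of their left ends lies in all of them. *)
Lemma dyadic_limit (u : nat -> R) (P : R) :
  (forall n, `|u n.+1 - u n| <= P / 2 ^+ n.+1) ->
  exists x, forall n, `|u n - x| <= P / 2 ^+ n.
Proof.
move=> H; pose l n := u n - P / 2 ^+ n; pose h n := u n + P / 2 ^+ n.
have E n : P / 2 ^+ n = 2 * (P / 2 ^+ n.+1).
  by rewrite exprS; field; rewrite expf_neq0.
have ln n : l n <= l n.+1.
  by have := H n; rewrite /l (E n) ler_norml => /andP [? ?]; lra.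
have hn n : h n.+1 <= h n.
  by have := H n; rewrite /h (E n) ler_norml => /andP [? ?]; lra.
have lm : {homo l : m n / (m <= n)%N >-> m <= n}.
  by apply: homo_leq => //; exact: le_trans.
have hm : {homo h : m n / (m <= n)%N >-> n <= m}.
  by apply: (homo_leq (r := fun x y => y <= x)) => // y x z xy /le_trans; apply.
have P0 n : 0 <= P / 2 ^+ n by rewrite E mulr_ge0 //; apply: le_trans (H n).
have lh m n : l m <= h n.
  apply: le_trans (lm _ _ (leq_maxl m n)) _.
  apply: le_trans _ (hm _ _ (leq_maxr m n)).
  by rewrite /l /h; have := P0 (maxn m n); lra.
exists (sup (range l)) => n; rewrite ler_norml.
have A : l n <= sup (range l).
  by apply: ub_le_sup; [exists (h 0%N) => _ [m _ <-]|exists n].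
have B : sup (range l) <= h n.
  by apply: ge_sup; [exists (l 0%N); exists 0%N|move=> _ [m _ <-]].
by move: A B; rewrite /l /h => ? ?; lra.
Qed.

Lemma dyadic_limit_complex (u : nat -> R[i]%C) (P : R) :
  (forall n, normc (u n.+1 - u n) <= P / 2 ^+ n.+1) ->
  exists x, forall n, normc (u n - x) <= 2 * (P / 2 ^+ n).
Proof.
move=> H.
have [n|x X] := @dyadic_limit (fun n => complex.Re (u n)) P.
  by apply: le_trans (H n); rewrite -reN -reD; exact: Re_le_nrm.
have [n|y Y] := @dyadic_limit (fun n => complex.Im (u n)) P.
  by apply: le_trans (H n); rewrite -imN -imD; exact: Im_le_nrm.
exists (Complex x y) => n; apply: le_trans (nrm_le_ReIm _) _.
by rewrite reD imD reN imN /= mulr_natl mulr2n lerD.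
Qed.

Lemma dyadic_small (P e : R) : 0 < e -> exists n, P / 2 ^+ n < e.
Proof.
move=> e0; exists (Num.bound `|P / e|).
rewrite ltr_pdivrMr ?exprn_gt0 // mulrC -ltr_pdivrMr //.
apply: le_lt_trans (ler_norm _) _; apply: lt_le_trans (archi_boundP _) _ => //.
by rewrite -natrX ler_nat; apply: ltnW; exact: ltn_expl.
Qed.

End DyadicLimit.

(** * Goursat's theorem for triangles *)

Section Goursat.
Context {R : realType}.
Local Notation C := (R[i]%C).
Local Notation K := (R[i]%C : numFieldType).
Local Notation nrm := (@normc R).
Local Open Scope complex_scope.
Variables (D : set C) (psi : K -> K).
Hypothesis closedD : forall p : C,
  (forall e : R, 0 < e -> exists2 z, D z & nrm (z - p) < e) -> D p.
Hypothesis convexD : forall a b (t : R), D a -> D b -> 0 <= t <= 1 ->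
  D (segment a b t).
Hypothesis dpsi : forall p, D p -> derivable psi (p : K) (1 : K).

Definition is_triangle_integral (f : C -> C) a b c v := exists v1 v2 v3,
  [/\ is_segment_integral f a b v1, is_segment_integral f b c v2,
      is_segment_integral f c a v3 & v = v1 + v2 + v3].

Definition perimeter (a b c : C) : R := nrm (b - a) + nrm (c - b) + nrm (a - c).

Lemma nrmD (z w : C) : nrm (z + w) <= nrm z + nrm w.
Proof. exact: le_normcD. Qed.

Lemma nrm_distC (z w : C) : nrm (z - w) = nrm (w - z).
Proof. by rewrite -opprB; exact: normcN. Qed.

Lemma nrm_half (z : C) : nrm (z / 2) = nrm z / 2.
Proof. by rewrite -half2 normcM nrm_real ger0_norm // invr_ge0. Qed.

Let good (q : C * C * C * C) : Prop :=
  let: (a, b, c, v) := q in [/\ D a, D b, D c & is_triangle_integral psi a b c v].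

Lemma segment_integral_exists a b : D a -> D b ->
  exists v, is_segment_integral psi a b v.
Proof.
by move=> Da Db; apply: is_segment_integral_exists => t t01; exact/dpsi/convexD.
Qed.

Lemma midpoint_segment (a b : C) : (a + b) / 2 = segment a b (2^-1).
Proof. by rewrite /segment half2; field. Qed.

Lemma convex_midpoint a b : D a -> D b -> D ((a + b) / 2).
Proof. by move=> Da Db; rewrite midpoint_segment; apply: convexD => //; lra. Qed.

(** The midpoints cut the triangle into four similar ones, one of which carries at least a quarter
    of the integral. The last bound makes the first vertices of iterated choices converge. *)
Lemma triangle_quarter (a b c v : C) : good (a, b, c, v) ->
  exists a' b' c' v', [/\ good (a', b', c', v'), nrm v <= 4 * nrm v',
    perimeter a' b' c' = perimeter a b c / 2 &
    nrm (a' - a) <= perimeter a b c / 2].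
Proof.
move=> [Da Db Dc [v1 [v2 [v3 [H1 H2 H3 vE]]]]].
have [v11 [v12 [H11 H12 E1]]] := is_segment_integral_halves H1.
have [v21 [v22 [H21 H22 E2]]] := is_segment_integral_halves H2.
have [v31 [v32 [H31 H32 E3]]] := is_segment_integral_halves H3.
set m1 := (a + b) / 2 in H11 H12; set m2 := (b + c) / 2 in H21 H22.
set m3 := (c + a) / 2 in H31 H32.
have Dm1 : D m1 by exact: convex_midpoint.
have Dm2 : D m2 by exact: convex_midpoint.
have Dm3 : D m3 by exact: convex_midpoint.
have [w13 W13] := segment_integral_exists Dm1 Dm3.
have [w21 W21] := segment_integral_exists Dm2 Dm1.
have [w32 W32] := segment_integral_exists Dm3 Dm2.
(* Each inner side occurs once in a corner triangle and once, reversed, in the central one, so the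
   four integrals add up to [v]. *)
pose u1 := v11 + w13 + v32; pose u2 := v12 + v21 + w21.
pose u3 := w32 + v22 + v31; pose u4 := - w21 + - w32 + - w13.
have vu : v = u1 + u2 + u3 + u4 by rewrite vE E1 E2 E3 /u1 /u2 /u3 /u4; ring.
have G1 : good (a, m1, m3, u1) by split => //; exists v11, w13, v32.
have G2 : good (m1, b, m2, u2) by split => //; exists v12, v21, w21.
have G3 : good (m3, m2, c, u3) by split => //; exists w32, v22, v31.
have G4 : good (m1, m2, m3, u4).
  by split => //; exists (- w21), (- w32), (- w13); split => //;
    exact: is_segment_integral_rev.
have ab := nrm_ge0 (b - a); have bc := nrm_ge0 (c - b); have ca := nrm_ge0 (a - c).
have N0 : nrm (a - a) = 0 by rewrite subrr normc0.
have N1 : nrm (m1 - a) = nrm (b - a) / 2.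
  by rewrite -nrm_half; congr nrm; rewrite /m1; field.
have N2 : nrm (m3 - a) = nrm (a - c) / 2.
  by rewrite nrm_distC -nrm_half; congr nrm; rewrite /m3; field.
have S1 : perimeter a m1 m3 = perimeter a b c / 2.
  rewrite /perimeter mulrDl mulrDl -!nrm_half; congr (nrm _ + nrm _ + nrm _);
    by rewrite /m1 /m3; field.
have S2 : perimeter m1 b m2 = perimeter a b c / 2.
  rewrite /perimeter mulrDl mulrDl -!nrm_half; congr (nrm _ + nrm _ + nrm _);
    by rewrite /m1 /m2; field.
have S3 : perimeter m3 m2 c = perimeter a b c / 2.
  rewrite /perimeter mulrDl mulrDl -!nrm_half; congr (nrm _ + nrm _ + nrm _);
    by rewrite /m2 /m3; field.
have S4 : perimeter m1 m2 m3 = perimeter a b c / 2.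
  have F1 : nrm (m2 - m1) = nrm (a - c) / 2.
    by rewrite nrm_distC -nrm_half; congr nrm; rewrite /m1 /m2; field.
  have F2 : nrm (m3 - m2) = nrm (b - a) / 2.
    by rewrite nrm_distC -nrm_half; congr nrm; rewrite /m3 /m2; field.
  have F3 : nrm (m1 - m3) = nrm (c - b) / 2.
    by rewrite nrm_distC -nrm_half; congr nrm; rewrite /m1 /m3; field.
  rewrite /perimeter F1 F2 F3; lra.
have Q : nrm v <= nrm u1 + nrm u2 + nrm u3 + nrm u4.
  rewrite vu; apply: le_trans (nrmD _ _) _; rewrite lerD2r.
  apply: le_trans (nrmD _ _) _; rewrite lerD2r; exact: nrmD.
rewrite /perimeter in S1 S2 S3 S4 *.
(* If three pieces fall short of a quarter of [v], the bound [Q] forces the fourth to reach it. *)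
have [L1|L1] := leP (nrm v) (4 * nrm u1).
  by exists a, m1, m3, u1; split => //; rewrite N0; lra.
have [L2|L2] := leP (nrm v) (4 * nrm u2).
  by exists m1, b, m2, u2; split => //; rewrite N1; lra.
have [L3|L3] := leP (nrm v) (4 * nrm u3).
  by exists m3, m2, c, u3; split => //; rewrite N2; lra.
by exists m1, m2, m3, u4; split => //; [lra|rewrite N1; lra].
Qed.

Lemma segment_nrm a b t : 0 <= t <= 1 -> nrm (segment a b t - a) <= nrm (b - a).
Proof.
move=> /andP [t0 t1].
have -> : segment a b t - a = t%:C * (b - a) by rewrite /segment addrC addKr.
by rewrite normcM nrm_real ger0_norm // ler_piMl // nrm_ge0.
Qed.

Lemma nrmB3 (x y z : C) : nrm (x - z) <= nrm (x - y) + nrm (y - z).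
Proof. by have := nrmD (x - y) (y - z); rewrite addrA subrK. Qed.

Lemma is_segment_integral_linear (f g : C -> C) (k : C) a b v w :
  is_segment_integral f a b v -> is_segment_integral g a b w ->
  is_segment_integral (fun z => k * f z + g z) a b (k * v + w).
Proof.
move=> fv gw; apply: is_cintegral_ext (is_cintegral_linear k fv gw) => t _.
by rewrite mulrDr mulrCA.
Qed.

(** Subtracting the first order approximation of [psi] at [p] does not change the integral over the
    triangle, and what remains is at most [e * d] on the three sides, which all lie within [d] of
    [p]. *)
Lemma goursat_local (a b c v p : C) (e d : R) :
  is_triangle_integral psi a b c v -> 0 <= e ->
  (forall z, nrm (z - p) <= d ->
    nrm (psi z - psi p - (z - p) * 'D_1 psi (p : K)) <= e * d) ->
  nrm (a - p) + perimeter a b c <= d ->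
  nrm v <= 2 * (perimeter a b c * (e * d)).
Proof.
move=> [v1 [v2 [v3 [H1 H2 H3 ->]]]] e0 He Hd.
set D1 := 'D_1 psi (p : K) in He.
pose c0 := psi p - p * D1.
pose err z := -1 * (c0 + D1 * z) + psi z.
have E1 := is_segment_integral_linear (-1) (is_segment_integral_affine c0 D1 a b) H1.
have E2 := is_segment_integral_linear (-1) (is_segment_integral_affine c0 D1 b c) H2.
have E3 := is_segment_integral_linear (-1) (is_segment_integral_affine c0 D1 c a) H3.
have ab := nrm_ge0 (b - a); have bc := nrm_ge0 (c - b); have ca := nrm_ge0 (a - c).
have errB z : nrm (z - p) <= d -> nrm (err z) <= e * d.
  move=> /He; congr (nrm _ <= _); rewrite /err /c0; ring.
have B1 t : 0 <= t <= 1 -> nrm (err (segment a b t)) <= e * d.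
  move=> t01; apply: errB; apply: le_trans (nrmB3 _ a _) _.
  have := segment_nrm a b t01; rewrite /perimeter in Hd; lra.
have B2 t : 0 <= t <= 1 -> nrm (err (segment b c t)) <= e * d.
  move=> t01; apply: errB; apply: le_trans (nrmB3 _ b _) _.
  have := segment_nrm b c t01; have := nrmB3 b a p; rewrite /perimeter in Hd; lra.
have B3 t : 0 <= t <= 1 -> nrm (err (segment c a t)) <= e * d.
  move=> t01; apply: errB; apply: le_trans (nrmB3 _ c _) _.
  have := segment_nrm c a t01; have := nrmB3 c a p; have := nrmB3 c b a.
  rewrite [nrm (c - a)]nrm_distC.
  rewrite /perimeter in Hd; lra.
have F1 := is_segment_integral_bound E1 B1.
have F2 := is_segment_integral_bound E2 B2.
have F3 := is_segment_integral_bound E3 B3.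
set w1 := -1 * _ + v1 in F1; set w2 := -1 * _ + v2 in F2; set w3 := -1 * _ + v3 in F3.
(* The affine parts telescope around the triangle. *)
have -> : v1 + v2 + v3 = w1 + w2 + w3 by rewrite /w1 /w2 /w3; ring.
apply: le_trans (nrmD _ _) _; apply: le_trans (lerD (nrmD _ _) (lexx _)) _.
rewrite /perimeter; move: (nrm w1) (nrm w2) (nrm w3) F1 F2 F3 => x1 x2 x3 F1 F2 F3.
move: (e * d) F1 F2 F3 => u F1 F2 F3.
have -> : 2 * ((nrm (b - a) + nrm (c - b) + nrm (a - c)) * u) =
  2 * (nrm (b - a) * u) + 2 * (nrm (c - b) * u) + 2 * (nrm (a - c) * u) by ring.
exact: (lerD (lerD F1 F2) F3).
Qed.

Lemma goursat a b c v : D a -> D b -> D c -> is_triangle_integral psi a b c v ->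
  v = 0.
Proof.
move=> Da Db Dc H.
have /choice [F FP] : forall q : C * C * C * C, exists q' : C * C * C * C,
    good q -> [/\ good q', nrm q.2 <= 4 * nrm q'.2,
      perimeter q'.1.1.1 q'.1.1.2 q'.1.2 = perimeter q.1.1.1 q.1.1.2 q.1.2 / 2 &
      nrm (q'.1.1.1 - q.1.1.1) <= perimeter q.1.1.1 q.1.1.2 q.1.2 / 2].
  (* The choice function must be total: data that are not [good] are left unchanged. *)
  move=> [[[a' b'] c'] v']; have [G|G] := pselect (good (a', b', c', v')).
    have [a2 [b2 [c2 [v2 [? ? ? ?]]]]] := triangle_quarter G.
    by exists (a2, b2, c2, v2).
  by exists (a', b', c', v') => /G.
pose T n := iter n F (a, b, c, v); pose P := perimeter a b c.
have gT n : good (T n).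
  by elim: n => [|n /FP [] //]; split.
have pT n : perimeter (T n).1.1.1 (T n).1.1.2 (T n).1.2 = P / 2 ^+ n.
  elim: n => [|n IH]; first by rewrite expr0 divr1.
  have [_ _ -> _] := FP _ (gT n); rewrite -/(T n) IH exprS.
  by rewrite invfM mulrCA mulrC mulrA.
have vT n : nrm v <= 4 ^+ n * nrm (T n).2.
  elim: n => [|n IH]; first by rewrite expr0 mul1r.
  apply: le_trans IH _; rewrite exprSr -mulrA ler_wpM2l ?exprn_ge0 //.
  by have [] := FP _ (gT n).
have [n|p pP] := dyadic_limit_complex (u := fun n => (T n).1.1.1) (P := P).
  have [_ _ _] := FP _ (gT n).
  by rewrite pT exprS invfM [2^-1 * _]mulrC [P * (_ * _)]mulrA.
have Dp : D p.
  apply: closedD => e e0; have [n nP] := dyadic_small (2 * P) e0.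
  exists (T n).1.1.1; first by have := gT n; case: (T n) => [[[? ?] ?] ?] [].
  have := pP n; lra.
have P0 : 0 <= P by rewrite !addr_ge0 // nrm_ge0.
apply: eq0_normc; apply/eqP; rewrite eq_le nrm_ge0 andbT.
apply/ler_addgt0Pr => e e0; rewrite add0r.
(* The final estimate is [4 ^+ n * (2 * (P / 2 ^+ n) * (e / k) * (3 * P / 2 ^+ n))], that is
   [e * (6 * P * P / k)]; adding 1 keeps [k] positive when [P = 0]. *)
pose k := 6 * (P * P) + 1; have k0 : 0 < k by rewrite ltr_pwDr // !mulr_ge0.
have dp : is_derive (p : K) (1 : K) psi ('D_1 psi (p : K)) by apply: derivableP; exact: dpsi.
have /is_deriveP/(_ (e / k)%:C) := dp; rewrite ltcR divr_gt0 // => /(_ isT).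
move=> /nearPadd [r /realC_pos [-> r0] rP].
(* The first vertex is within [2 * P / 2 ^+ n] of [p] and the perimeter is [P / 2 ^+ n], which gives
   the factor 3. *)
have [n nP] := dyadic_small (3 * P) r0.
have := gT n; have := pP n; have := pT n; have := vT n.
case: (T n) => [[[a' b'] c'] v'] /= vle per ap [_ _ _ tri].
have := @goursat_local a' b' c' v' p (e / k) (3 * P / 2 ^+ n) tri.
rewrite per => G; apply: le_trans vle _.
have := G _ _ _; move=> {}G.
have {}G : nrm v' <= 2 * (P / 2 ^+ n * (e / k * (3 * P / 2 ^+ n))).
  apply: G; first by rewrite ltW // divr_gt0.
    move=> z zp; have := rP (z - p); rewrite add0r normE ltcR => /(_ (le_lt_trans zp nP)).
    rewrite /GRing.scale /= mulr1 [p + (z - p)]addrC subrK !normE -realCM lecR => G.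
    by apply: le_trans G _; rewrite ler_wpM2l // ltW // divr_gt0.
  by move: ap; lra.
apply: le_trans (ler_wpM2l _ G) _; first exact: exprn_ge0.
have -> : (4 : R) ^+ n = 2 ^+ n * 2 ^+ n by rewrite -exprMn; congr (_ ^+ _); ring.
have w0 : (2 : R) ^+ n != 0 by rewrite expf_neq0.
have -> : 2 ^+ n * 2 ^+ n * (2 * (P / 2 ^+ n * (e / k * (3 * P / 2 ^+ n)))) =
    e * (6 * (P * P) / k).
  by field; rewrite gt_eqF.
apply: ler_piMr; first exact: ltW.
by rewrite ler_pdivrMr // mul1r /k lerDl.
Qed.

End Goursat.

(** * Cauchy's estimate for the derivative at the centre *)

Section CauchyEstimate.
Context {R : realType}.
Local Notation C := (R[i]%C).
Local Notation K := (R[i]%C : numFieldType).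
Local Notation Re := (@complex.Re R).
Local Notation Im := (@complex.Im R).
Local Notation nrm := (@normc R).
Local Open Scope complex_scope.
Local Notation I := ('i%C : C).

Lemma is_derive_rescale (phi : K -> K) (c z d : K) :
  is_derive (c * z) (1 : K) phi d ->
  is_derive z (1 : K) (fun w => phi (c * w)) (c * d).
Proof.
move=> H.
have H' : is_derive (0 + z *: c : K) (1 : K) phi d.
  by rewrite /GRing.scale /= add0r mulrC.
have H2 : is_derive (0 + z *: c : K) (c : K) phi (c * d).
  by have := is_derive_scale_dir c H'; rewrite [c *: 1]mulr1.
have := is_derive_line H2.
by congr is_derive; apply/funext => s; rewrite /GRing.scale /= add0r mulrC.
Qed.

Lemma segment1i (t : R) : segment 1 I t = Complex (1 - t) t.
Proof.
by rewrite /segment; apply: eq_ReIm; rewrite ?reD ?imD ?Re_realM ?Im_realM /=; ring.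
Qed.

Lemma nrm_sqr (z : C) : nrm z ^+ 2 = Re z ^+ 2 + Im z ^+ 2.
Proof. by case: z => a b; rewrite /= sqr_sqrtr // addr_ge0 // sqr_ge0. Qed.

Lemma nrm_segment1i (t : R) : 2^-1 <= nrm (segment 1 I t) ^+ 2.
Proof. by rewrite segment1i nrm_sqr /=; have := sqr_ge0 (t - 2^-1); lra. Qed.

Lemma nrm_i : nrm I = 1.
Proof. by rewrite /= expr0n expr1n add0r sqrtr1. Qed.

Lemma nrm_i1 : nrm (I - 1) <= 2.
Proof.
apply: le_trans (nrmD _ _) _.
have -> : nrm (- 1) = nrm 1 by exact: normcN.
by rewrite nrm_i normc1.
Qed.

Lemma ii : I * I = -1.
Proof. by rewrite -expr2 sqr_i. Qed.

Lemma nrm_inv (z : C) : nrm z^-1 = (nrm z)^-1.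
Proof. exact: normcV. Qed.

Section Sector.
Variables (Phi : K -> K) (M : R).
Hypothesis Phi_rot : forall z : C, Phi (I * z) = I * Phi z.
Hypothesis dPhi : forall z : C, nrm z <= 1 ->
  derivable Phi (z : K) (1 : K) /\ nrm (Phi z) <= M.

(** A closed convex region which avoids 0 for [e > 0] and, when moreover [e <= 1], contains the four
    corners 1, [I], [e] and [I * e]. Goursat's theorem on triangles therefore applies without any
    contour around 0. *)
Let sector (e : R) : set C := [set z | nrm z <= 1 /\ e <= Re z + Im z].

(** The integrand of Cauchy's formula for the derivative of [Phi] at 0. *)
Let psi (z : K) : K := Phi z / z ^+ 2.

Let closed_sector e (p : C) :
  (forall e' : R, 0 < e' -> exists2 z, sector e z & nrm (z - p) < e') -> sector e p.
Proof.
move=> H; split; apply/ler_addgt0Pr => e' e'0.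
  have [z [z1 _] zp] := H e' e'0; have := nrmD (p - z) z; rewrite subrK.
  rewrite [nrm (p - z)]nrm_distC; lra.
have e20 : 0 < e' / 2 by rewrite divr_gt0.
have [z [_ z1] zp] := H _ e20.
have := Re_le_nrm (z - p); have := Im_le_nrm (z - p).
rewrite reD imD reN imN !ler_norml => /andP [? ?] /andP [? ?]; lra.
Qed.

Let convex_sector e (a b : C) (t : R) : sector e a -> sector e b -> 0 <= t <= 1 ->
  sector e (segment a b t).
Proof.
move=> [a1 a2] [b1 b2] /andP [t0 t1].
have E : segment a b t = (1 - t)%:C * a + t%:C * b.
  by rewrite /segment realCB; ring.
rewrite E; split.
  apply: le_trans (nrmD _ _) _; rewrite !normcM !nrm_real !ger0_norm ?subr_ge0 //.
  have := ler_wpM2l t0 b1; have : 0 <= 1 - t by rewrite subr_ge0.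
  by move=> t1'; have := ler_wpM2l t1' a1; lra.
rewrite !reD !imD !Re_realM !Im_realM.
have := ler_wpM2l t0 b2; have : 0 <= 1 - t by rewrite subr_ge0.
by move=> t1'; have := ler_wpM2l t1' a2; lra.
Qed.

Let sector_neq0 e (z : C) : 0 < e -> sector e z -> z != 0.
Proof. by move=> e0 [_ ez]; apply: contraTneq ez => ->; rewrite /= addr0 -ltNge. Qed.

Let dpsi e (z : C) : 0 < e -> sector e z -> derivable psi (z : K) (1 : K).
Proof.
move=> e0 ez; have z0 := sector_neq0 e0 ez.
have d1 : is_derive (z : K) (1 : K) (fun w : K => w) (1 : K) by exact: is_derive_id.
have d2 := is_derive_exp 2 d1.
have d3 : is_derive (z : K) (1 : K) Phi ('D_1 Phi (z : K)).
  by apply: derivableP; have [] := dPhi ez.1.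
have z20 : (z : K) ^+ 2 != 0 by rewrite expf_neq0.
by have [] := is_derive_quotient (g := fun w : K => w ^+ 2) z20 d3 d2.
Qed.

Let psi_rot (z : C) : psi (I * z) = - I * psi z.
Proof.
by rewrite /psi Phi_rot exprMn sqr_i mulN1r invrN mulrN mulNr mulrA.
Qed.

Let sector_points (e : R) : 0 < e -> e <= 1 ->
  [/\ sector e 1, sector e I, sector e e%:C & sector e (I * e%:C)].
Proof.
move=> e0 e1; split; split; rewrite ?normcM ?nrm_i ?normc1 ?nrm_real ?gtr0_norm //=;
  lra.
Qed.

Let sector_integral (e : R) : 0 < e -> e <= 1 -> exists v,
  is_segment_integral psi 1 I v /\ is_segment_integral psi e%:C (I * e%:C) v.
Proof.
move=> e0 e1; have [p1 p2 p3 p4] := sector_points e0 e1.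
have ex a b := @segment_integral_exists _ (sector e) psi (@convex_sector e)
  (fun z => @dpsi e z e0) a b.
have [v1 V1] := ex _ _ p1 p2; have [v2 V2] := ex _ _ p2 p4.
have [v3 V3] := ex _ _ p1 p4; have [v4 V4] := ex _ _ p4 p3.
have [v5 V5] := ex _ _ p1 p3.
have G a b c v := @goursat _ (sector e) psi (@closed_sector e) (@convex_sector e)
  (fun z => @dpsi e z e0) a b c v.
have T1 : v1 + v2 + - v3 = 0.
  apply: (G _ _ _ _ p1 p2 p4); exists v1, v2, (- v3); split => //.
  exact: is_segment_integral_rev.
have T2 : v3 + v4 + - v5 = 0.
  apply: (G _ _ _ _ p1 p4 p3); exists v3, v4, (- v5); split => //.
  exact: is_segment_integral_rev.
(* Rotation by [I] carries the side on the real axis to the one on the imaginary axis; it multiplies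
   the direction by [I] and [psi] by [- I], whose product is 1. *)
have v25 : v2 = v5.
  apply: is_cintegral_unique V2 _; apply: is_cintegral_ext V5 => t _.
  have -> : segment I (I * e%:C) t = I * segment 1 e%:C t by rewrite /segment; ring.
  rewrite psi_rot; move: (psi _) => w.
  have -> : I * e%:C - I = I * (e%:C - 1) by ring.
  by rewrite mulrAC !mulrA mulrN ii opprK mul1r mulrC.
exists v1; split => //.
have -> : v1 = - v4.
  apply/eqP; rewrite -addr_eq0; apply/eqP.
  have -> : v1 + v4 = (v1 + v2 + - v3) + (v3 + v4 + - v5) by rewrite v25; ring.
  by rewrite T1 T2 addr0.
exact: is_segment_integral_rev.
Qed.

Let M0 : 0 <= M.
Proof.
have [|_] := @dPhi 0; first by rewrite normc0.
by apply: le_trans; exact: nrm_ge0.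
Qed.

Let integral_bound v : is_segment_integral psi 1 I v -> nrm v <= 8 * M.
Proof.
(* On the segment the squared norm of [z] is at least 1/2, so [psi] is at most [2 * M]; the length
   is at most 2, and the bound on complex integrals costs another 2. This is the origin of the 8. *)
move=> H; apply: le_trans (is_segment_integral_bound (M := 2 * M) H _) _ => [t t01|].
  have [p1 p2 _ _] := sector_points ltr01 (lexx 1).
  have [z1 _] := convex_sector p1 p2 t01.
  have [_ PM] := dPhi z1; have := nrm_segment1i t.
  rewrite /psi normcM nrm_inv nrmX; move: (nrm (segment _ _ _) ^+ 2) => x x2.
  have x0 : 0 < x by lra.
  rewrite ler_pdivrMr //; apply: le_trans PM _.
  by have := ler_wpM2l M0 x2; lra.
by have := ler_wpM2r M0 nrm_i1; lra.
Qed.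

(** The value is i times pi / 2, but a lower bound is enough: the imaginary part of the integrand is
    [((1 - t) ^+ 2 + t ^+ 2)^-1], which is at least 1. *)
Let winding : exists2 c : C, is_segment_integral (fun z => z^-1) 1 I c & 1 <= nrm c.
Proof.
have [p1 p2 _ _] := sector_points ltr01 (lexx 1).
have [t t01|c cI] := @is_segment_integral_exists R (fun z : K => z^-1) 1 I.
  have ez := convex_sector p1 p2 t01; have z0 := sector_neq0 ltr01 ez.
  apply: (@derivableV K K (fun w : K => w)) => //; exact: derivable_id.
exists c => //; apply: le_trans (Im_le_nrm c); apply: le_trans (ler_norm _).
apply: is_integral_lower cI.2 _ => t /andP [t0 t1].
rewrite segment1i imM /=.
have N0 : 0 < (1 - t) ^+ 2 + t ^+ 2 by have := sqr_ge0 (t - 2^-1); lra.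
have -> : (0 - 1) * - (t / ((1 - t) ^+ 2 + t ^+ 2)) +
  (1 - 0) * ((1 - t) / ((1 - t) ^+ 2 + t ^+ 2)) = ((1 - t) ^+ 2 + t ^+ 2)^-1.
  by field; rewrite gt_eqF.
rewrite -[leLHS]invr1 lef_pV2 ?posrE //.
have := mulr_ge0 t0 (_ : 0 <= 1 - t); rewrite subr_ge0 => /(_ t1); lra.
Qed.

(* By Goursat's theorem on two triangles avoiding 0, and because the sides along
   the two axes cancel by rotation symmetry, the integral of Phi z / z^2 from x to
   i x does not depend on 0 < x <= 1.  For x = 1 it is at most 8 M, and as x -> 0
   it approaches Phi'(0) c, where c is the integral of 1 / z from 1 to i. *)
Lemma cauchy_estimate_sector : nrm ('D_1 Phi (0 : K)) <= 8 * M.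
Proof.
set d := 'D_1 Phi (0 : K).
have Phi0 : Phi 0 = 0.
  have := Phi_rot 0; rewrite mulr0 => /eqP; rewrite -subr_eq0 -[X in X - _]mul1r -mulrBl.
  by rewrite mulf_eq0 eq_complex /= subr0 oner_eq0 /= => /eqP.
have [c cI c1] := winding.
apply/ler_addgt0Pr => e e0.
have e80 : 0 < e / 8 by rewrite divr_gt0.
have n0 : nrm 0 <= 1 by rewrite normc0.
have dP : is_derive (0 : K) (1 : K) Phi d by apply: derivableP; have [] := dPhi n0.
move/is_deriveP : dP => /(_ (e / 8)%:C); rewrite ltcR => /(_ e80).
move=> /nearPadd [r /realC_pos [-> r0] rP].
pose x := Num.min 1 (Re r / 2).
have x0 : 0 < x by rewrite /x lt_min ltr01 divr_gt0.
have x1 : x <= 1 by rewrite /x ge_min lexx.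
have xr : x < Re r by rewrite /x gt_min; apply/orP; right; lra.
have [v [V1 V2]] := sector_integral x0 x1.
have B1 := integral_bound V1.
have D := is_cintegral_linear (- d) cI V2.
(* With [u] on the segment from 1 to [I], the integrand is at most [2 * (e / 8) / nrm u]. As [nrm u]
   is at least 1/2 this is at most [e / 2], and the bound on complex integrals doubles it. *)
have B2 : nrm (- d * c + v) <= 2 * (e / 2).
  apply: is_cintegral_bound D _ => t t01.
  have xC0 : x%:C != 0 :> C by rewrite eq_complex /= eqxx andbT gt_eqF.
  have -> : segment x%:C (I * x%:C) t = x%:C * segment 1 I t by rewrite /segment; ring.
  have [p1 p2 _ _] := sector_points ltr01 (lexx 1).
  have uS := convex_sector p1 p2 t01; have u0 := sector_neq0 ltr01 uS.
  have un := nrm_segment1i t; have u1 := uS.1.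
  set u := segment 1 I t in u0 un u1 *.
  have := rP (x%:C * u).
  have xu : nrm (x%:C * u) <= x by rewrite normcM nrm_real gtr0_norm // ler_piMr // ltW.
  rewrite add0r normE ltcR => /(_ (le_lt_trans xu xr)).
  rewrite add0r /GRing.scale /= mulr1 Phi0 subr0 !normE -realCM lecR => P.
  rewrite /psi.
  have -> : - d * ((I - 1) * u^-1) + (I * x%:C - x%:C) * (Phi (x%:C * u) / (x%:C * u) ^+ 2)
    = (I - 1) * (Phi (x%:C * u) - x%:C * u * d) * (x%:C * u ^+ 2)^-1.
    by field; rewrite u0 xC0.
  rewrite !normcM nrm_inv normcM nrm_real gtr0_norm // nrmX.
  rewrite normcM nrm_real gtr0_norm // in P.
  have nu : 0 < nrm u by rewrite lt_def nrm_eq0 u0 nrm_ge0.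
  rewrite ler_pdivrMr ?mulr_gt0 ?exprn_gt0 //.
  apply: le_trans (ler_pM (nrm_ge0 _) (nrm_ge0 _) nrm_i1 P) _.
  have -> : e / 2 * (x * nrm u ^+ 2) = 2 * (e / 8 * (x * nrm u)) * (2 * nrm u) by field.
  apply: ler_peMr.
    by rewrite mulr_ge0 // mulr_ge0 ?(ltW e80) // mulr_ge0 ?nrm_ge0 // ltW.
  have : nrm u ^+ 2 <= nrm u by rewrite expr2 ler_piMl // nrm_ge0.
  lra.
have B3 : nrm (d * c) <= 8 * M + e.
  have -> : d * c = - (- d * c + v) + v by ring.
  apply: le_trans (nrmD _ _) _.
  have -> : nrm (- (- d * c + v)) = nrm (- d * c + v) by exact: normcN.
  lra.
by apply: le_trans B3; rewrite normcM ler_peMr // nrm_ge0.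
Qed.

End Sector.

(* Averaging phi over the rotations by powers of i keeps its derivative at 0 and
   makes it equivariant, as [cauchy_estimate_sector] requires. *)
Lemma cauchy_estimate (phi : K -> K) (r M : R) : 0 < r ->
  (forall z : C, nrm z <= r -> derivable phi (z : K) (1 : K) /\ nrm (phi z) <= M) ->
  nrm ('D_1 phi (0 : K)) <= 8 * M / r.
Proof.
move=> r0 H.
pose f (z : K) : K := phi (r%:C * z).
have Hf z : nrm z <= 1 -> is_derive (z : K) (1 : K) f (r%:C * 'D_1 phi (r%:C * z : K)) /\
    nrm (f z) <= M.
  move=> z1; have [|d1 d2] := H (r%:C * z).
    by rewrite normcM nrm_real gtr0_norm // ler_piMr // ltW.
  split; last exact: d2.
  by apply: is_derive_rescale; exact: derivableP.
(* The weights are the powers of [- I] divided by 4; in terms of power series, only the exponents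
   congruent to 1 modulo 4 survive. *)
pose F (z : K) : K := (4^-1 : C) * (f z + (- I) * f (I * z) + (-1) * f (-1 * z)
  + I * f ((- I) * z)).
pose df (z : K) : K := r%:C * 'D_1 phi (r%:C * z : K).
pose dF (z : K) : K := (4^-1 : C) * (df z + (- I) * (I * df (I * z)) + (-1) * (-1 * df (-1 * z))
  + I * ((- I) * df ((- I) * z))).
have nN (z : C) : nrm (- z) = nrm z by exact: normcN.
have HF z : nrm z <= 1 -> is_derive (z : K) (1 : K) F (dF z) /\ nrm (F z) <= M.
  move=> z1.
  have z2 : nrm (I * z) <= 1 by rewrite normcM nrm_i mul1r.
  have z3 : nrm (-1 * z) <= 1 by rewrite mulN1r nN.
  have z4 : nrm ((- I) * z) <= 1 by rewrite mulNr nN.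
  have [d1 b1] := Hf _ z1; have [d2 b2] := Hf _ z2.
  have [d3 b3] := Hf _ z3; have [d4 b4] := Hf _ z4.
  split.
    have e2 := is_derive_rescale d2; have e3 := is_derive_rescale d3.
    have e4 := is_derive_rescale d4.
    exact: (is_deriveZ (4^-1 : K) (is_deriveD (is_deriveD (is_deriveD d1
      (is_deriveZ (- I : K) e2)) (is_deriveZ (-1 : K) e3)) (is_deriveZ (I : K) e4))).
  rewrite /F normcM nrm_inv.
  have -> : nrm 4 = 4 by rewrite -(rmorph_nat (real_complex R) 4) nrm_real ger0_norm.
  rewrite mulrC ler_pdivrMr //.
  apply: le_trans (nrmD _ _) _; apply: le_trans (lerD (nrmD _ _) (lexx _)) _.
  apply: le_trans (lerD (lerD (nrmD _ _) (lexx _)) (lexx _)) _.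
  rewrite !normcM !nN nrm_i normc1 !mul1r; lra.
have rot z : F (I * z) = I * F z.
  rewrite /F.
  have -> : I * (I * z) = -1 * z by rewrite mulrA ii.
  have -> : -1 * (I * z) = (- I) * z by ring.
  have -> : (- I) * (I * z) = z by rewrite mulrA mulNr ii opprK mul1r.
  move: (f z) (f (I * z)) (f (-1 * z)) (f (- I * z)) => a b c d.
  have E : I * (4^-1 * (a + - I * b + -1 * c + I * d)) =
    4^-1 * (I * a + - (I * I) * b + - I * c + (I * I) * d) by ring.
  by rewrite [RHS]E ii; ring.
have := @cauchy_estimate_sector F M rot.
have -> : 'D_1 F (0 : K) = r%:C * 'D_1 phi (0 : K).
  have [|[_ ->] _] := HF 0; first by rewrite normc0.
  rewrite /dF /df !mulr0; move: ('D_1 phi _) => w.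
  have -> : 4^-1 * (r%:C * w + - I * (I * (r%:C * w)) + -1 * (-1 * (r%:C * w)) + I * (- I * (r%:C * w)))
    = 4^-1 * ((1 + 1) * (r%:C * w) - (I * I + I * I) * (r%:C * w)) by ring.
  by rewrite ii; field.
rewrite normcM nrm_real gtr0_norm // ler_pdivlMr // mulrC; apply.
by move=> z /HF [[? _] ?].
Qed.

End CauchyEstimate.

(** * Separately holomorphic functions are smooth *)

Definition cauchy_inequality (K : numFieldType) : Prop :=
  forall (phi : K -> K) (r M : K), 0 < r ->
    (forall z : K, `|z| <= r -> derivable phi z (1 : K) /\ `|phi z| <= M) ->
    `|'D_1 phi (0 : K)| <= 8 * M / r.

(* The only use of the completeness of K: A is a difference quotient. *)
Definition lipschitz_limit (K : numFieldType) : Prop :=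
  forall (A : K -> K) (c d : K), 0 <= c -> 0 < d ->
    (forall s t : K, s != 0 -> t != 0 -> `|s| < d -> `|t| < d ->
       `|A s - A t| <= c * (`|s| + `|t|)) ->
    exists l : K, forall s : K, s != 0 -> `|s| < d -> `|A s - l| <= c * `|s|.

Section SeparatelyHolomorphic.
Context {K : numFieldType} {n : nat}.
Hypothesis Kmvi : mean_value_inequality K.
Hypothesis Kcauchy : cauchy_inequality K.
Hypothesis Klim : lipschitz_limit K.
Local Notation ee := basis_vec.
Implicit Types (g h : 'rV[K]_n -> K) (x : 'rV[K]_n).

Lemma cauchy_partial h x (i : 'I_n) (r M : K) : 0 < r ->
  (forall z : K, `|z| <= r ->
     derivable h (x + z *: ee i) (ee i) /\ `|h (x + z *: ee i)| <= M) ->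
  `|'D_(ee i) h x| <= 8 * M / r.
Proof.
move=> r0 H; pose phi z := h (x + z *: ee i).
have [d1 d2] : is_derive (0 : K) (1 : K) phi ('D_(ee i) h x).
  apply: is_derive_line; rewrite scale0r addr0; apply: derivableP.
  have [|dx _] := H 0; first by rewrite normr0 ltW.
  by move: dx; rewrite scale0r addr0.
rewrite -d2; apply: Kcauchy => [//|z /H [dz bz]]; split; last exact: bz.
by have [] := is_derive_line (derivableP dz).
Qed.

Section Local.
Variables (g : 'rV[K]_n -> K) (x0 : 'rV[K]_n) (r M : K).
Hypothesis r0 : 0 < r.
Hypothesis dg : forall x, `|x - x0| < 4 * r ->
  (forall i : 'I_n, derivable g x (ee i)) /\ `|g x| <= M.

Let shift_norm x (z a b : K) (i : 'I_n) : `|x - x0| < a -> `|z| <= b ->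
  `|x + z *: ee i - x0| < a + b.
Proof.
move=> xa zb; rewrite addrAC; apply: le_lt_trans (ler_normD _ _) _.
by rewrite norm_basis_vec ltr_leD.
Qed.

(** [M1] bounds the partial derivatives on radius [3 * r]. [L] is their Lipschitz constant along
    coordinate directions on radius [r]. Each Cauchy or mean value estimate gives up a margin [r],
    hence the initial radius [4 * r]. *)
Let M1 := 8 * M / r.
Let L := 8 * (2 * M1) / r.

Let M0 : 0 <= M.
Proof.
have [|_] := @dg x0; first by rewrite subrr normr0 mulr_gt0.
by apply: le_trans.
Qed.

Let M10 : 0 <= M1.
Proof. by rewrite divr_ge0 ?mulr_ge0 // ltW. Qed.

Let L0 : 0 <= L.
Proof. by rewrite divr_ge0 ?(ltW r0) // mulr_ge0 // mulr_ge0. Qed.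

Let E43 : 4 * r = 3 * r + r. Proof. by ring. Qed.
Let E32 : 3 * r = 2 * r + r. Proof. by ring. Qed.
Let E21 : 2 * r = r + r. Proof. by ring. Qed.

Let lt34 x : `|x - x0| < 3 * r -> `|x - x0| < 4 * r.
Proof. by move=> H; rewrite E43 ltr_wpDr // ltW. Qed.
Let lt23 x : `|x - x0| < 2 * r -> `|x - x0| < 3 * r.
Proof. by move=> H; rewrite E32 ltr_wpDr // ltW. Qed.
Let lt12 x : `|x - x0| < r -> `|x - x0| < 2 * r.
Proof. by move=> H; rewrite E21 ltr_wpDr // ltW. Qed.

Let partial_bound i x : `|x - x0| < 3 * r -> `|'D_(ee i) g x| <= M1.
Proof.
move=> xr; apply: cauchy_partial => // z zr.
have [|d1 d2] := @dg (x + z *: ee i); first by rewrite E43 shift_norm.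
by split; [exact: d1|exact: d2].
Qed.

Let norm_ts (t s : K) : 0 <= t <= 1 -> `|t * s| <= `|s|.
Proof. by move=> /andP [t0 t1]; rewrite normrM ger0_norm // ler_piMl. Qed.

Let coord_lipschitz j x (s : K) : `|x - x0| < 2 * r -> `|s| <= r ->
  `|g (x + s *: ee j) - g x| <= 2 * M1 * `|s|.
Proof.
move=> xr sr; have := @mean_value_dir K _ Kmvi g x (ee j) s 0 M1.
rewrite mulr0 subr0; apply=> t t01.
have B : `|x + (t * s) *: ee j - x0| < 3 * r.
  by rewrite E32 shift_norm //; apply: le_trans sr; exact: norm_ts.
by rewrite subr0; split; [exact: (dg (lt34 B)).1|exact: partial_bound].
Qed.

Let is_derive_g i x : `|x - x0| < 4 * r -> is_derive x (ee i) g ('D_(ee i) g x).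
Proof. by move=> /dg [d _]; exact: derivableP. Qed.

(** Cauchy's inequality is applied to the increment [h] of [g] in direction [j], which is small by
    [coord_lipschitz]; so no second derivative has to exist beforehand. *)
Let partial_lipschitz i j x (s : K) : `|x - x0| < r -> `|s| <= r ->
  `|'D_(ee i) g (x + s *: ee j) - 'D_(ee i) g x| <= L * `|s|.
Proof.
move=> xr sr; pose h y := g (y + s *: ee j) - g y.
have dh y : `|y - x0| < 2 * r ->
    is_derive y (ee i) h ('D_(ee i) g (y + s *: ee j) - 'D_(ee i) g y).
  move=> yr; apply: is_deriveB; last exact/is_derive_g/lt34/lt23.
  by apply: is_derive_translate; apply/is_derive_g/lt34; rewrite E32 shift_norm.
have [_ <-] := dh x (lt12 xr).
have -> : L * `|s| = 8 * (2 * M1 * `|s|) / r by rewrite /L mulrAC !mulrA.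
apply: cauchy_partial => // z zr.
have B : `|x + z *: ee i - x0| < 2 * r by rewrite E21 shift_norm.
by split; [have [] := dh _ B|exact: coord_lipschitz].
Qed.

Let norm_x0 (h : 'rV[K]_n) : `|x0 + h - x0| = `|h|.
Proof. by rewrite addrC addKr. Qed.

Lemma partial_continuous i : {for x0, continuous ('D_(ee i) g)}.
Proof.
suff : 'D_(ee i) g y @[y --> x0] --> 'D_(ee i) g x0 by [].
apply: (@cvgrPdist_le _ _ _ (nbhs x0) (nbhs_filter x0) _ _).2 => e e0.
have c0 : 0 < L * n%:R + 1 by apply: ltr_wpDl => //; rewrite mulr_ge0.
near=> y.
have yr : `|y - x0| < r.
  near: y; apply: (@nearPadd _ _ x0 _).2; exists r => // h; by rewrite norm_x0.
have ye : `|y - x0| <= e / (L * n%:R + 1).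
  near: y; apply: (@nearPadd _ _ x0 _).2; exists (e / (L * n%:R + 1)).
    by rewrite divr_gt0.
  by move=> h; rewrite norm_x0 => /ltW.
have [h yE] : exists h : 'rV[K]_n, y = x0 + h by exists (y - x0); rewrite addrC subrK.
rewrite yE norm_x0 in yr; rewrite yE norm_x0 in ye.
move: yr ye => hr he; rewrite yE distrC.
rewrite (telescope_truncate ('D_(ee i) g)); apply: le_trans (ler_norm_sum _ _ _) _.
apply: (@le_trans _ _ (\sum_(k < n) L * `|h|)); last first.
  rewrite sumr_const card_ord -[leLHS]mulr_natr mulrAC.
  move: he; rewrite ler_pdivlMr // => he; apply: le_trans he.
  by rewrite mulrC ler_wpM2l // lerDl.
apply: ler_sum => k _; rewrite truncate_vecS addrA.
have hk : `|h 0 k| <= `|h| by exact: norm_coord_le.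
apply: le_trans (partial_lipschitz _ _ _ _) _.
- rewrite norm_x0; apply: le_lt_trans hr; apply: norm_le_coord => // j.
  by rewrite mxE; case: ifP => _; [exact: norm_coord_le|rewrite normr0].
- by apply: le_trans hk _; exact: ltW.
- exact: ler_wpM2l.
Unshelve. all: by end_near. Qed.

Let difference_quotient j x (s : K) : `|x - x0| < r -> s != 0 -> `|s| <= r ->
  `|(g (x + s *: ee j) - g x) / s - 'D_(ee j) g x| <= 2 * L * `|s|.
Proof.
move=> xr s0 sr; have := @mean_value_dir K _ Kmvi g x (ee j) s ('D_(ee j) g x) (L * `|s|).
have -> : (g (x + s *: ee j) - g x) / s - 'D_(ee j) g x =
    (g (x + s *: ee j) - g x - s * 'D_(ee j) g x) / s.
  by rewrite [RHS]mulrBl [s * _]mulrC mulfK.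
rewrite normrM normfV ler_pdivrMr ?normr_gt0 // [2 * (L * _)]mulrA; apply=> t t01.
have ts := norm_ts s t01; have tsr := le_trans ts sr.
split; first by apply: (dg _).1; apply/lt34/lt23; rewrite E21 shift_norm.
by apply: le_trans (partial_lipschitz _ _ xr tsr) _; rewrite ler_wpM2l.
Qed.

(** [A s] is the [i]-th derivative at [x0] of the difference quotient [Q s] of [g] in direction [j].
    All [Q s] are uniformly close to ['D_(ee j) g], so Cauchy's inequality for [Q s - Q t] shows
    that [A] has a limit at 0. *)
Lemma partial_derivable i j : derivable ('D_(ee i) g) x0 (ee j).
Proof.
pose A s := ('D_(ee i) g (x0 + s *: ee j) - 'D_(ee i) g x0) / s.
pose Q s y := (g (y + s *: ee j) - g y) / s.
have dQ (s : K) y : `|s| <= r -> `|y - x0| < 2 * r ->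
    is_derive y (ee i) (Q s) (('D_(ee i) g (y + s *: ee j) - 'D_(ee i) g y) / s).
  move=> sr yr; apply: is_derive_mulr; apply: is_deriveB; last exact/is_derive_g/lt34/lt23.
  by apply: is_derive_translate; apply/is_derive_g/lt34; rewrite E32 shift_norm.
(* Cauchy's inequality uses a closed disc, and the estimates hold on an open ball of radius [r]. *)
have r20 : 0 < r / 2 by rewrite divr_gt0.
pose c := 8 * (2 * L) / (r / 2).
have c0 : 0 <= c by rewrite divr_ge0 ?(ltW r20) // mulr_ge0 // mulr_ge0.
have AL s t : s != 0 -> t != 0 -> `|s| < r -> `|t| < r ->
    `|A s - A t| <= c * (`|s| + `|t|).
  move=> s0 t0 /ltW sr /ltW tr.
  have x02 : `|x0 - x0| < 2 * r by rewrite subrr normr0 mulr_gt0.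
  have [_ <-] := is_deriveB (dQ s x0 sr x02) (dQ t x0 tr x02).
  have -> : c * (`|s| + `|t|) = 8 * (2 * L * (`|s| + `|t|)) / (r / 2).
    by rewrite /c mulrAC !mulrA.
  apply: cauchy_partial => // z zr.
  have B : `|x0 + z *: ee i - x0| < r.
    rewrite norm_x0 norm_basis_vec; apply: le_lt_trans zr _.
    by rewrite ltr_pdivrMr // ltr_pMr // ltr1n.
  split; first by have [] := is_deriveB (dQ s _ sr (lt12 B)) (dQ t _ tr (lt12 B)).
  set y := x0 + z *: ee i in B *.
  have Hs : `|Q s y - 'D_(ee j) g y| <= 2 * L * `|s| by exact: difference_quotient.
  have Ht : `|Q t y - 'D_(ee j) g y| <= 2 * L * `|t| by exact: difference_quotient.
  rewrite [X in `|X|](_ : _ = Q s y - Q t y) //.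
  move: ('D_(ee j) g y) (Q s y) (Q t y) Hs Ht => w u v Hu Hv.
  have -> : u - v = (u - w) - (v - w) by rewrite opprB addrA subrK.
  by apply: le_trans (ler_normB _ _) _; rewrite mulrDr lerD.
have [l lP] := Klim c0 r0 AL.
have [] // : is_derive x0 (ee j) ('D_(ee i) g) l.
apply/is_deriveP => e e0; apply/nearPadd.
have c10 : 0 < c + 1 by rewrite ltr_wpDl.
have ec0 : 0 < e / (c + 1) by rewrite divr_gt0.
(* The order of [K] is only partial, but positive elements are comparable, so a minimum exists. *)
have [m m0 [mr me]] : exists2 m : K, 0 < m & m <= r /\ m <= e / (c + 1).
  case: (real_leP (gtr0_real r0) (gtr0_real ec0)) => H; first by exists r.
  by exists (e / (c + 1)) => //; split => //; exact: ltW.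
exists m => // s sm.
have sr := lt_le_trans sm mr; have se := lt_le_trans sm me.
rewrite add0r; have [->|s0] := eqVneq s 0.
  by rewrite scale0r addr0 mul0r !subrr normr0 mulr0.
have := lP s s0 sr; rewrite /A.
have -> : 'D_(ee i) g (x0 + s *: ee j) - 'D_(ee i) g x0 - s * l =
  (('D_(ee i) g (x0 + s *: ee j) - 'D_(ee i) g x0) / s - l) * s.
  by rewrite mulrBl divfK // [l * s]mulrC.
rewrite normrM => H; rewrite ler_wpM2r //; apply: le_trans H _.
move: se; rewrite ltr_pdivlMr // => /ltW; apply: le_trans.
by rewrite mulrC ler_wpM2l // lerDl.
Qed.

End Local.

(** This is Osgood's lemma: the class of continuous, separately differentiable functions is itself
    stable under partial derivatives. Continuity provides the local bound that Cauchy's inequality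
    takes as input. *)
Lemma separately_differentiable_C_infty (U : set 'rV[K]_n) g : open U ->
  (forall x, U x -> {for x, continuous g} /\ forall i : 'I_n, derivable g x (ee i)) ->
  C_infty_on U g.
Proof.
move=> oU H; apply: (C_infty_on_coind (P := [set g | forall x, U x ->
  {for x, continuous g} /\ forall i : 'I_n, derivable g x (ee i)])) => //.
move=> {H} g i H; exists ('D_(ee i) g); last by []; move=> x Ux.
have [cg dg] := H x Ux.
have /nearPadd [s s0 sP] : \forall y \near x, U y /\ `|g y| <= `|g x| + 1.
  apply: filterI; first exact: open_nbhs_nbhs.
  have /cvgrPdist_le/(_ _ ltr01) := cg; apply: filterS => y gy.
  rewrite -lerBlDl; apply: le_trans gy; rewrite distrC; exact: lerB_dist.
have s40 : 0 < s / 4 by rewrite divr_gt0.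
have B y : `|y - x| < 4 * (s / 4) ->
    (forall i : 'I_n, derivable g y (ee i)) /\ `|g y| <= `|g x| + 1.
  rewrite mulrC divfK ?pnatr_eq0 // => /sP; rewrite addrC subrK => -[Uy gy].
  by split; [exact: (H y Uy).2|exact: gy].
split; first exact: (partial_continuous s40 B).
by move=> j; exact: (partial_derivable s40 B).
Qed.

End SeparatelyHolomorphic.

(** * The complex numbers satisfy the last two hypotheses *)

Section ComplexScalars.
Context {R : realType}.
Local Notation C := (R[i]%C).
Local Notation K := (R[i]%C : numFieldType).
Local Notation nrm := (@normc R).
Local Open Scope complex_scope.

Lemma realC_posP (e : K) : 0 < e -> exists2 x : R, 0 < x & e = x%:C.
Proof. by move=> /realC_pos [eE e0]; exists (complex.Re e). Qed.

Lemma realC_nnegP (e : K) : 0 <= e -> exists2 x : R, 0 <= x & e = x%:C.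
Proof. by move=> /realC_nneg [eE e0]; exists (complex.Re e). Qed.

Lemma complex_cauchy_inequality : cauchy_inequality K.
Proof.
move=> phi _ M /realC_posP [r r0 ->] H.
have M0 : 0 <= M.
  have [|_] := H 0; first by rewrite normr0 ler0c ltW.
  by apply: le_trans.
have [m _ ME] := realC_nnegP M0; rewrite {}ME in H *.
have -> : 8 * m%:C / r%:C = (8 * m / r)%:C :> C.
  by rewrite !realCM fmorphV rmorph_nat.
rewrite le_normE; apply: cauchy_estimate => // z zr.
by have := H z; rewrite le_normE => /(_ zr) [dz]; rewrite le_normE.
Qed.

(** The limit is taken along the points [d / 2 ^+ n.+1], which are nonzero and within the admissible
    radius; any other [s] is then compared with them. *)
Lemma complex_lipschitz_limit : lipschitz_limit K.
Proof.
move=> A _ _ /realC_nnegP [c c0 ->] /realC_posP [d d0 ->] H.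
have H' (s t : C) : s != 0 -> t != 0 -> nrm s < d -> nrm t < d ->
    nrm (A s - A t) <= c * (nrm s + nrm t).
  move=> s0 t0 sd td; rewrite -lecR realCM realCD; apply: H => //; by rewrite normE ltcR.
pose p n : C := (d / 2 ^+ n.+1)%:C.
have pn n : nrm (p n) = d / 2 ^+ n.+1 by rewrite nrm_real ger0_norm // divr_ge0 ?exprn_ge0 // ltW.
have p0 n : p n != 0.
  by rewrite -nrm_eq0 pn mulf_neq0 ?gt_eqF // invr_gt0 exprn_gt0.
have pd n : nrm (p n) < d.
  by rewrite pn ltr_pdivrMr ?exprn_gt0 // ltr_pMr // exprn_egt1 // ltr1n.
have [n|l lP] := @dyadic_limit_complex R (fun n => A (p n)) (2 * c * d).
  apply: le_trans (H' _ _ (p0 n.+1) (p0 n) (pd n.+1) (pd n)) _; rewrite !pn.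
  have -> : 2 * c * d / 2 ^+ n.+1 = c * (d / 2 ^+ n.+1 + d / 2 ^+ n.+1).
    by move: (_^-1) => w; ring.
  rewrite ler_wpM2l // lerD2r ler_pM2l // lef_pV2 ?posrE ?exprn_gt0 //.
  by rewrite ler_weXn2l // ler1n.
exists l => s s0; rewrite normE ltcR => sd.
rewrite -realCM le_normE; apply/ler_addgt0Pr => e e0.
(* The comparison of [s] with [p n] costs at most [2 * c * d / 2 ^+ n] beyond [c * nrm s], and that
   of [A (p n)] with [l] costs [4 * c * d / 2 ^+ n]. *)
have [n nP] := dyadic_small (6 * c * d) e0.
have A1 := H' _ _ s0 (p0 n) sd (pd n).
have A2 := lP n; have A3 := nrmB3 (A s) (A (p n)) l.
have E : d / 2 ^+ n.+1 <= 2 * (d / 2 ^+ n).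
  rewrite exprS invfM mulrCA; have : 0 <= d / 2 ^+ n by rewrite divr_ge0 ?exprn_ge0 // ltW.
  lra.
have E2 := ler_wpM2l c0 E.
by rewrite pn mulrDr in A1; lra.
Qed.

End ComplexScalars.

Section Scalars.
Context {R : realType} {b : base_field}.
Local Notation K := (scalars R b).

Lemma scalars_mean_value_inequality : mean_value_inequality K.
Proof.
case: b; [exact: real_mean_value_inequality|exact: complex_mean_value_inequality].
Qed.

(** Over R the two notions coincide by definition. Over C one direction is Osgood's lemma and the
    other is differentiability from continuous partial derivatives; from here on both fields are
    treated alike. *)
Lemma smooth_onE n (U : set 'rV[K]_n) (g : 'rV[K]_n -> K) : open U ->
  smooth_on U g <-> C_infty_on U g.
Proof.
case: b U g => [//|U g oU]; split=> [hg|Cg x Ux].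
  apply: separately_differentiable_C_infty => //.
  - exact: complex_mean_value_inequality.
  - exact: complex_cauchy_inequality.
  - exact: complex_lipschitz_limit.
  - move=> x /hg dg; split; first exact: differentiable_continuous.
    by move=> i; exact: diff_derivable.
have [] // := C_infty_on_differentiable complex_mean_value_inequality oU Cg Ux.
Qed.

End Scalars.

(** * Germs *)

Section FiniteCodimension.
Context {K : fieldType} {X : lmodType K} {T : eqType}.

(** One functional is treated at a time: [V] is replaced by its kernel, and one vector is added when
    the functional is nonzero on [V]. Linearity is assumed on [V] only, since iterated partial
    derivatives are linear on smooth germs and not on arbitrary functions. *)
Lemma finite_codimension (J : T -> X -> K) (L : seq T) (V : set X) :
  (forall (c : K) u v, V u -> V v -> V (c *: u + v)) ->
  (forall t c u v, V u -> V v -> J t (c *: u + v) = c * J t u + J t v) ->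
  exists (N : nat) (e : 'I_N -> X), (forall k, V (e k)) /\
    forall u, V u -> exists c : 'I_N -> K,
      V (u - \sum_k c k *: e k) /\
      forall t, t \in L -> J t (u - \sum_k c k *: e k) = 0.
Proof.
elim: L V => [|t L IH] V VL JL.
  exists 0%N, (fun=> 0); split=> [[]//|u Vu]; exists (fun=> 0).
  by rewrite big_ord0 subr0.
pose V' := [set u | V u /\ J t u = 0].
have [||N [e [Ve eP]]] := IH V'.
- move=> c u v [Vu Ju] [Vv Jv]; split; first exact: VL.
  by rewrite JL // Ju Jv mulr0 addr0.
- by move=> t' c u v [Vu _] [Vv _]; exact: JL.
have [[w [Vw Jw]]|nw] := pselect (exists w, V w /\ J t w != 0); last first.
  exists N, e; split=> [k|u Vu]; first by have [] := Ve k.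
  have V'u : V' u.
    by split => //; apply/eqP/negPn/negP => Ju; apply: nw; exists u.
  have [c [[Vc Jc] cP]] := eP u V'u; exists c; split => // t'.
  by rewrite inE => /orP [/eqP ->//|]; exact: cP.
exists N.+1, (fun k => oapp e w (unlift ord0 k)); split=> [k|u Vu].
  by case: unliftP => [j _|_] //=; have [] := Ve j.
pose d := J t u / J t w.
have V'u : V' (u - d *: w).
  have -> : u - d *: w = (- d) *: w + u by rewrite scaleNr addrC.
  split; first exact: VL.
  by rewrite JL // mulNr divfK // addNr.
have [c [[Vc Jc] cP]] := eP _ V'u.
exists (fun k => oapp c d (unlift ord0 k)).
have -> : u - \sum_k oapp c d (unlift ord0 k) *: oapp e w (unlift ord0 k) =
    u - d *: w - \sum_k c k *: e k.
  rewrite big_ord_recl unlift_none /= opprD addrA; congr (_ - _).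
  by apply: eq_bigr => k _; rewrite liftK.
by split => // t'; rewrite inE => /orP [/eqP ->//|]; exact: cP.
Qed.

End FiniteCodimension.

(** * Smooth germs at a single point *)

Section SmoothGerms.
Context {K : numFieldType} (Kmvi : mean_value_inequality K).
Local Notation ee := basis_vec.

Definition smooth_germ n (a : 'rV[K]_n) (g : 'rV[K]_n -> K) : Prop :=
  exists U, [/\ open U, U a & C_infty_on U g].

Section Closure.
Context {n : nat}.
Implicit Types (a x : 'rV[K]_n) (g h : 'rV[K]_n -> K).

Lemma smooth_germ2 a g h : smooth_germ a g -> smooth_germ a h ->
  exists U, [/\ open U, U a, C_infty_on U g & C_infty_on U h].
Proof.
move=> [U [oU Ua Cg]] [V [oV Va Ch]]; exists (U `&` V); split => //.
- exact: openI.
- by apply: C_infty_on_sub Cg => x [].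
- by apply: C_infty_on_sub Ch => x [].
Qed.

Lemma smooth_germ_cst a (c : K) : smooth_germ a (fun=> c).
Proof. by exists setT; split => //; [exact: openT|apply: C_infty_on_cst; exact: openT]. Qed.

Lemma smooth_germD a g h : smooth_germ a g -> smooth_germ a h ->
  smooth_germ a (fun x => g x + h x).
Proof.
move=> Cg Ch; have [U [oU Ua {}Cg {}Ch]] := smooth_germ2 Cg Ch.
by exists U; split; [exact: oU|exact: Ua|exact: C_infty_onD].
Qed.

Lemma smooth_germM a g h : smooth_germ a g -> smooth_germ a h ->
  smooth_germ a (fun x => g x * h x).
Proof.
move=> Cg Ch; have [U [oU Ua {}Cg {}Ch]] := smooth_germ2 Cg Ch.
by exists U; split; [exact: oU|exact: Ua|exact: C_infty_onM].
Qed.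

Lemma smooth_germ_partial a g (i : 'I_n) :
  smooth_germ a g -> smooth_germ a ('D_(ee i) g).
Proof.
move=> [U [oU Ua Cg]].
by exists U; split; [exact: oU|exact: Ua|exact: C_infty_on_partial].
Qed.

Lemma smooth_germ_near a g h : (\forall x \near a, g x = h x) ->
  smooth_germ a g -> smooth_germ a h.
Proof.
move=> gh [U [oU Ua Cg]]; exists (U `&` [set x | g x = h x]^°); split.
- by apply: openI => //; exact: open_interior.
- by split.
- apply: (C_infty_on_eq (g := g)).
  + by apply: openI => //; exact: open_interior.
  + by move=> x [_ /interior_subset].
  + by apply: C_infty_on_sub Cg => x [].
Qed.

Lemma smooth_germ_ball a g : smooth_germ a g ->
  exists2 r : K, 0 < r & C_infty_on (ball a r) g.
Proof.
move=> [U [oU Ua Cg]].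
have /nbhs_ballP [r r0 rU] : nbhs a U by exact: open_nbhs_nbhs.
by exists r => //; exact: C_infty_on_sub Cg.
Qed.

Lemma smooth_germ_near_differentiable a g : smooth_germ a g ->
  \forall x \near a, differentiable g x.
Proof.
move=> [U [oU Ua Cg]]; have : nbhs a U by exact: open_nbhs_nbhs.
by apply: filterS => x Ux; have [] := C_infty_on_differentiable Kmvi oU Cg Ux.
Qed.

Lemma iter_partial_germ_linear s (c : K) g h a : smooth_germ a g -> smooth_germ a h ->
  iter_partial s (fun y => c * g y + h y) a =
    c * iter_partial s g a + iter_partial s h a.
Proof.
move=> Cg Ch; have [U [oU Ua {}Cg {}Ch]] := smooth_germ2 Cg Ch.
exact: iter_partial_linear oU Cg Ch Ua.
Qed.

Lemma vanishes_to_germM k g h a : smooth_germ a g -> smooth_germ a h ->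
  vanishes_to k g a -> vanishes_to k (fun y => g y * h y) a.
Proof.
move=> Cg Ch; have [U [oU Ua {}Cg {}Ch]] := smooth_germ2 Cg Ch.
exact: vanishes_toM oU Ua Cg Ch.
Qed.

End Closure.

Lemma smooth_germ_comp n p (f : 'rV[K]_n -> 'rV[K]_p) (psi : 'rV[K]_p -> K) a :
  (forall j, smooth_germ a (fun x => f x 0 j)) -> smooth_germ (f a) psi ->
  smooth_germ a (psi \o f).
Proof.
move=> Cf [V [oV Vfa Cpsi]].
have [U [oU Ua CU]] : exists U, [/\ open U, U a &
    forall j : 'I_p, C_infty_on U (fun x => f x 0 j)].
  have /choice [U UP] := Cf.
  exists ([set x | forall j, U j x]^°); split; first exact: open_interior.
    have H (j : 'I_p) : \forall x \near a, U j x.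
      by have [oUj Uja _] := UP j; exact: open_nbhs_nbhs.
    exact: (near_forall_ord _ H).
  by move=> j; have [_ _] := UP j; apply: C_infty_on_sub => x /interior_subset; exact.
have df x : U x -> differentiable f x.
  by move=> Ux; exact: (C_infty_on_differentiable_rV Kmvi oU CU Ux).
exists (U `&` (f @^-1` V)^°).
have oW : open (U `&` (f @^-1` V)^°) by apply: openI => //; exact: open_interior.
split => //.
- split => //; have /differentiable_continuous cf := df _ Ua.
  by apply: cf; exact: open_nbhs_nbhs.
- apply: (C_infty_on_comp Kmvi oW oV) => // [j|x [_ /interior_subset]] //.
  by apply: C_infty_on_sub (CU j) => x [].
Qed.

End SmoothGerms.

(** * Gluing germs at finitely many points *)

Section Gluing.
Context {K : numFieldType} {n : nat}.

Lemma common_radius (T : eqType) (s : seq T) (P : T -> K -> Prop) :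
  (forall a r r', P a r -> r' <= r -> P a r') ->
  (forall a, a \in s -> exists2 r, 0 < r & P a r) ->
  exists2 r, 0 < r & forall a, a \in s -> P a r.
Proof.
move=> Pd; elim: s => [|a s IH] H; first by exists 1.
have [b bs|r r0 rP] := IH; first by apply: H; rewrite inE bs orbT.
have [r' r'0 r'P] := H a (mem_head _ _).
case: (real_leP (gtr0_real r0) (gtr0_real r'0)) => L.
  exists r => // b; rewrite inE => /orP [/eqP ->|]; last exact: rP.
  exact: Pd r'P L.
exists r' => // b; rewrite inE => /orP [/eqP ->//|/rP H'].
by apply: Pd H' _; exact: ltW.
Qed.

Lemma separation_radius (s : seq 'rV[K]_n) : exists2 r : K, 0 < r &
  forall a b, a \in s -> b \in s -> a != b -> r <= `|a - b|.
Proof.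
have [|a as_|r r0 rP] := @common_radius _ s
  (fun a r => forall b, b \in s -> a != b -> r <= `|a - b|).
- by move=> a r r' H r'r b bs ab; apply: le_trans r'r _; exact: H.
- apply: common_radius => [b r r' H r'r ab|b bs].
    by apply: le_trans r'r _; exact: H.
  have [->|ab] := eqVneq a b; first by exists 1.
  by exists `|a - b| => //; rewrite normr_gt0 subr_eq0.
- by exists r => // a b as_ bs; exact: rP.
Qed.

(** Distinct points of [S] are at least [r] apart, so near [a] no other point of [S] is within
    [r / 2], and the search finds [a]. *)
Lemma glue_germs (T : Type) (S : set 'rV[K]_n) (F : 'rV[K]_n -> 'rV[K]_n -> T) :
  finite_set S -> exists G : 'rV[K]_n -> T,
    forall a, S a -> \forall x \near a, F a x = G x.
Proof.
move=> /finite_seqP [s ->]; have [r r0 rP] := separation_radius s.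
(* Far from [S] the search fails and [nth] returns its default 0; only values near [S] matter. *)
exists (fun x => F (nth 0 s (find (fun a => `|a - x| < r / 2) s)) x) => a /= as_.
apply/nearPadd; exists (r / 2) => [|h hr]; first by rewrite divr_gt0.
set k := find _ s.
have hk : has (fun b => `|b - (a + h)| < r / 2) s.
  by apply/hasP; exists a => //; rewrite opprD addNKr normrN.
have ks : nth 0 s k \in s by rewrite mem_nth // -has_find.
have kn := nth_find 0 hk; rewrite -/k in kn.
have [<-//|ka] := eqVneq (nth 0 s k) a.
have := rP _ _ ks as_ ka => H; exfalso.
have : `|nth 0 s k - a| < r.
  have -> : nth 0 s k - a = (nth 0 s k - (a + h)) + h by rewrite opprD !addrA subrK.
  by apply: le_lt_trans (ler_normD _ _) _; rewrite [r]splitr ltrD.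
by move=> /(le_lt_trans H); rewrite ltxx.
Qed.

End Gluing.

(** * Function germs at finitely many points and their jets *)

Section FunctionGerms.
Context {R : realType} {b : base_field}.
Local Notation K := (scalars R b).
Let Kmvi : mean_value_inequality K := scalars_mean_value_inequality.
Local Notation ee := basis_vec.

(** Smoothness is local, so the union of all open sets on which [g] is smooth serves all points of
    [S] at once. *)
Lemma function_germE n (S : set 'rV[K]_n) (g : 'rV[K]_n -> K) :
  function_germ S g <-> forall a, S a -> smooth_germ a g.
Proof.
split=> [[U [oU SU sg]] a Sa|H].
  by exists U; split; [exact: oU|exact: SU|exact/smooth_onE].
pose F := [set V : set 'rV[K]_n | open V /\ C_infty_on V g].
have oF : open (\bigcup_(V in F) V) by apply: bigcup_open => V [].
exists (\bigcup_(V in F) V); split; first exact: oF.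
  by move=> a /H [U [oU Ua Cg]]; exists U.
by apply/(smooth_onE _ oF) => s x [V [_ CV] Vx]; exact: CV.
Qed.

Lemma function_germ0E n (g : 'rV[K]_n -> K) :
  function_germ [set 0] g <-> smooth_germ 0 g.
Proof. by split=> [/function_germE|H]; [exact|apply/function_germE => a ->]. Qed.

Lemma m_powE n (S : set 'rV[K]_n) l (g : 'rV[K]_n -> K) :
  m_pow S l g <-> function_germ S g /\ forall a, S a -> vanishes_to l g a.
Proof.
split=> -[Cg vg]; split => //; first by move=> a Sa s sl; exact: vg.
by move=> s sl a Sa; exact: vg.
Qed.

Lemma germ_eq_sym n T (S : set 'rV[K]_n) (g h : 'rV[K]_n -> T) :
  germ_eq S g h -> germ_eq S h g.
Proof. by move=> gh a Sa; apply: filterS (gh a Sa) => x ->. Qed.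

Lemma function_germ_eq n (S : set 'rV[K]_n) (g h : 'rV[K]_n -> K) :
  germ_eq S g h -> function_germ S g -> function_germ S h.
Proof.
move=> gh /function_germE Cg; apply/function_germE => a Sa.
exact: smooth_germ_near (gh a Sa) (Cg a Sa).
Qed.

Lemma function_germD n (S : set 'rV[K]_n) (g h : 'rV[K]_n -> K) :
  function_germ S g -> function_germ S h -> function_germ S (fun x => g x + h x).
Proof.
move=> /function_germE Cg /function_germE Ch; apply/function_germE => a Sa.
by apply: smooth_germD; [exact: Cg|exact: Ch].
Qed.

Lemma function_germM n (S : set 'rV[K]_n) (g h : 'rV[K]_n -> K) :
  function_germ S g -> function_germ S h -> function_germ S (fun x => g x * h x).
Proof.
move=> /function_germE Cg /function_germE Ch; apply/function_germE => a Sa.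
by apply: smooth_germM; [exact: Cg|exact: Ch].
Qed.

Lemma function_germ_cst n (S : set 'rV[K]_n) (c : K) : function_germ S (fun=> c).
Proof. by apply/function_germE => a _; exact: smooth_germ_cst. Qed.

Lemma function_germ_comp n p (S : set 'rV[K]_n) (f : 'rV[K]_n -> 'rV[K]_p)
    (psi : 'rV[K]_p -> K) :
  multigerm S f -> function_germ [set 0] psi -> function_germ S (psi \o f).
Proof.
move=> [Cf f0] /function_germ0E Cpsi; apply/function_germE => a Sa.
apply: (smooth_germ_comp Kmvi); last by rewrite f0.
by move=> j; exact: ((function_germE _ _).1 (Cf j)).
Qed.

Lemma m_powM n (S : set 'rV[K]_n) l (g h : 'rV[K]_n -> K) :
  m_pow S l g -> function_germ S h -> m_pow S l (fun x => g x * h x).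
Proof.
move=> /m_powE [Cg vg] Ch; apply/m_powE; split; first exact: function_germM.
move=> a Sa; apply: vanishes_to_germM; last exact: vg.
  exact: ((function_germE _ _).1 Cg).
exact: ((function_germE _ _).1 Ch).
Qed.

(** A word denotes at each point of [S] the monomial centred there. Gluing these over [S], and
    likewise the Hadamard quotients, gives one generator per word whatever the number of points. *)
Lemma m_pow_monomials n (S : set 'rV[K]_n) l : finite_set S ->
  exists2 mu : word n l -> 'rV[K]_n -> K, forall w, m_pow S l (mu w) &
    forall g, m_pow S l g -> exists2 q : word n l -> 'rV[K]_n -> K,
      forall w, function_germ S (q w) &
      germ_eq S g (fun x => \sum_w mu w x * q w x).
Proof.
move=> finS.
have /choice [mu muE] : forall w : word n l, exists G : 'rV[K]_n -> K,
    forall a, S a -> \forall x \near a, monomial a w x = G x.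
  by move=> w; exact: (glue_germs (fun a => monomial a w)).
exists mu => [w|g /m_powE [/function_germE Cg vg]].
  apply/m_powE; split=> [|a Sa].
    apply/function_germE => a Sa; apply: smooth_germ_near (muE w a Sa) _.
    exists (ball a 1); split; [exact: ball_open|exact: ballxx|].
    exact: C_infty_on_monomial.
  apply: vanishes_to_near (muE w a Sa) _.
  exact: (@vanishes_to_monomial K n a 1 ltr01 l w).
have loc a : exists q : word n l -> 'rV[K]_n -> K, S a ->
    (forall w, smooth_germ a (q w)) /\
    \forall x \near a, g x = \sum_w monomial a w x * q w x.
  have [Sa|nSa] := pselect (S a); last by exists (fun _ _ => 0).
  have [r r0 CB] := smooth_germ_ball (Cg a Sa).
  have [q Cq gE] := hadamard_monomial Kmvi r0 CB (vg a Sa).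
  exists q => _; split=> [w|].
    by exists (ball a r); split; [exact: ball_open|exact: ballxx|exact: Cq].
  have : nbhs a (ball a r) by exact: nbhsx_ballx.
  by apply: filterS => x /gE.
have /choice [Q QP] := loc.
have /choice [q qE] : forall w : word n l, exists G : 'rV[K]_n -> K,
    forall a, S a -> \forall x \near a, Q a w x = G x.
  by move=> w; exact: (glue_germs (fun a => Q a w)).
exists q => [w|a Sa].
  apply/function_germE => a Sa; apply: smooth_germ_near (qE w a Sa) _.
  exact: (QP a Sa).1.
have H (w : word n l) : \forall x \near a, monomial a w x = mu w x /\ Q a w x = q w x.
  by apply: filterI; [exact: muE|exact: qE].
have HA : \forall x \near a, forall w : word n l, monomial a w x = mu w x /\ Q a w x = q w x.
  exact: (@filter_forall _ (word n l) (fun w x => monomial a w x = mu w x /\ Q a w x = q w x) _ _ H).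
apply: filterS2 (QP a Sa).2 HA => x -> Hx.
by apply: eq_bigr => w _; have [-> ->] := Hx w.
Qed.

Lemma bounded_words n l : exists L : seq (seq 'I_n),
  forall s : seq 'I_n, (size s < l)%N -> s \in L.
Proof.
elim: l => [|l [L LP]]; first by exists [::].
exists ([::] :: [seq i :: s | i <- enum 'I_n, s <- L]) => -[//|i s] /= sl.
rewrite inE; apply/orP; right; apply/allpairsP; exists (i, s).
by split; rewrite ?mem_enum //=; exact: LP.
Qed.

Lemma m_pow_finite_codimension n (S : set 'rV[K]_n) l : finite_set S ->
  exists (N : nat) (u : 'I_N -> 'rV[K]_n -> K), (forall k, function_germ S (u k)) /\
    forall g, function_germ S g -> exists c : 'I_N -> K,
      m_pow S l (fun x => g x - \sum_k c k * u k x).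
Proof.
move=> /finite_seqP [pts SE]; have [L LP] := bounded_words n l.
(* The value 0 away from [S] makes [J t] linear on germs for every index [t], including points where
   the representatives need not be smooth. *)
pose J (t : seq 'I_n * 'rV[K]_n) (g : 'rV[K]_n -> K^o) : K :=
  if t.2 \in pts then iter_partial t.1 (g : 'rV[K]_n -> K) t.2 else 0.
have Sp a : S a <-> a \in pts by rewrite SE.
have [||N [u [Cu uP]]] := @finite_codimension K ('rV[K]_n -> K^o) _ J
  [seq (s, a) | s <- L, a <- pts] (function_germ S).
- by move=> c g h Cg Ch; apply: function_germD => //; apply: function_germM => //;
    exact: function_germ_cst.
- move=> [s a] c g h Cg Ch; rewrite /J /=; case: ifP => [/Sp Sa|_]; last by rewrite mulr0 addr0.
  apply: iter_partial_germ_linear.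
    exact: ((function_germE _ _).1 Cg).
  exact: ((function_germE _ _).1 Ch).
exists N, u; split => // g Cg; have [c [Cc cP]] := uP g Cg; exists c.
have E : (fun x => g x - \sum_k c k * u k x) = (g : 'rV[K]_n -> K^o) - \sum_k c k *: u k.
  apply/funext => x; rewrite -[RHS]/(g x - (\sum_k c k *: u k) x); congr (_ - _).
  by rewrite fct_sumE.
rewrite E; split => // s sl a Sa.
have := cP (s, a); rewrite /J /=; have ap := (Sp a).1 Sa.
by rewrite ap; apply; apply/allpairsP; exists (s, a); split => //; exact: LP.
Qed.

End FunctionGerms.

(** * The module of lowerable vector fields *)

Lemma germ_eqW (R : realType) (b : base_field) n T (S : set 'rV[scalars R b]_n)
    (g h : 'rV[scalars R b]_n -> T) : (forall x, g x = h x) -> germ_eq S g h.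
Proof.
by move=> gh a _; near=> x; exact: gh.
Unshelve. all: by end_near. Qed.

Section LowerModule.
Context {R : realType} {b : base_field} {n p : nat}.
Local Notation K := (scalars R b).
Let Kmvi : mean_value_inequality K := scalars_mean_value_inequality.
Local Notation ee := basis_vec.
Variables (S : set 'rV[K]_n) (f : 'rV[K]_n -> 'rV[K]_p).
Hypotheses (p_gt0 : (0 < p)%N) (finS : finite_set S) (f_multigerm : multigerm S f).

Lemma m_pow_pullback l (h : 'rV[K]_n -> K) :
  m_pow_theta S f l `<=` TLe S f -> m_pow S l h ->
  exists2 psi, function_germ [set 0] psi & germ_eq S h (psi \o f).
Proof.
move=> lS mh; pose j0 := Ordinal p_gt0.
have [|eta Ceta etaE] := lS (fun x => h x *: ee j0).
  exists 1%N, (fun=> h), (fun=> fun=> ee j0); split => // [_ j|].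
    exact: function_germ_cst.
  by apply: germ_eqW => x; rewrite big_ord1.
exists (fun y => eta y 0 j0) => [|a Sa]; first exact: Ceta.
apply: filterS (etaE a Sa) => x /(congr1 (fun v : 'rV[K]_p => v 0 j0)).
by rewrite !mxE !eqxx mulr1.
Qed.

Lemma function_germs_finitely_generated l : m_pow_theta S f l `<=` TLe S f ->
  exists (N : nat) (u : 'I_N -> 'rV[K]_n -> K), (forall k, function_germ S (u k)) /\
    forall g, function_germ S g ->
      exists2 phi : 'I_N -> 'rV[K]_p -> K, forall k, function_germ [set 0] (phi k) &
        germ_eq S g (fun x => \sum_k phi k (f x) * u k x).
Proof.
move=> lS; have [N [u [Cu uP]]] := m_pow_finite_codimension l finS.
exists N.+1, (fun k => oapp u (fun=> 1) (unlift ord0 k)); split=> [k|g Cg].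
  by case: unliftP => [j _|_] /=; [exact: Cu|exact: function_germ_cst].
have [c mc] := uP g Cg; have [psi Cpsi psiE] := m_pow_pullback lS mc.
(* The pullback [psi] is the coefficient of the generator 1; the other coefficients are
   constants. *)
exists (fun k => oapp (fun j => fun=> c j) psi (unlift ord0 k)) => [k|a Sa].
  by case: unliftP => [j _|_] //=; exact: function_germ_cst.
apply: filterS (psiE a Sa) => x /eqP; rewrite subr_eq => /eqP ->.
rewrite big_ord_recl unlift_none /= mulr1; congr (_ + _).
by apply: eq_bigr => k _; rewrite liftK.
Qed.

Lemma m_pow_finitely_generated l : m_pow_theta S f l `<=` TLe S f ->
  exists (I : finType) (beta : I -> 'rV[K]_n -> K), (forall i, m_pow S l (beta i)) /\
    forall g, m_pow S l g ->
      exists2 phi : I -> 'rV[K]_p -> K, forall i, function_germ [set 0] (phi i) &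
        germ_eq S g (fun x => \sum_i phi i (f x) * beta i x).
Proof.
move=> lS; have [mu mmu muP] := @m_pow_monomials R b n S l finS.
have [N [u [Cu uP]]] := function_germs_finitely_generated lS.
exists (word n l * 'I_N)%type, (fun i x => mu i.1 x * u i.2 x); split=> [i|g mg].
  exact: m_powM.
have [q Cq qE] := muP g mg.
have /choice [Phi PhiP] : forall w, exists phi : 'I_N -> 'rV[K]_p -> K,
    (forall k, function_germ [set 0] (phi k)) /\
    germ_eq S (q w) (fun x => \sum_k phi k (f x) * u k x).
  by move=> w; have [phi] := uP _ (Cq w); exists phi.
exists (fun i => Phi i.1 i.2) => [i|a Sa]; first exact: (PhiP i.1).1.
have HA : \forall x \near a, forall w : word n l,
    q w x = \sum_k Phi w k (f x) * u k x.
  exact: (@filter_forall _ (word n l)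
    (fun w x => q w x = \sum_k Phi w k (f x) * u k x) _ _ (fun w => (PhiP w).2 a Sa)).
apply: filterS2 (qE a Sa) HA => x -> Hx.
under eq_bigr => w _ do rewrite Hx mulr_sumr.
rewrite pair_bigA /=; apply: eq_bigr => w _; by rewrite mulrCA.
Qed.

(** Membership of [tf f xi] in [TRe S f] is witnessed by [xi] itself. *)
Lemma Lower_TLe xi : theta S id xi -> TLe S f (tf f xi) -> Lower S f xi.
Proof. by move=> Cxi H; split => //; split => //; exists xi => //; exact: germ_eqW. Qed.

Lemma Lower_germ_eq xi zeta : germ_eq S xi zeta -> Lower S f xi -> Lower S f zeta.
Proof.
move=> E [Cxi [_ [eta Ceta etaE]]]; apply: Lower_TLe.
  move=> j; apply: function_germ_eq (Cxi j) => a Sa.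
  by apply: filterS (E a Sa) => x ->.
exists eta => // a Sa; apply: filterS2 (E a Sa) (etaE a Sa) => x xiE.
by rewrite /tf xiE.
Qed.

Lemma Lower0 : Lower S f (fun=> 0).
Proof.
apply: Lower_TLe => [j|].
  by under eq_fun do rewrite mxE; exact: function_germ_cst.
exists (fun=> 0) => [j|].
  by under eq_fun do rewrite mxE; exact: function_germ_cst.
by apply: germ_eqW => x; rewrite /tf linear0.
Qed.

Lemma Lower_act_add (psi : 'rV[K]_p -> K) xi zeta : function_germ [set 0] psi ->
  Lower S f xi -> Lower S f zeta ->
  Lower S f (fun x => act_via f psi xi x + zeta x).
Proof.
move=> Cpsi [Cxi [_ [eta Ceta etaE]]] [Czeta [_ [eta' Ceta' etaE']]].
apply: Lower_TLe => [j|].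
  under eq_fun do rewrite !mxE; apply: function_germD => //.
  by apply: function_germM => //; exact: function_germ_comp.
exists (fun y => psi y *: eta y + eta' y) => [j|a Sa].
  by under eq_fun do rewrite !mxE; apply: function_germD => //; exact: function_germM.
apply: filterS2 (etaE a Sa) (etaE' a Sa) => x.
by rewrite /tf /omegaf /act_via /= => H H'; rewrite linearP H H'.
Qed.

Lemma Lower_act_sum (N : nat) (psi : 'I_N -> 'rV[K]_p -> K) e :
  (forall k, function_germ [set 0] (psi k)) -> (forall k, Lower S f (e k)) ->
  Lower S f (fun x => \sum_k act_via f (psi k) (e k) x).
Proof.
elim: N psi e => [|N IH] psi e Cpsi Le.
  by under eq_fun do rewrite big_ord0; exact: Lower0.
under eq_fun do rewrite big_ord_recl; apply: Lower_act_add => //.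
exact: IH.
Qed.

(** [tf f] sends the field [h *: ee i] to [h] times the [i]-th partial derivative of [f], a product
    in [m_pow_theta S f l], which determinacy places in [TLe S f]. *)
Lemma Lower_m_pow l (h : 'rV[K]_n -> K) (i : 'I_n) :
  m_pow_theta S f l `<=` TLe S f -> m_pow S l h ->
  Lower S f (fun x => h x *: ee i).
Proof.
move=> lS mh; have [Ch _] := (m_powE _ _ _).1 mh; apply: Lower_TLe => [j|].
  under eq_fun do rewrite !mxE; apply: function_germM => //.
  exact: function_germ_cst.
pose zeta x : 'rV[K]_p := \row_j 'D_(ee i) (fun y => f y 0 j) x.
apply: lS; exists 1%N, (fun=> h), (fun=> zeta); split => // [_ j|a Sa].
  under eq_fun do rewrite mxE; apply/function_germE => a Sa.
  by apply: smooth_germ_partial; exact: ((function_germE _ _).1 (f_multigerm.1 j)).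
have df (j : 'I_p) : \forall x \near a, differentiable (fun y => f y 0 j : K) x.
  by apply: (smooth_germ_near_differentiable Kmvi); exact: ((function_germE _ _).1 (f_multigerm.1 j)).
apply: filterS (near_forall_ord _ df) => x dfx.
rewrite big_ord1 /tf linearZ; congr (_ *: _); apply/rowP => j.
rewrite mxE diff_coordE; last exact: differentiable_rV.
by rewrite deriveE.
Qed.

Lemma finite_generation_finType (M : set ('rV[K]_n -> 'rV[K]_n)) (I : finType)
    (e : I -> 'rV[K]_n -> 'rV[K]_n) :
  (forall i, M (e i)) ->
  (forall N (psi : 'I_N -> 'rV[K]_p -> K) (e : 'I_N -> 'rV[K]_n -> 'rV[K]_n) xi,
    (forall k, function_germ [set 0] (psi k)) -> (forall k, M (e k)) ->
    germ_eq S xi (fun x => \sum_k act_via f (psi k) (e k) x) -> M xi) ->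
  (forall xi, M xi -> exists2 psi : I -> 'rV[K]_p -> K,
     forall i, function_germ [set 0] (psi i) &
     germ_eq S xi (fun x => \sum_i act_via f (psi i) (e i) x)) ->
  finitely_generated_via S f M.
Proof.
move=> Me Mclosed Mgen; exists #|I|, (fun k => e (enum_val k)); split=> [k|xi].
  exact: Me.
split=> [/Mgen [psi Cpsi E]|[psi Cpsi E]].
  exists (fun k => psi (enum_val k)) => [k|a Sa]; first exact: Cpsi.
  apply: filterS (E a Sa) => x ->.
  by rewrite (reindex _ (onW_bij _ (@enum_val_bij I))).
by apply: Mclosed E => // k; exact: Me.
Qed.

End LowerModule.

Section LowerGenerators.
Context {R : realType} {b : base_field} {n p : nat}.
Local Notation K := (scalars R b).
Local Notation ee := basis_vec.

(** [finite_codimension] is applied to [Lower S f] itself, so the finitely many correcting fields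
    are lowerable. The functionals are the derivatives of order less than [l] of each component at
    each point of [S]. *)
Lemma Lower_finite_codimension (S : set 'rV[K]_n) (f : 'rV[K]_n -> 'rV[K]_p) l :
  finite_set S -> multigerm S f ->
  exists (N : nat) (e : 'I_N -> 'rV[K]_n -> 'rV[K]_n), (forall k, Lower S f (e k)) /\
    forall xi, Lower S f xi -> exists c : 'I_N -> K,
      forall j, m_pow S l (fun x => (xi x - \sum_k c k *: e k x) 0 j).
Proof.
move=> finS mf; have := finS; move=> /finite_seqP [pts SE].
have [L LP] := bounded_words n l.
have Sp a : S a <-> a \in pts by rewrite SE.
pose J (t : seq 'I_n * 'rV[K]_n * 'I_n) (xi : 'rV[K]_n -> 'rV[K]_n) : K :=
  if t.1.2 \in pts then iter_partial t.1.1 (fun x => xi x 0 t.2) t.1.2 else 0.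
have lin (c : K) xi zeta : Lower S f xi -> Lower S f zeta -> Lower S f (c *: xi + zeta).
  move=> Lxi Lzeta.
  exact: (Lower_act_add mf (function_germ_cst _ c) Lxi Lzeta).
have [||N [e [Le eP]]] := @finite_codimension K ('rV[K]_n -> 'rV[K]_n) _ J
  [seq (sa, j) | sa <- [seq (s, a) | s <- L, a <- pts], j <- enum 'I_n] (Lower S f).
- exact: lin.
- move=> [[s a] j] c xi zeta [Cxi _] [Czeta _]; rewrite /J /=.
  case: ifP => [/Sp Sa|_]; last by rewrite mulr0 addr0.
  have -> : (fun x => (c *: xi + zeta) x 0 j) = (fun x => c * xi x 0 j + zeta x 0 j).
    by apply/funext => x; rewrite !mxE.
  apply: iter_partial_germ_linear.
    exact: ((function_germE _ _).1 (Cxi j)).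
  exact: ((function_germE _ _).1 (Czeta j)).
exists N, e; split => // xi Lxi; have [c [Lc cP]] := eP xi Lxi; exists c => j.
have E : (fun x => (xi x - \sum_k c k *: e k x) 0 j) =
    (fun x => (xi - \sum_k c k *: e k) x 0 j).
  apply/funext => x; rewrite -[(xi - _) x]/(xi x - (\sum_k c k *: e k) x).
  by rewrite fct_sumE.
rewrite E; split; first by have [Cc _] := Lc; exact: Cc.
move=> s sl a Sa; have := cP (s, a, j); rewrite /J /=.
have -> := (Sp a).1 Sa; apply; apply/allpairsP; exists (s, a, j).
split; rewrite ?mem_enum //=; apply/allpairsP; exists (s, a).
by split; [exact: LP|exact/Sp|].
Qed.

End LowerGenerators.

Theorem corollary1 (R : realType) (b : base_field) (n p r : nat)
    (S : set 'rV[scalars R b]_n)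
    (f : 'rV[scalars R b]_n -> 'rV[scalars R b]_p)
    (p_gt0 : (0 < p)%N)
    (card_S : (S #= `I_r)%card)
    (f_multigerm : multigerm S f)
    (f_fin_det : finitely_L_determined S f) :
  finitely_generated_via S f (Lower S f).
Proof.
have finS : finite_set S by exists r.
have [l _ lS] := f_fin_det.
have [I [beta [mbeta betaP]]] := m_pow_finitely_generated p_gt0 finS lS.
have [N [e [Le eP]]] := Lower_finite_codimension l finS f_multigerm.
(* The [e k] span [Lower S f] modulo fields with components in [m_pow S l], and the other generators
   produce these fields component by component. *)
pose gen (i : 'I_N + I * 'I_n) x := match i with
  | inl k => e k x
  | inr tj => beta tj.1 x *: basis_vec tj.2
  end.
apply: (@finite_generation_finType _ _ _ _ S f _ _ gen).
- by case=> [k|tj]; [exact: Le|exact: (Lower_m_pow f_multigerm _ lS)].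
- move=> N' psi e' xi Cpsi Le' E; apply: Lower_germ_eq (germ_eq_sym E) _.
  exact: (Lower_act_sum f_multigerm).
move=> xi Lxi; have [c mc] := eP xi Lxi.
have /choice [Phi PhiP] : forall j, exists phi : I -> 'rV[scalars R b]_p -> scalars R b,
    (forall i, function_germ [set 0] (phi i)) /\
    germ_eq S (fun x => (xi x - \sum_k c k *: e k x) 0 j)
      (fun x => \sum_i phi i (f x) * beta i x).
  by move=> j; have [phi] := betaP _ (mc j); exists phi.
exists (fun i : 'I_N + I * 'I_n => match i with
  | inl k => fun=> c k
  | inr tj => Phi tj.2 tj.1
  end) => [[k|tj]|a Sa].
- exact: function_germ_cst.
- exact: (PhiP tj.2).1.
have H (j : 'I_n) := (PhiP j).2 a Sa.
apply: filterS (near_forall_ord _ H) => x Hx.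
(* [xi] is the sum of its correction by the [e k], with constant coefficients, and of a remainder
   that is matched in each coordinate. *)
rewrite big_sumType /= -[LHS](subrK (\sum_k c k *: e k x)) addrC; congr (_ + _).
have -> : \sum_(tj : I * 'I_n) act_via f (Phi tj.2 tj.1) (gen (inr tj)) x =
    \sum_t \sum_j (Phi j t (f x) * beta t x) *: basis_vec j.
  by rewrite pair_bigA; apply: eq_bigr => tj _; rewrite /act_via /gen scalerA.
apply/rowP => j; rewrite Hx summxE; apply: eq_bigr => t _.
rewrite summxE (bigD1 j) //= !mxE !eqxx mulr1 big1 ?addr0 // => k kj.
by rewrite !mxE eqxx /= eq_sym (negPf kj) !mulr0.
Qed.
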